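(* Let $n\ge3$, let $\pm$ be a sign, and let $C_0>0$ and $\sigma,\sigma_0>0$ be arbitrary. Then there exist a sequence $V_m:\mathbf{R}^n\to\mathbf{R}$ of spherically symmetric potentials obeying the uniform bounds $$\sup_m\|\langle x\rangle^{1+\sigma_0}\nabla_x^\alpha V_m\|_{L^\infty(\mathbf{R}^n)}<\infty\quad\text{for all }\alpha\ge0,$$ sequences $\lambda_m\to0^+$ and $\varepsilon_m\to0^+$ of real numbers with $0<\varepsilon_m<\lambda_m$, and functions $f_m\in H^{0,1/2+\sigma}(\mathbf{R}^n)$, such that if $H_m:=-\Delta+V_m$ then $H_m$ has no resonance or eigenfunction at zero, and $$\|R(\lambda_m\pm i\varepsilon_m)f_m\|_{H^{0,-1/2-\sigma}(\mathbf{R}^n)}>\lambda_m^{-C_0}\|f_m\|_{H^{0,1/2+\sigma}(\mathbf{R}^n)}$$ for all $m$, where $R(\lambda_m\pm i\varepsilon_m):=(H_m-(\lambda_m\pm i\varepsilon_m))^{-1}$.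
   Context: On $\mathbf{R}^n$, $\langle x\rangle:=(1+|x|^2)^{1/2}$ and $\|f\|_{H^{0,m}(\mathbf{R}^n)}:=\|\langle x\rangle^mf\|_{L^2(\mathbf{R}^n)}$. An eigenfunction of $H_m$ at zero is a nonzero $u\in L^2(\mathbf{R}^n)$ with $H_mu=0$. $H_m$ has a resonance at zero if the equation $H_mu=0$ has a solution $u\in H^{0,-3/2+\sigma}(\mathbf{R}^n)$ for some $\sigma>0$ such that $u\notin\bigcup_{\sigma>0}H^{0,-1/2+\sigma}(\mathbf{R}^n)$ and $\partial_ru\in H^{0,-1/2+\sigma'}(\mathbf{R}^n)$ for some $\sigma'>0$, where $\partial_r=\frac{x}{|x|}\cdot\nabla_x$. *)

(* Defs.v *)
From HB Require Import structures.
From mathcomp Require Import all_boot all_order all_algebra.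
From mathcomp Require Import complex.
From mathcomp Require Import all_classical all_reals all_analysis.
Set Implicit Arguments.
Unset Strict Implicit.
Unset Printing Implicit Defensive.
Import Order.TTheory GRing.Theory Num.Theory.
Import numFieldNormedType.Exports.
Local Open Scope classical_set_scope.
Local Open Scope ring_scope.
Local Open Scope complex_scope.

(* R^n is 'rV[R]_n.  The library gives it its (product) topology, but no
   sigma-algebra and no Lebesgue measure; both are built here.  Beware that the
   library norm `|x| on 'rV[R]_n is the sup norm, so the Euclidean norm is a
   separate definition below. *)

Section borel_rV.
Context {R : realType} (n : nat).

Let coord (i : 'I_n) (x : 'rV[R]_n) : R := x 0 i.

Let rV_set0 : g_sigma_preimage coord set0.
Proof. exact: sigma_algebra0. Qed.

Let rV_setC A : g_sigma_preimage coord A -> g_sigma_preimage coord (~` A).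
Proof. exact: sigma_algebraC. Qed.

Let rV_bigcup (F : (set 'rV[R]_n)^nat) :
  (forall i, g_sigma_preimage coord (F i)) ->
  g_sigma_preimage coord (\bigcup_i (F i)).
Proof. exact: sigma_algebra_bigcup. Qed.

(* The sigma-algebra generated by the coordinates, i.e. the Borel one. *)
HB.instance Definition _ := @isMeasurable.Build
  (measure_tuple_display default_measure_display)
  'rV[R]_n (g_sigma_preimage coord) rV_set0 rV_setC rV_bigcup.

Lemma measurable_coord (i : 'I_n) :
  measurable_fun [set: 'rV[R]_n] (fun x : 'rV[R]_n => x 0 i : R).
Proof.
move=> _ Y mY; rewrite setTI; apply: sub_sigma_algebra => /=.
rewrite -bigcup_seq/=; exists i => /=; first by rewrite mem_index_enum.
by exists Y => //; rewrite setTI.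
Qed.

Lemma measurable_fun_coordP d (T : measurableType d) (f : T -> 'rV[R]_n) :
  (forall i, measurable_fun [set: T] (fun t => f t 0 i : R)) ->
  measurable_fun [set: T] f.
Proof.
move=> mf; pose G := [set A : set 'rV[R]_n | measurable (f @^-1` A)].
have sG : sigma_algebra setT G.
  split; first by rewrite /G /= preimage_set0; exact: measurable0.
  - by move=> A mA; rewrite /G /= setTD preimage_setC; exact: measurableC.
  - by move=> F mF; rewrite /G /= preimage_bigcup; exact: bigcupT_measurable.
move=> _ Y mY; rewrite setTI.
suff: G Y by [].
apply: (smallest_sub sG _ mY) => A.
rewrite -bigcup_seq/= => -[i _ [B mB <-]].
rewrite /G /= setTI -comp_preimage -[X in measurable X]setTI.
exact: mf.
Qed.

End borel_rV.

Section lebesgue_rV.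
Context {R : realType}.

Definition rcons_rV n (p : 'rV[R]_n * R) : 'rV[R]_n.+1 :=
  \row_(i < n.+1) (if unlift ord_max i is Some j then p.1 0 j else p.2).

Lemma measurable_rcons_rV n :
  measurable_fun [set: 'rV[R]_n * measurableTypeR R] (@rcons_rV n).
Proof.
apply: measurable_fun_coordP => i.
rewrite /rcons_rV; under eq_fun do rewrite mxE.
case: unliftP => [j _|_]; last exact: measurable_snd.
apply: (@measurableT_comp _ _ _ _ _ _ (fun x : 'rV[R]_n => x 0 j : R)).
  exact: measurable_coord.
exact: measurable_fst.
Qed.

(* Lebesgue measure on R^n: lebesgue_rV k.+1 is the image of the product of
   lebesgue_rV k with the one-dimensional measure under rcons_rV.  The long name
   is the library's measure structure on a pushforward, which takes the
   measurability of the map as an argument. *)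
Fixpoint lebesgue_rV n : {measure set 'rV[R]_n -> \bar R} :=
  match n with
  | 0 => \d_(0 : 'rV[R]_0)
  | k.+1 => measure_function_pushforward__canonical__measure_function_Measure
      (lebesgue_rV k \x lebesgue_measure)%E (@measurable_rcons_rV k)
  end.

Lemma lebesgue_rV_box n (A : 'I_n -> set R) :
  (forall i, measurable (A i)) ->
  lebesgue_rV n [set x | forall i, A i (x 0 i)] =
  (\prod_(i < n) (lebesgue_measure (A i)))%E.
Proof.
elim: n A => [|n IH] A mA.
  by rewrite big_ord0 /= diracE mem_set//= => -[].
rewrite big_ord_recr /=.
rewrite -(IH (fun i => A (widen_ord (leqnSn n) i))); last first.
  by move=> i; exact: mA.
have mbox : measurable [set x : 'rV[R]_n |
    forall i, A (widen_ord (leqnSn n) i) (x 0 i)].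
  rewrite [X in measurable X](_ : _ = \bigcap_(i in [set: 'I_n])
      ((fun x : 'rV[R]_n => x 0 i : R) @^-1` A (widen_ord (leqnSn n) i))).
    apply: fin_bigcap_measurable => [|i _]; first exact: finite_finset.
    rewrite -[X in measurable X]setTI.
    exact: (measurable_coord i measurableT (mA (widen_ord (leqnSn n) i))).
  by apply/seteqP; split => [x h i _|x h i]; exact: h.
rewrite -[RHS](@product_measure1E _ _ _ _ _ (lebesgue_rV n) lebesgue_measure
  _ _ mbox (mA ord_max)).
rewrite /pushforward /=; congr ((_ \x _)%E _).
apply/seteqP; split => [[x t] /= h|[x t] /= [h1 h2] i].
  split=> [i|]; last first.
    by have := h ord_max; rewrite mxE unlift_none.
  have := h (lift ord_max i); rewrite mxE liftK /=.
  suff -> : lift ord_max i = widen_ord (leqnSn n) i by [].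
  by apply/val_inj => /=; rewrite /bump leqNgt ltn_ord.
rewrite mxE; case: unliftP => [j ->|-> //] /=.
suff -> : lift ord_max j = widen_ord (leqnSn n) j by [].
by apply/val_inj => /=; rewrite /bump leqNgt ltn_ord.
Qed.

End lebesgue_rV.

Section defs.
Context {R : realType} {n : nat}.
Local Notation rV := 'rV[R]_n.
Local Notation mu := (lebesgue_rV (R := R) n).

Definition enorm (x : rV) : R := Num.sqrt (\sum_(i < n) x 0 i ^+ 2).

Definition japanese (x : rV) : R := Num.sqrt (1 + enorm x ^+ 2).

Definition basis_vec (i : 'I_n) : rV := delta_mx 0 i.

(* Iterated partial derivative: s lists the directions, so that the tensor
   nabla^k f consists of the partials s f with size s = k. *)
Definition partials (s : seq 'I_n) (f : rV -> R^o) : rV -> R^o :=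
  foldr (fun i g => 'D_(basis_vec i) g) f s.

Definition smooth (f : rV -> R^o) : Prop :=
  forall s : seq 'I_n, continuous (partials s f) /\
    forall (i : 'I_n) (x : rV), derivable (partials s f) x (basis_vec i).

Definition laplacian (f : rV -> R^o) : rV -> R :=
  fun x => \sum_(i < n) partials [:: i; i] f x.

Definition test_function (phi : rV -> R^o) : Prop :=
  smooth phi /\ compact (closure [set x | phi x != 0]).

Definition radial (V : rV -> R) : Prop :=
  forall x y, enorm x = enorm y -> V x = V y.

Definition cabs (z : R[i]) : R := ComplexField.Normc.normc z.

Definition cmeasurable (u : rV -> R[i]) : Prop :=
  measurable_fun setT (fun x => complex.Re (u x)) /\
  measurable_fun setT (fun x => complex.Im (u x)).

(* The norm of H^{0,s}; it is +oo when < x >^s u is not in L^2. *)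
Definition wnorm (s : R) (u : rV -> R[i]) : \bar R :=
  ('N[mu]_2%:E[(fun x => (japanese x `^ s * cabs (u x))%R%:E)])%E.

Definition H0 (s : R) : set (rV -> R[i]) :=
  [set u | cmeasurable u /\ (wnorm s u < +oo)%E].

(* L^2(R^n): the weight is 1 *)
Definition L2 : set (rV -> R[i]) := H0 0.

Definition locally_L1 (u : rV -> R[i]) : Prop :=
  forall r : R,
    mu.-integrable [set x | enorm x <= r] (fun x => (complex.Re (u x))%:E) /\
    mu.-integrable [set x | enorm x <= r] (fun x => (complex.Im (u x))%:E).

(* The integral of u * phi.  Pairing with real-valued phi is enough to
   identify the distribution u. *)
Definition pairing (u : rV -> R[i]) (phi : rV -> R) : R[i] :=
  Complex (\int[mu]_x (complex.Re (u x) * phi x))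
          (\int[mu]_x (complex.Im (u x) * phi x)).

(* (- Delta + V) u = g in the sense of distributions. *)
Definition schrodinger_eq (V : rV -> R) (u g : rV -> R[i]) : Prop :=
  forall phi, test_function phi ->
    pairing u (fun x => - laplacian phi x + V x * phi x) = pairing g phi.

(* u is in the domain of the operator H = - Delta + V on L^2, and H u = g.  For
   bounded real V the self-adjoint realisation of - Delta + V has domain
   H^2(R^n), which is exactly the set of the u in L^2 with - Delta u + V u
   (taken as a distribution) in L^2. *)
Definition operator_graph (V : rV -> R) (u g : rV -> R[i]) : Prop :=
  [/\ L2 u, L2 g & schrodinger_eq V u g].

(* (H - z)^{-1} f: the u in the domain of H with H u = f + z u.  It is unique up
   to a null set when z is in the resolvent set; xget selects a representative,
   and the dummy value 0 is returned if f is not in the range of H - z. *)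
Definition resolvent (V : rV -> R) (z : R[i]) (f : rV -> R[i]) : rV -> R[i] :=
  xget (fun=> 0) [set u | operator_graph V u (fun x => f x + z * u x)].

Definition weak_partial (i : 'I_n) (u w : rV -> R[i]) : Prop :=
  locally_L1 w /\ forall phi, test_function phi ->
    pairing u ('D_(basis_vec i) phi) = - pairing w phi.

(* v = (x / |x|) . nabla u, with the weak gradient of u. *)
Definition radial_derivative (u v : rV -> R[i]) : Prop :=
  exists2 w : 'I_n -> rV -> R[i], forall i, weak_partial i u (w i) &
    v = fun x => \sum_(i < n) (x 0 i / enorm x)%:C * w i x.

Definition zero_eigenfunction (V : rV -> R) (u : rV -> R[i]) : Prop :=
  operator_graph V u (fun=> 0) /\ ~ (u = (fun=> 0) %[ae mu]).

Definition zero_resonance (V : rV -> R) : Prop :=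
  exists u : rV -> R[i],
    [/\ exists2 s : R, 0 < s & H0 (- (3 / 2) + s) u,
        schrodinger_eq V u (fun=> 0),
        forall s : R, 0 < s -> ~ H0 (- (1 / 2) + s) u &
        exists v, radial_derivative u v /\
          exists2 s : R, 0 < s & H0 (- (1 / 2) + s) v].

End defs.

(* Main.v *)
Require Import Defs.
From HB Require Import structures.
From mathcomp Require Import all_boot all_order all_algebra.
From mathcomp Require Import complex finmap.
From mathcomp Require Import all_classical all_reals all_analysis.
From mathcomp Require Import ring lra zify measurable_realfun ess_sup_inf.
Set Implicit Arguments.
Unset Strict Implicit.
Unset Printing Implicit Defensive.
Import Order.TTheory GRing.Theory Num.Theory.
Import numFieldNormedType.Exports.
Local Open Scope classical_set_scope.
Local Open Scope ring_scope.

(* Let P be a harmonic polynomial of large degree l and a = n + 2 l - 2.  Then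
   psi0 = P (1 + |x|^(2a))^(-1/2) is a rapidly decaying zero energy state of
   - Delta + V0, where V0 = - 3 a^2 |x|^(2a - 2) (1 + |x|^(2a))^(-2).  Adding lambda
   to V0 on the ball of radius 2 r moves its energy to lambda, and cutting psi0 off
   at radius r gives a quasimode psi with error O(r^(-N)), N growing with l.  Take
   r -> oo, lambda = r^(-alpha), eps = r^(-beta) and f = (H - z) psi with
   z = lambda +- i eps.  Then ||f||^2 = O(eps^2), whereas the imaginary part of the
   equation (H - z) u = f paired with psi gives eps ||psi||^2 <= ||u|| ||f||; so
   ||u|| exceeds ||f|| by any prescribed power of 1 / lambda.

   To remove zero modes add t W with W > 0 and 0 < t < eps: zero modes for distinct
   t are orthogonal in L^2(W dx), hence only countably many t admit one. *)

(** * Symbol classes *)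

(** The product P |x|^(-a) is the Kelvin transform of P; [profile a] replaces |x|^(-a) by a smooth
    function, at the price of the well V0. The decay of psi0 and V0 improves with l, so a large l
    buys any power of r. The exponents answer three demands: alpha >= 1 + sigma0 keeps lambda <x>^(1
    + sigma0) bounded on a ball of radius O(r); gam >= alpha C0 gives lambda^(-C0) <= r^gam; and
    beta = gam + alpha + 1 makes r^gam eps^2 small against eps ||psi||^2, the mass of psi being
    bounded below. The obstacle is the exclusion of zero modes: a resonance function need not lie in
    L^2 and solves its equation only weakly, so Green's formula is not at hand for two of them.
    Instead, the decay of the potential puts V v in L^1 and L^2, where Newtonian energies are
    finite, and testing with smooth truncations of |x|^(2 - n) represents v, up to a constant
    factor, as the Newtonian potential of - V v. As for the resolvent, psi inhabits the set from
    which it is selected, and the lower bound holds for every element of that set. *)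

Section directional_calculus.
Context {R : realType} {n : nat}.
Local Notation rV := 'rV[R]_n.
Local Notation "''d_' i f" := ('D_(@basis_vec R n i) (f : rV -> R))
  (at level 10, i at level 8, f at level 8).
Implicit Types (f g : rV -> R) (x y v : rV).

Lemma is_derive_line f x v y (t df : R) : y = t *: v + x ->
  is_derive y v f df -> is_derive t 1 (fun h : R => f (h *: v + x)) df.
Proof.
move=> -> [fv <-]; split.
  apply/derivable1P; move/derivable1P : fv.
  by under [X in _ -> derivable X _ _]eq_fun do
    rewrite [_%:A]mulr1 scalerDl -addrA.
rewrite /derive; set F := fun h => _; set G := fun h => _.
suff -> : F = G by [].
by apply/funext => h; rewrite /F /G /= [_%:A]mulr1 scalerDl -addrA.
Qed.

(** Together with [is_derive_line] this passes back and forth between a directional derivative and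
    an ordinary derivative along the line, so that the one-variable chain rule applies. *)
Lemma is_derive_line0 f x v (df : R) :
  is_derive (0 : R) 1 (fun h : R => f (h *: v + x)) df -> is_derive x v f df.
Proof.
move=> [fv <-]; split; first exact/derivable1P.
rewrite /derive; set F := fun h => _; set G := fun h => _.
suff -> : F = G by [].
by apply/funext => h; rewrite /F /G /= [_%:A]mulr1 scale0r !add0r addr0.
Qed.

Lemma is_derive_comp (B : R -> R) f x v (df dB : R) :
  is_derive (f x) 1 B dB -> is_derive x v f df ->
  is_derive x v (fun y => B (f y)) (dB * df).
Proof.
move=> dBf dfx; apply: is_derive_line0.
have x0 : x = 0 *: v + x by rewrite scale0r add0r.
have := is_derive_line x0 dfx.
apply: (@is_derive1_comp _ B (fun h : R => f (h *: v + x))).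
by rewrite -x0.
Qed.

Lemma is_dD f g x v (df dg : R) : is_derive x v f df -> is_derive x v g dg ->
  is_derive x v (fun y => f y + g y) (df + dg).
Proof. by move=> hf hg; apply: (@is_deriveD _ _ _ f g). Qed.

Lemma is_dM f g x v (df dg : R) : is_derive x v f df -> is_derive x v g dg ->
  is_derive x v (fun y => f y * g y) (f x * dg + g x * df).
Proof. by move=> hf hg; apply: (@is_deriveM _ _ f g). Qed.

Lemma is_dZ (c : R) f x v (df : R) : is_derive x v f df ->
  is_derive x v (fun y => c * f y) (c * df).
Proof. by move=> hf; apply: (@is_deriveZ _ _ _ f c). Qed.

Lemma is_dN f x v (df : R) : is_derive x v f df ->
  is_derive x v (fun y => - f y) (- df).
Proof. by move=> hf; apply: (@is_deriveN _ _ _ f). Qed.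

Lemma is_dcst (c : R) x v : is_derive x v (fun=> c : R) 0.
Proof. exact: is_derive_cst. Qed.

Lemma is_dX f k x v (df : R) : is_derive x v f df ->
  is_derive x v (fun y => f y ^+ k) (k%:R * f x ^+ k.-1 * df).
Proof.
move=> hf; rewrite (_ : (fun y => f y ^+ k) = f ^+ k); last first.
  by apply/funext => y; rewrite exprfctE.
exact: (@is_deriveX _ _ f).
Qed.

Lemma is_dcoord (j i : 'I_n) x :
  is_derive x (basis_vec i) (fun y : rV => y 0 j) ((i == j)%:R : R).
Proof.
apply: is_derive_line0.
rewrite (_ : (fun h => _) = (fun h : R => h * (i == j)%:R + x 0 j)); last first.
  by apply/funext => h; rewrite !mxE eqxx /= [j == i]eq_sym.
rewrite -[X in is_derive _ _ _ X]addr0; apply: is_deriveD.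
rewrite -[X in is_derive _ _ _ X]mulr1.
under eq_fun do rewrite mulrC.
by apply: (@is_deriveZ _ _ _ id).
Qed.

Definition nrm2 x : R := \sum_(i < n) x 0 i ^+ 2.

Lemma nrm2_ge0 x : 0 <= nrm2 x.
Proof. by apply: sumr_ge0 => i _; exact: sqr_ge0. Qed.

Lemma enorm2 x : enorm x ^+ 2 = nrm2 x.
Proof. by rewrite sqr_sqrtr// nrm2_ge0. Qed.

Lemma japanese_sqr x : japanese x ^+ 2 = 1 + nrm2 x.
Proof. by rewrite sqr_sqrtr ?enorm2// addr_ge0// nrm2_ge0. Qed.

Lemma japanese_ge1 x : 1 <= japanese x.
Proof.
by rewrite -[leLHS]sqrtr1 ler_wsqrtr// enorm2 lerDl nrm2_ge0.
Qed.

Lemma japanese_gt0 x : 0 < japanese x.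
Proof. exact: lt_le_trans (japanese_ge1 x). Qed.
#[local] Hint Resolve japanese_gt0 japanese_ge1 : core.

Lemma is_dnrm2 (i : 'I_n) x :
  is_derive x (basis_vec i) nrm2 (2 * x 0 i).
Proof.
rewrite (_ : nrm2 = \sum_(j < n) (fun y : rV => y 0 j ^+ 2)); last first.
  by apply/funext => y; rewrite fct_sumE.
have -> : 2 * x 0 i = \sum_(j < n) (2%:R * x 0 j ^+ 1 * (i == j)%:R).
  rewrite (bigD1 i)//= eqxx mulr1 expr1 big1 ?addr0// => j ji.
  by rewrite eq_sym (negbTE ji) mulr0.
by apply: is_derive_sum => j; apply: is_dX; exact: is_dcoord.
Qed.

(** The symbol class truncated at order [k], on which the closure properties are proved by
    induction. Continuity is recorded at each order because partial derivatives alone do not imply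
    it. *)
Fixpoint symk (k : nat) (m : R) f : Prop :=
  [/\ continuous f, exists C, forall x, `|f x| <= C * japanese x `^ m &
    if k is k'.+1 then forall i : 'I_n,
      (forall x, derivable f x (basis_vec i)) /\ symk k' (m - 1) ('d_i f)
    else True].

(* The Hormander class S^m: partial derivatives of order j are O(<x>^(m - j)). *)
Definition sym (m : R) f := forall k, symk k m f.

Lemma symk_cont k m f : symk k m f -> continuous f.
Proof. by case: k => [|k] []. Qed.

Lemma symk_bnd k m f : symk k m f ->
  exists2 C, 0 <= C & forall x, `|f x| <= C * japanese x `^ m.
Proof.
move=> h; have [C hC] : exists C, forall x, `|f x| <= C * japanese x `^ m.
  by case: k h => [|k] [].
exists `|C| => // x; rewrite (le_trans (hC x))// ler_wpM2r ?powR_ge0//.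
exact: ler_norm.
Qed.

Lemma le_powj m m' x : m <= m' -> japanese x `^ m <= japanese x `^ m'.
Proof. by move=> mm'; apply: ler_powR. Qed.

Lemma symk_le k m m' f : m <= m' -> symk k m f -> symk k m' f.
Proof.
have aux m1 m2 g : m1 <= m2 ->
    (exists2 C, 0 <= C & forall x, `|g x| <= C * japanese x `^ m1) ->
    exists C, forall x, `|g x| <= C * japanese x `^ m2.
  move=> m12 [C C0 hC]; exists C => x.
  by rewrite (le_trans (hC x))// ler_wpM2l// le_powj.
elim: k m m' f => [|k IH] m m' f mm' h.
  by split => //; [exact: symk_cont h|exact: aux mm' (symk_bnd h)].
split; [exact: symk_cont h|exact: aux mm' (symk_bnd h)|].
move=> i; case: h => _ _ /(_ i)[d h]; split => //.
by apply: IH h; rewrite lerD2r.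
Qed.

Lemma sym_le m m' f : m <= m' -> sym m f -> sym m' f.
Proof. by move=> mm' h k; exact: symk_le mm' (h k). Qed.

Lemma sym_cont m f : sym m f -> continuous f.
Proof. by move=> /(_ 0%N)/symk_cont. Qed.

Lemma sym_bnd m f : sym m f ->
  exists2 C, 0 <= C & forall x, `|f x| <= C * japanese x `^ m.
Proof. by move=> /(_ 0%N)/symk_bnd. Qed.

Lemma sym_derivable m f i x : sym m f -> derivable f x (basis_vec i).
Proof. by move=> /(_ 1%N)[_ _ /(_ i)[]]. Qed.

Lemma sym_is_d m f i x : sym m f -> is_derive x (basis_vec i) f ('d_i f x).
Proof. by move=> h; apply: derivableP; exact: sym_derivable h. Qed.

Lemma sym_d m f i : sym m f -> sym (m - 1) ('d_i f).
Proof. by move=> h k; have [_ _ /(_ i)[]] := h k.+1. Qed.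

Lemma sym_intro m f : continuous f ->
  (exists C, forall x, `|f x| <= C * japanese x `^ m) ->
  (forall i x, derivable f x (basis_vec i)) ->
  (forall i, sym (m - 1) ('d_i f)) -> sym m f.
Proof.
move=> cf bf df sf [|k]; split => // i; split; last exact: sf.
by move=> x; exact: df.
Qed.

Lemma powjD m m' x :
  japanese x `^ (m + m') = japanese x `^ m * japanese x `^ m'.
Proof. by rewrite powRD//; apply/implyP => _; rewrite gt_eqF. Qed.

Lemma symkD k m f g : symk k m f -> symk k m g -> symk k m (fun x => f x + g x).
Proof.
elim: k m f g => [|k IH] m f g hf hg.
all: have [C1 C10 h1] := symk_bnd hf; have [C2 C20 h2] := symk_bnd hg.
all: have cfg : continuous (fun x => f x + g x).
1,3: by move=> x; apply: (@continuousD _ _ _ f g); [exact: (symk_cont hf)|exact: (symk_cont hg)].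
all: have bfg : exists C, forall x, `|f x + g x| <= C * japanese x `^ m.
1,3: by exists (C1 + C2) => x; rewrite (le_trans (ler_normD _ _))// mulrDl lerD.
  by split.
split => // i.
case: hf hg => [_ _ /(_ i)[df hf]] [_ _ /(_ i)[dg hg]]; split.
  by move=> x; apply: derivableD.
rewrite (_ : 'D_(basis_vec i) _ = fun x => 'd_i f x + 'd_i g x); first exact: IH.
apply/funext => x.
have [] := is_dD (derivableP (df x)) (derivableP (dg x)).
by [].
Qed.

Lemma symkM k m m' f g : symk k m f -> symk k m' g ->
  symk k (m + m') (fun x => f x * g x).
Proof.
elim: k m m' f g => [|k IH] m m' f g hf hg.
all: have [C1 C10 h1] := symk_bnd hf; have [C2 C20 h2] := symk_bnd hg.
all: have cfg : continuous (fun x => f x * g x).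
1,3: by move=> x; apply: (@continuousM _ _ f g); [exact: (symk_cont hf)|exact: (symk_cont hg)].
all: have bfg : exists C, forall x, `|f x * g x| <= C * japanese x `^ (m + m').
1,3: exists (C1 * C2) => x; by rewrite normrM powjD mulrACA ler_pM.
  by split.
split => // i.
(* The Leibniz terms contain the undifferentiated factors, needed at order [k] instead of [k.+1]. *)
have hf' : symk k m f.
  by elim: k m f hf {IH hg h1 h2 cfg bfg} => [|k IH'] m f [? ? h]; split => // j;
    have [? ?] := h j; split => //; exact: IH'.
have hg' : symk k m' g.
  by elim: k m' g hg {IH hf hf' h1 h2 cfg bfg} => [|k IH'] m1 f1 [? ? h];
    split => // j; have [? ?] := h j; split => //; exact: IH'.
case: hf hg => [_ _ /(_ i)[df hf]] [_ _ /(_ i)[dg hg]]; split.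
  by move=> x; apply: derivableM.
rewrite (_ : 'D_(basis_vec i) _ = fun x => f x * 'd_i g x + g x * 'd_i f x).
  apply: symkD; first by rewrite -addrA; exact: IH.
  by rewrite (addrC m) -addrA; exact: IH.
apply/funext => x.
have [] := is_dM (derivableP (df x)) (derivableP (dg x)).
by [].
Qed.

Lemma symD m f g : sym m f -> sym m g -> sym m (fun x => f x + g x).
Proof. by move=> hf hg k; exact: symkD. Qed.

Lemma symM m m' f g : sym m f -> sym m' g -> sym (m + m') (fun x => f x * g x).
Proof. by move=> hf hg k; exact: symkM. Qed.

Lemma sym0 m : sym m (fun=> 0).
Proof.
move=> k; elim: k m => [|k IH] m; split => //; try exact: cst_continuous.
- by exists 0 => x; rewrite normr0 mul0r.
- by exists 0 => x; rewrite normr0 mul0r.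
move=> i; split; first by move=> x; exact: derivable_cst.
rewrite (_ : 'D_(basis_vec i) _ = fun=> 0)//.
by apply/funext => x; rewrite (@derive_cst _ _ R^o).
Qed.

Lemma sym_cst c : sym 0 (fun=> c).
Proof.
apply: sym_intro.
- exact: cst_continuous.
- by exists `|c| => x; rewrite powRr0 mulr1.
- by move=> i x; exact: derivable_cst.
move=> i; rewrite (_ : 'D_(basis_vec i) _ = fun=> 0); first exact: sym0.
by apply/funext => x; rewrite (@derive_cst _ _ R^o).
Qed.

Lemma symZ m c f : sym m f -> sym m (fun x => c * f x).
Proof. by move=> hf; rewrite -[m]add0r; apply: symM => //; exact: sym_cst. Qed.

Lemma symN m f : sym m f -> sym m (fun x => - f x).
Proof.
by move=> /(symZ (-1)); under eq_fun do rewrite mulN1r.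
Qed.

Lemma symB m f g : sym m f -> sym m g -> sym m (fun x => f x - g x).
Proof. by move=> hf /symN; exact: symD. Qed.

Lemma symX m f k : sym m f -> sym (k%:R * m) (fun x => f x ^+ k).
Proof.
move=> hf; elim: k => [|k IH].
  by rewrite mul0r; under eq_fun do rewrite expr0; exact: sym_cst.
under eq_fun do rewrite exprS.
by rewrite mulrS mulrDl mul1r; exact: symM.
Qed.

Lemma sym_sum m (I : finType) (F : I -> rV -> R) : (forall i, sym m (F i)) ->
  sym m (fun x => \sum_i F i x).
Proof.
move=> hF; rewrite (_ : (fun x => _) = \sum_i F i); last first.
  by apply/funext => x; rewrite fct_sumE.
elim/big_ind : _ => //; [exact: sym0|by move=> f g; exact: symD].
Qed.

Lemma le_coord_japanese x (j : 'I_n) : `|x 0 j| <= japanese x.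
Proof.
rewrite -(@ler_pXn2r _ 2)// ?nnegrE// ?(ltW (japanese_gt0 x))//.
rewrite japanese_sqr real_normK ?num_real// /nrm2 (bigD1 j)//=.
by rewrite addrCA lerDl addr_ge0// sumr_ge0// => k _; exact: sqr_ge0.
Qed.

Lemma coord_cont (j : 'I_n) : continuous (fun y : rV => y 0 j : R).
Proof. exact: coord_continuous. Qed.

Lemma sym_coord (j : 'I_n) : sym 1 (fun x => x 0 j).
Proof.
apply: sym_intro.
- exact: coord_cont.
- by exists 1 => x; rewrite mul1r powRr1 ?(ltW (japanese_gt0 x))// le_coord_japanese.
- by move=> i x; case: (is_dcoord j i x).
move=> i; rewrite subrr (_ : 'D_(basis_vec i) _ = fun _ : rV => (i == j)%:R : R).
  exact: sym_cst.
by apply/funext => x; case: (is_dcoord j i x).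
Qed.

Lemma sym_nrm2 : sym 2 nrm2.
Proof.
apply: sym_sum => i; rewrite [X in sym X _](_ : _ = 2%:R * 1); last by rewrite mulr1.
by apply: (@symX 1 (fun x => x 0 i) 2); exact: sym_coord.
Qed.

(** [B j] is the j-th derivative of a function of one variable. The chain rule lowers the order by
    [m] through [B] and multiplies by the gradient of [q], of order [m - 1]: a net loss of one. The
    domain [D] accommodates powers, differentiable on the positive half line only. *)
Lemma sym_comp (B : nat -> R -> R) (D : set R) (mu m : R) (q : rV -> R) :
  (forall j (y : R), D y -> is_derive y 1 (B j) (B j.+1 y)) ->
  (forall x, D (q x)) -> sym m q ->
  (forall j, exists C, forall x, `|B j (q x)| <= C * japanese x `^ (mu - j%:R * m)) ->
  forall j, sym (mu - j%:R * m) (fun x => B j (q x)).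
Proof.
move=> dB Dq sq bB j k; elim: k j => [|k IH] j.
all: have cB : continuous (fun x => B j (q x)).
1,3: move=> x; apply: (@continuous_comp _ _ _ q (B j)); first exact: (sym_cont sq).
1,2: apply/differentiable_continuous/derivable1_diffP; by have [] := dB j _ (Dq x).
  by split.
split => // i.
have dq x := is_derive_comp (dB j _ (Dq x)) (sym_is_d i x sq).
split; first by move=> x; case: (dq x).
rewrite (_ : 'D_(basis_vec i) _ = fun x => B j.+1 (q x) * 'd_i q x); last first.
  by apply/funext => x; case: (dq x).
rewrite [X in symk _ X _](_ : _ = (mu - j.+1%:R * m) + (m - 1)).
  by apply: symkM; [exact: IH|exact: sym_d].
by rewrite -[in RHS]addn1 natrD; ring.
Qed.

Lemma sym_partials m f (s : seq 'I_n) : sym m f ->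
  sym (m - (size s)%:R) (partials s f).
Proof.
move=> hf; elim: s => [|i s IH] /=; first by rewrite subr0.
by rewrite -addn1 natrD opprD addrA; exact: sym_d.
Qed.

Lemma sym_smooth m f : sym m f -> smooth f.
Proof.
move=> hf s; have h := sym_partials s hf; split; first exact: sym_cont h.
by move=> i x; exact: sym_derivable h.
Qed.

End directional_calculus.
#[export] Hint Resolve japanese_gt0 japanese_ge1 : core.

(** * Flat functions of one variable *)

Section bump_family.
Context {R : realType}.

(** The derivative of p(1/y) exp (-1/y) is q(1/y) exp (-1/y) with q = X^2 (p - p'); this is the
    recursion. *)
Fixpoint bump_poly (k : nat) : {poly R} :=
  if k is k'.+1 then 'X^2 * (bump_poly k' - (bump_poly k')^`()) else 1.

(* The k-th derivative of the flat function y |-> exp (-1/y) (0 for y <= 0). *)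
Definition flat (k : nat) (y : R) : R :=
  if 0 < y then (bump_poly k).[y^-1] * expR (- y^-1) else 0.

(** The inequality s / m <= 1 + s / m <= exp (s / m), raised to the power m. *)
Lemma pow_expR_bounded (m : nat) (s : R) : 0 <= s -> s ^+ m * expR (- s) <= m%:R ^+ m.
Proof.
move=> s0; case: m => [|m]; first by rewrite expr0 mul1r -[leRHS]expR0 ler_expR oppr_le0.
rewrite expRN -ler_pdivlMr ?invr_gt0 ?expR_gt0// invrK.
have m0 : 0 < m.+1%:R :> R by [].
have -> : expR s = expR (s / m.+1%:R) ^+ m.+1.
  by rewrite -expRM_natl mulrC divfK ?gt_eqF.
rewrite -exprMn; apply: lerXn2r; rewrite ?nnegrE ?mulr_ge0 ?expR_ge0//.
rewrite -ler_pdivrMl// mulrC.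
by rewrite (le_trans _ (expR_ge1Dx _))// lerDr.
Qed.

Lemma poly_expR_bounded (p : {poly R}) :
  exists2 C : R, 0 <= C & forall s, 0 <= s -> `|p.[s] * expR (- s)| <= C.
Proof.
exists (\sum_(i < size p) `|p`_i| * i%:R ^+ i).
  by apply: sumr_ge0 => i _; rewrite mulr_ge0// exprn_ge0.
move=> s s0; rewrite horner_coef mulr_suml.
apply: le_trans (ler_norm_sum _ _ _) _; apply: ler_sum => i _.
rewrite -mulrA normrM ler_wpM2l//.
by rewrite ger0_norm ?pow_expR_bounded// mulr_ge0 ?exprn_ge0 ?expR_ge0.
Qed.

Lemma flat_bounded k : exists2 C : R, 0 <= C & forall y, `|flat k y| <= C.
Proof.
have [C C0 hC] := poly_expR_bounded (bump_poly k); exists C => // y.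
rewrite /flat; case: ifPn => y0; last by rewrite normr0.
by rewrite hC// invr_ge0 ltW.
Qed.

Lemma flat_le0 k y : y <= 0 -> flat k y = 0.
Proof. by move=> y0; rewrite /flat ltNge y0. Qed.

(** Boundedness of s^2 p(s) exp (-s) at s = 1/y. The quadratic bound makes the difference quotient
    of [flat k] at the origin tend to 0, the one delicate point of [is_derive_flat]. *)
Lemma flat_quadratic k : exists2 C : R, 0 <= C & forall y, `|flat k y| <= C * y ^+ 2.
Proof.
have [C C0 hC] := poly_expR_bounded ('X^2 * bump_poly k); exists C => // y.
have [y0|y0] := leP y 0; first by rewrite flat_le0// normr0 mulr_ge0// sqr_ge0.
have yi0 : 0 <= y^-1 by rewrite invr_ge0 ltW.
have := hC _ yi0.
rewrite /flat y0 hornerM hornerXn -mulrA normrM ger0_norm ?exprn_ge0//.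
by rewrite -ler_pdivlMl ?exprn_gt0 ?invr_gt0// exprVn invrK [_ * C]mulrC.
Qed.

Lemma is_derive_flat k (y : R) : is_derive y 1 (flat k) (flat k.+1 y).
Proof.
have [y0|y0|->] := ltgtP y 0.
- rewrite flat_le0 ?ltW//.
  apply: (@near_eq_is_derive _ R R (fun=> 0)).
  by near=> z; rewrite flat_le0// ltW//; near: z; exact: lt_nbhsl.
- pose F := fun z : R => (bump_poly k).[z^-1] * expR (- z^-1).
  apply: (@near_eq_is_derive _ R R F).
    by near=> z; rewrite /flat ifT//; near: z; exact: lt_nbhsr.
  have yn0 : y != 0 by rewrite gt_eqF.
  have dV : is_derive y 1 (fun z : R => z^-1) (- y ^- 2 *: 1).
    exact: (@is_deriveV _ id).
  have dE : is_derive y 1 (fun z : R => expR (- z^-1)) (expR (- y^-1) * - (- y ^- 2 *: 1)).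
    exact: (@is_derive1_comp _ expR (fun z : R => - z^-1) y _ _
      (is_derive_expR _) (is_deriveN dV)).
  have dP : is_derive y 1 (fun z : R => (bump_poly k).[z^-1])
      ((bump_poly k)^`().[y^-1] * (- y ^- 2 *: 1)).
    exact: (@is_derive1_comp _ (horner (bump_poly k)) (fun z : R => z^-1)).
  have := @is_deriveM _ _ (fun z : R => (bump_poly k).[z^-1]) _ _ _ _ _ dP dE.
  congr is_derive.
  rewrite /flat y0 /= !hornerE /GRing.scale /= exprVn; ring.
- rewrite flat_le0//.
  have [C C0 hC] := flat_quadratic k.
  have H : (fun h : R => h^-1 *: (flat k (h *: 1 + 0) - flat k 0)) @ 0^' --> (0 : R).
    apply/cvgrPdist_le => e e0; near=> h.
    rewrite [flat k 0]flat_le0// subr0 sub0r normrN addr0 [_%:A]mulr1.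
    rewrite normrM normfV.
    have h0 : 0 < `|h| by rewrite normr_gt0; near: h; exact: nbhs_dnbhs_neq.
    rewrite ler_pdivrMl// (le_trans (hC h))//.
    rewrite -[X in C * X]real_normK ?num_real// expr2 mulrCA ler_wpM2l//.
    have : `|h| <= e / (C + 1).
      by near: h; apply: dnbhs0_le; rewrite divr_gt0// ltr_pwDr.
    rewrite ler_pdivlMr ?ltr_pwDr// mulrDr mulr1 mulrC => he.
    by rewrite (le_trans _ he)// lerDl ltW.
  split; first by apply/cvg_ex; exists 0.
  exact: cvg_lim H.
Unshelve. all: by end_near. Qed.

Lemma flat0_gt0 y : 0 < y -> 0 < flat 0 y.
Proof. by move=> y0; rewrite /flat y0 /= hornerE mul1r expR_gt0. Qed.

Lemma flat0_le y z : y <= z -> flat 0 y <= flat 0 z.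
Proof.
move=> yz; have [y0|y0] := leP y 0.
  rewrite flat_le0//; have [z0|/flat0_gt0/ltW//] := leP z 0.
  by rewrite flat_le0.
rewrite /flat y0 (lt_le_trans y0 yz) /= !hornerE ler_expR lerN2.
by rewrite lef_pV2// posrE// (lt_le_trans y0 yz).
Qed.

End bump_family.

(** * Affine substitutions, Laplacians of products and a smooth cutoff *)

Section special_functions.
Context {R : realType} {n : nat}.
Local Notation rV := 'rV[R]_n.
Local Notation "''d_' i f" := ('D_(@basis_vec R n i) (f : rV -> R))
  (at level 10, i at level 8, f at level 8).
Implicit Types (f g : rV -> R) (x y v : rV).

Lemma is_derive_affine f (c : R) y x v (df : R) :
  is_derive (c *: x + y) v f df ->
  is_derive x v (fun z => f (c *: z + y)) (c * df).
Proof.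
move=> hf; apply: is_derive_line0.
have -> : (fun h : R => f (c *: (h *: v + x) + y)) =
          (fun k : R => f (k *: v + (c *: x + y))) \o (fun h : R => c * h).
  by apply/funext => h /=; rewrite scalerDr addrA scalerA.
rewrite mulrC; apply: is_derive1_comp.
  by apply: is_derive_line hf; rewrite mulr0 scale0r add0r.
rewrite -[X in is_derive _ _ _ X]mulr1; exact: (@is_deriveZ _ _ _ id).
Qed.


Lemma powR_le2 (r a b : R) : 0 <= r -> 0 <= a -> a <= b -> a `^ r <= b `^ r.
Proof.
by move=> r0 a0 ab; apply: (ge0_ler_powR r0) => //; rewrite nnegrE// (le_trans a0).
Qed.

Lemma nrm2_affine (c : R) x y :
  nrm2 (c *: x + y) <= 2 * c ^+ 2 * nrm2 x + 2 * nrm2 y.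
Proof.
rewrite /nrm2 !mulr_sumr -big_split /=; apply: ler_sum => i _; rewrite !mxE.
have := sqr_ge0 (c * x 0 i - y 0 i); nra.
Qed.

Lemma japanese_affine (c : R) y :
  exists2 K, 0 < K & forall x, japanese (c *: x + y) <= K * japanese x.
Proof.
have y0 := nrm2_ge0 y; have c0 := sqr_ge0 c.
exists (Num.sqrt (1 + 2 * c ^+ 2 + 2 * nrm2 y)); first by rewrite sqrtr_gt0; nra.
have jn z : (japanese z : R) \is Num.nneg by rewrite nnegrE; exact: ltW (japanese_gt0 _).
move=> x; rewrite -(@ler_pXn2r _ 2)// ?rpredM// ?nnegrE ?sqrtr_ge0//.
rewrite exprMn !japanese_sqr sqr_sqrtr; last by nra.
have := nrm2_affine c x y; have x0 := nrm2_ge0 x.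
have := mulr_ge0 x0 y0; lra.
Qed.

Lemma powj_affine (m c : R) y : c != 0 ->
  exists2 K, 0 <= K &
    forall x, japanese (c *: x + y) `^ m <= K * japanese x `^ m.
Proof.
move=> c0; have [m0|m0] := leP 0 m.
  have [K K0 hK] := japanese_affine c y; exists (K `^ m); first exact: powR_ge0.
  move=> x; rewrite -powRM ?(ltW K0) ?(ltW (japanese_gt0 _))//.
  apply: powR_le2 => //; exact: ltW (japanese_gt0 _).
(* For negative [m] the comparison is reversed, so the inverse affine map is applied at the point c
   x + y. *)
have [K K0 hK] := japanese_affine c^-1 (- (c^-1 *: y)).
have [p mE] : exists p, m = - p by exists (- m); rewrite opprK.
have p0 : 0 <= p by rewrite -oppr_le0 -mE ltW.
exists (K `^ p); first exact: powR_ge0.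
move=> x; have := hK (c *: x + y).
rewrite scalerDr scalerA mulVf// scale1r addrK => h.
have jx0 := ltW (japanese_gt0 x); have jy0 := ltW (japanese_gt0 (c *: x + y)).
rewrite mE !powRN ler_pdivlMr ?powR_gt0// ler_pdivrMl ?powR_gt0//.
by rewrite mulrC -powRM ?(ltW K0)//; apply: powR_le2.
Qed.

Lemma sym_affine (m c : R) y f : c != 0 -> sym m f ->
  sym m (fun x => f (c *: x + y)).
Proof.
move=> c0 hf k; elim: k m f hf => [|k IH] m f hf.
all: have cf : continuous (fun x => f (c *: x + y)).
1,3: move=> x; apply: (@continuous_comp _ _ _ (fun x => c *: x + y) f);
  last (have H := sym_cont hf; exact: H).
1,2: by apply: continuousD; [exact: scaler_continuous|exact: cst_continuous].
all: have bf : exists C, forall x, `|f (c *: x + y)| <= C * japanese x `^ m.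
1,3: have [K K0 hK] := powj_affine m y c0; have [C C0 hC] := sym_bnd hf;
  exists (C * K) => x; rewrite -mulrA; apply: le_trans (hC _) _;
  by apply: ler_wpM2l => //; exact: hK.
  by split.
split => // i; have d x := is_derive_affine (sym_is_d i (c *: x + y) hf).
split; first by move=> x; case: (d x).
rewrite (_ : 'D_(basis_vec i) _ = fun x => c * 'd_i f (c *: x + y)); last first.
  by apply/funext => x; case: (d x).
rewrite -[m - 1]add0r.
apply: (@symkM _ _ k 0 (m - 1) (fun=> c) (fun x => 'd_i f (c *: x + y))).
  exact: sym_cst.
exact: (IH _ _ (sym_d i hf)).
Qed.

Lemma partials_scale f (c : R) (s : seq 'I_n) x : smooth f ->
  partials s (fun x => f (c *: x)) x = c ^+ size s * partials s f (c *: x).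
Proof.
move=> sf; elim: s x => [|i s IH] x /=; first by rewrite expr0 mul1r.
rewrite (_ : partials s _ = fun x => c ^+ size s * partials s f (c *: x + 0)); last first.
  by apply/funext => z; rewrite IH addr0.
have [_ /(_ i (c *: x + 0))/derivableP d] := sf s.
have [_ ->] := is_dZ (c ^+ size s) (is_derive_affine d).
by rewrite mulrA exprSr addr0.
Qed.

Lemma sym_dM m m' f g i : sym m f -> sym m' g ->
  'd_i (fun x => f x * g x) = (fun x => f x * 'd_i g x + g x * 'd_i f x).
Proof.
move=> hf hg; apply/funext => x.
by have [] := is_dM (sym_is_d i x hf) (sym_is_d i x hg).
Qed.

Lemma sym_dD m m' f g i : sym m f -> sym m' g ->
  'd_i (fun x => f x + g x) = (fun x => 'd_i f x + 'd_i g x).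
Proof.
move=> hf hg; apply/funext => x.
by have [] := is_dD (sym_is_d i x hf) (sym_is_d i x hg).
Qed.

Let leibniz2 (a b c d e h : R) :
  a * b + c * d + (e * h + d * c) = a * b + 2 * (d * c) + e * h.
Proof. by ring. Qed.

Lemma laplacianM m m' f g x : sym m f -> sym m' g ->
  laplacian (fun x => f x * g x) x =
  f x * laplacian g x + 2 * \sum_(i < n) 'd_i f x * 'd_i g x + g x * laplacian f x.
Proof.
move=> hf hg; rewrite /laplacian !mulr_sumr -!big_split /=; apply: eq_bigr => i _.
rewrite /= (sym_dM i hf hg).
have [_ ->] := is_dD (is_dM (sym_is_d i x hf) (sym_is_d i x (sym_d i hg)))
  (is_dM (sym_is_d i x hg) (sym_is_d i x (sym_d i hf))).
exact: leibniz2.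
Qed.

Definition flat_ball x : R := flat 0 (4 - nrm2 x).
Let flat3 : R := flat 0 3.
Let flat3_gt0 : 0 < flat3. Proof. exact: flat0_gt0. Qed.

(** A composition of flat functions. [flat3] is the value of [flat_ball] on the unit sphere: inside
    the unit ball [flat_ball] is at least that large and the outer [flat 0] vanishes, whereas
    outside the ball of radius 2 [flat_ball] is 0 and the outer term equals its normalising
    constant. *)
Definition cutoff x : R :=
  1 - (flat 0 flat3)^-1 * flat 0 (flat3 - flat_ball x).

(** On the ball of radius 2 the bracket lies between 1 and 5, so every weight is comparable to 1.
    This is how a compact support yields membership in all classes [sym m]. *)
Lemma powj_ball (m : R) x : nrm2 x <= 4 -> 1 <= 5 `^ `|m| * japanese x `^ m.
Proof.
move=> x4; rewrite -ler_pdivrMl ?powR_gt0// mulr1 -powRN.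
apply: (@le_trans _ _ (japanese x `^ (- `|m|))).
  rewrite !powRN lef_pV2 ?posrE ?powR_gt0//; apply: powR_le2; rewrite ?(ltW (japanese_gt0 x))//.
  rewrite -(@ler_pXn2r _ 2)// ?nnegrE ?(ltW (japanese_gt0 x))// japanese_sqr; lra.
by apply: le_powj; rewrite lerNnormlW// ler_normr lexx.
Qed.

Lemma sym_flat_ball m : sym m flat_ball.
Proof.
have sq : sym 2 (fun x => 4 - nrm2 x).
  by apply: symB; [apply: sym_le (sym_cst 4)|exact: sym_nrm2].
have := @sym_comp _ n (@flat R) setT m 2 _ (fun j (y : R) _ => is_derive_flat j y)
  (fun=> I) sq _ 0%N; rewrite mul0r subr0; apply => j.
have [C C0 hC] := @flat_bounded R j.
exists (C * 5 `^ `|m - j%:R * 2|) => x.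
have [x4|x4] := leP (nrm2 x) 4.
  by rewrite -mulrA (le_trans (hC _))// ler_peMr// powj_ball.
rewrite flat_le0 ?normr0 ?mulr_ge0 ?powR_ge0//.
by rewrite subr_le0 ltW.
Qed.

Lemma sym_flat_cut j : sym 0 (fun x => flat j (flat3 - flat_ball x)).
Proof.
have sq : sym 0 (fun x => flat3 - flat_ball x).
  by apply: symB; [exact: sym_cst|exact: sym_flat_ball].
have := @sym_comp _ n (@flat R) setT 0 0 _ (fun j (y : R) _ => is_derive_flat j y)
  (fun=> I) sq _ j; rewrite mulr0 subr0; apply => k.
have [C C0 hC] := @flat_bounded R k.
by exists C => x; rewrite mulr0 subr0 powRr0 mulr1.
Qed.

Let fflat3_gt0 : 0 < flat 0 flat3. Proof. exact: flat0_gt0. Qed.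

Lemma cutoff_out x : 4 <= nrm2 x -> cutoff x = 0.
Proof.
move=> x4; rewrite /cutoff /flat_ball [flat 0 (4 - _)]flat_le0 ?subr_le0// subr0.
by rewrite mulVf ?subrr// gt_eqF.
Qed.

Lemma cutoff_in x : nrm2 x <= 1 -> cutoff x = 1.
Proof.
move=> x1; rewrite /cutoff [flat 0 (_ - _)]flat_le0 ?mulr0 ?subr0//.
rewrite subr_le0; apply: flat0_le; lra.
Qed.

(** Composition gives order 0 only, since the outer function does not vanish where [flat_ball] does.
    For arbitrary [m] the size bound comes from the support, and the derivative carries the factor
    ['d_i flat_ball], which lies in every class. *)
Lemma sym_cutoff m : sym m cutoff.
Proof.
have s0 : sym 0 cutoff.
  by apply: symB; [exact: sym_cst|apply: symZ; exact: (sym_flat_cut 0)].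
apply: sym_intro; first exact: sym_cont s0.
- have [C C0 hC] := sym_bnd s0; exists (C * 5 `^ `|m|) => x.
  have [x4|x4] := leP 4 (nrm2 x).
    by rewrite cutoff_out// normr0 !mulr_ge0 ?powR_ge0.
  rewrite -mulrA; apply: (le_trans (hC x)); apply: ler_wpM2l => //.
  by rewrite powRr0 powj_ball// ltW.
- by move=> i x; exact: sym_derivable s0.
move=> i; rewrite (_ : 'D_(basis_vec i) _ = fun x =>
    (flat 0 flat3)^-1 * (flat 1 (flat3 - flat_ball x) * 'd_i flat_ball x)).
  apply: symZ; rewrite -[m - 1]add0r; apply: symM; first exact: (sym_flat_cut 1).
  exact: sym_d (sym_flat_ball m).
apply/funext => x.
have db := sym_is_d i x (sym_flat_ball 0).
have d1 := is_dD (is_dcst flat3 x (basis_vec i)) (is_dN db).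
have d2 := is_dD (is_dcst 1 x (basis_vec i))
  (is_dN (is_dZ (flat 0 flat3)^-1 (is_derive_comp (is_derive_flat 0 _) d1))).
have [_] := d2; rewrite /cutoff => ->; rewrite !add0r.
by rewrite mulrN mulrN opprK.
Qed.

Lemma deriv_locally_cst f (r c : R) i x : (forall y, nrm2 y < r -> f y = c) ->
  nrm2 x < r -> 'd_i f x = 0.
Proof.
move=> hf xr; have [//|_ ->//] := @near_eq_is_derive _ _ _ (fun=> c) f x (basis_vec i) 0 _
  (is_dcst c x (basis_vec i)).
near=> y; rewrite hf//; near: y.
exact: (@sym_cont _ _ _ _ sym_nrm2 x _ (lt_nbhsl xr)).
Unshelve. all: by end_near. Qed.

Lemma cutoff_partials_in (s : seq 'I_n) x : nrm2 x < 1 ->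
  (0 < size s)%N -> partials s cutoff x = 0.
Proof.
move=> x1; elim: s x x1 => [//|i s IH] x x1 _ /=.
have [s0|s0] := posnP (size s).
  rewrite (size0nil s0) /=; apply: (@deriv_locally_cst _ 1 1) => // y y1.
  by rewrite cutoff_in// ltW.
by apply: (@deriv_locally_cst _ 1 0) => // y y1; exact: IH.
Qed.

End special_functions.

(** * Harmonic polynomials and radial profiles *)

Section profiles.
Context {R : realType} {n : nat}.
Local Notation rV := 'rV[R]_n.
Local Notation "''d_' i f" := ('D_(@basis_vec R n i) (f : rV -> R))
  (at level 10, i at level 8, f at level 8).
Implicit Types (f g : rV -> R) (x v : rV).

Fixpoint isqrt_coef (k : nat) : R :=
  if k is k'.+1 then isqrt_coef k' * (- (1 / 2) - k'%:R) else 1.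

(** The k-th derivative of y^(-1/2) on the positive half line. *)
Definition isqrt (k : nat) (y : R) : R := isqrt_coef k * y `^ (- (1 / 2) - k%:R).

Lemma is_derive_isqrt k (y : R) : 0 < y -> is_derive y 1 (isqrt k) (isqrt k.+1 y).
Proof.
move=> y0; rewrite /isqrt /= -mulrA.
rewrite (_ : - (1 / 2) - k.+1%:R = - (1 / 2) - k%:R - 1); last first.
  by rewrite -addn1 natrD; ring.
have h := is_derive1_powR (- (1 / 2) - k%:R) y0.
exact: (@is_deriveZ _ _ _ _ (isqrt_coef k) _ _ _ h).
Qed.

Lemma isqrtE (y : R) : 0 < y -> isqrt 0 y ^+ 2 * y = 1.
Proof.
move=> y0; rewrite /isqrt /= mul1r subr0 expr2.
rewrite -powRD; last by apply/implyP => _; rewrite gt_eqF.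
rewrite (_ : - (1 / 2) + - (1 / 2) = - 1); last by field.
by rewrite powRN powRr1 ?ltW// mulVf// gt_eqF.
Qed.

Lemma isqrt1E (y : R) : 0 < y -> isqrt 1 y = - (1 / 2) * isqrt 0 y ^+ 3.
Proof.
move=> y0; rewrite /isqrt /= !mul1r !subr0 -powR_mulrn ?powR_ge0// -powRrM.
by congr (_ * _ `^ _); field.
Qed.

(* In a space of dimension n, (1 + |x|^(2 a))^(-1/2) with a = n - 2 is a smooth
   truncation of the Newtonian potential |x|^(2 - n). *)
Definition profile (a : nat) x : R := isqrt 0 (1 + nrm2 x ^+ a).

Lemma profile_arg_gt0 a x : 0 < 1 + nrm2 x ^+ a.
Proof. by rewrite ltr_wpDr ?exprn_ge0 ?nrm2_ge0. Qed.
#[local] Hint Resolve profile_arg_gt0 : core.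

Lemma profile_gt0 a x : 0 < profile a x.
Proof. by rewrite /profile /isqrt /= mul1r; apply: powR_gt0. Qed.

Lemma profile_sqr a x : profile a x ^+ 2 * (1 + nrm2 x ^+ a) = 1.
Proof. exact: isqrtE. Qed.

Lemma profile_le1 a x : profile a x <= 1.
Proof.
rewrite -(@ler_pXn2r _ 2)// ?nnegrE ?(ltW (profile_gt0 _ _))// expr1n.
rewrite -(profile_sqr a x) ler_peMr ?exprn_ge0 ?(ltW (profile_gt0 _ _))//.
by rewrite lerDl exprn_ge0// nrm2_ge0.
Qed.

Lemma japanese_le_profile_arg a x :
  japanese x `^ (2 * a%:R) <= 2 ^+ a * (1 + nrm2 x ^+ a).
Proof.
rewrite powRrM powR_mulrn ?powR_ge0//.
rewrite powR_mulrn ?(ltW (japanese_gt0 x))// japanese_sqr.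
have x0 := nrm2_ge0 x.
have [x1|x1] := leP (nrm2 x) 1.
  apply: (@le_trans _ _ (2 ^+ a)); last by rewrite ler_peMr// lerDl exprn_ge0.
  by apply: lerXn2r; rewrite ?nnegrE//; lra.
apply: (@le_trans _ _ (2 ^+ a * nrm2 x ^+ a)).
  by rewrite -exprMn; apply: lerXn2r; rewrite ?nnegrE//; lra.
by rewrite ler_pM2l// lerDr.
Qed.

(** All derivatives of y^(-1/2) have negative exponents, so a lower bound of 1 + |x|^(2a) by a
    multiple of <x>^(2a) suffices. *)
Lemma sym_profile a : sym (- a%:R) (profile a).
Proof.
have sq : sym (a%:R * 2) (fun x => 1 + nrm2 x ^+ a).
  apply: symD; last by apply: symX; exact: sym_nrm2.
  by apply: sym_le (sym_cst 1); rewrite mulr_ge0.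
have := @sym_comp _ n isqrt [set y | 0 < y] (- a%:R) _ _
  (fun j (y : R) h => is_derive_isqrt j h) (profile_arg_gt0 a) sq _ 0%N.
rewrite mul0r subr0; apply => j; pose p : R := 1 / 2 + j%:R.
have p0 : 0 <= p by rewrite addr_ge0.
exists (`|isqrt_coef j| * (2 ^+ a) `^ p) => x.
rewrite /isqrt normrM -mulrA ler_wpM2l// ger0_norm ?powR_ge0//.
rewrite (_ : - (1 / 2) - j%:R = - p); last by rewrite /p opprD.
rewrite (_ : - a%:R - _ = - ((2 * a%:R) * p)); last by rewrite /p; field.
rewrite !powRN powRrM ler_pdivlMr ?powR_gt0// ler_pdivrMl ?powR_gt0//.
rewrite -powRM ?exprn_ge0 ?(ltW (profile_arg_gt0 _ _))//.
apply: powR_le2 => //; first exact: powR_ge0.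
rewrite [leRHS]mulrC; exact: japanese_le_profile_arg.
Qed.

Lemma is_d_profile a i x : is_derive x (basis_vec i) (profile a)
  (- a%:R * nrm2 x ^+ a.-1 * x 0 i * profile a x ^+ 3).
Proof.
have dq := is_dD (is_dcst 1 x (basis_vec i)) (is_dX a (is_dnrm2 i x)).
have := is_derive_comp (is_derive_isqrt 0 (profile_arg_gt0 a x)) dq.
congr is_derive; rewrite isqrt1E ?profile_arg_gt0// /profile; by field.
Qed.

Variables i0 i1 : 'I_n.

(* Real and imaginary parts of (x_i0 + i x_i1)^l. *)
Fixpoint harm (l : nat) x : R * R :=
  if l is l'.+1 then
    (x 0 i0 * (harm l' x).1 - x 0 i1 * (harm l' x).2,
     x 0 i0 * (harm l' x).2 + x 0 i1 * (harm l' x).1)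
  else (1, 0).

Definition harmP l x := (harm l x).1.
Definition harmQ l x := (harm l x).2.

Lemma sym_harm l : sym l%:R (harmP l) /\ sym l%:R (harmQ l).
Proof.
elim: l => [|l [sP sQ]]; first by split; [exact: sym_cst|exact: sym_cst].
rewrite -addn1 natrD addrC addn1; split.
  by apply: symB; apply: symM => //; exact: sym_coord.
by apply: symD; apply: symM => //; exact: sym_coord.
Qed.

Lemma is_d_harm l i x :
  is_derive x (basis_vec i) (harmP l) (l%:R *
    ((i == i0)%:R * harmP l.-1 x - (i == i1)%:R * harmQ l.-1 x)) /\
  is_derive x (basis_vec i) (harmQ l) (l%:R *
    ((i == i0)%:R * harmQ l.-1 x + (i == i1)%:R * harmP l.-1 x)).
Proof.
elim: l => [|l [dP dQ]].
  by rewrite !mul0r; split; exact: is_dcst.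
have d0 := is_dcoord i0 i x; have d1 := is_dcoord i1 i x.
have e : l = 0%N \/ exists k, l = k.+1 by case: (l); [left|right; exists n0].
split.
- have := is_dD (is_dM d0 dP) (is_dN (is_dM d1 dQ)).
  congr is_derive; rewrite /harmP /harmQ.
  by case: e => [->|[k ->]] /=; rewrite -?[k.+2%:R]natr1 /=; ring.
- have := is_dD (is_dM d0 dQ) (is_dM d1 dP).
  congr is_derive; rewrite /harmP /harmQ.
  by case: e => [->|[k ->]] /=; rewrite -?[k.+2%:R]natr1 /=; ring.
Qed.


Lemma harmE l x : (0 < l)%N ->
  x 0 i0 * harmP l.-1 x - x 0 i1 * harmQ l.-1 x = harmP l x.
Proof. by case: l. Qed.

Hypothesis i01 : i0 != i1.

Lemma sum_delta (F : 'I_n -> R) (j : 'I_n) : \sum_i (i == j)%:R * F i = F j.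
Proof.
rewrite (bigD1 j)//= eqxx mul1r big1 ?addr0// => i ij.
by rewrite (negbTE ij) mul0r.
Qed.

(** The second derivatives in the directions [i0] and [i1] are [c] and [- c], all others vanish:
    harmonicity of the real part of a holomorphic function. *)
Lemma laplacian_harm l x : laplacian (harmP l) x = 0.
Proof.
pose c : R := l%:R * l.-1%:R * harmP l.-2 x.
have -> : laplacian (harmP l) x = \sum_i ((i == i0)%:R * c - (i == i1)%:R * c).
  apply: eq_bigr => i _ /=.
  rewrite (_ : 'D_(basis_vec i) (harmP l) = fun x => l%:R *
    ((i == i0)%:R * harmP l.-1 x - (i == i1)%:R * harmQ l.-1 x)); last first.
    by apply/funext => y; have [[]] := is_d_harm l i y.
  have [dP dQ] := is_d_harm l.-1 i x.
  have [_ ->] := is_dZ l%:R (is_dD (is_dZ (i == i0)%:R dP)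
    (is_dN (is_dZ (i == i1)%:R dQ))).
  rewrite /c; have [e0|_] := eqVneq i i0; have [e1|_] := eqVneq i i1 => /=;
    try by ring.
  by move: i01; rewrite -e0 e1 eqxx.
by rewrite sumrB !sum_delta subrr.
Qed.

Let euler_ring (a b c d e f : R) :
  a * (b * (c * d - e * f)) = c * (b * a * d) - e * (b * a * f).
Proof. by ring. Qed.

(** Euler's identity for a homogeneous polynomial. The gradient of a radial profile is parallel to
    x, so this evaluates the cross term in the Laplacian of harmonic times radial. *)
Lemma euler_harm l x : \sum_i x 0 i * 'd_i (harmP l) x = l%:R * harmP l x.
Proof.
have -> : \sum_i x 0 i * 'd_i (harmP l) x =
    \sum_i ((i == i0)%:R * (l%:R * x 0 i * harmP l.-1 x) -
            (i == i1)%:R * (l%:R * x 0 i * harmQ l.-1 x)).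
  apply: eq_bigr => i _.
  have [[_ ->] _] := is_d_harm l i x; exact: euler_ring.
rewrite sumrB !sum_delta; case: (l) => [|k]; first by rewrite !mul0r subrr.
by rewrite -(@harmE k.+1)//=; ring.
Qed.

Lemma laplacian_profile a x : laplacian (profile a) x =
  - a%:R * nrm2 x ^+ a.-1 * profile a x ^+ 3 *
  (2 * a.-1%:R + n%:R - 3 * a%:R * nrm2 x ^+ a * profile a x ^+ 2).
Proof.
pose j := profile a x; pose q := nrm2 x; pose A : R := a%:R.
have -> : laplacian (profile a) x = \sum_(i < n)
    (- A * j ^+ 3 * (2 * a.-1%:R * q ^+ a.-2 - 3 * A * q ^+ a.-1 * q ^+ a.-1 * j ^+ 2)
       * x 0 i ^+ 2 + - A * q ^+ a.-1 * j ^+ 3).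
  apply: eq_bigr => i _ /=.
  rewrite (_ : 'D_(basis_vec i) (profile a) = fun x =>
    - a%:R * nrm2 x ^+ a.-1 * x 0 i * profile a x ^+ 3); last first.
    by apply/funext => y; have [] := is_d_profile a i y.
  have [_ ->] := is_dM (is_dM (is_dZ (- A) (is_dX a.-1 (is_dnrm2 i x)))
    (is_dcoord i i x)) (is_dX 3 (is_d_profile a i x)).
  by rewrite eqxx /= -/j -/q -/A; ring.
rewrite big_split /= -mulr_sumr -/(nrm2 x) -/q sumr_const card_ord.
rewrite -[X in _ + X]mulr_natr -/j -/A.
(* The truncated predecessors do no harm: whenever an exponent is truncated, the coefficient in
   front of it is 0. *)
have e1 : a.-1%:R * q ^+ a.-2 * q = a.-1%:R * q ^+ a.-1.
  by case: (a) => [|[|b]]; rewrite ?mul0r//= -mulrA exprSr.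
have e2 : A * q ^+ a.-1 * q = A * q ^+ a.
  by rewrite /A; case: (a) => [|b]; rewrite ?mul0r//= -mulrA exprSr.
transitivity (- A * j ^+ 3 * (2 * (a.-1%:R * q ^+ a.-2 * q)
   - 3 * (A * q ^+ a.-1 * q) * q ^+ a.-1 * j ^+ 2) + - A * q ^+ a.-1 * j ^+ 3 * n%:R).
  ring.
rewrite e1 e2; ring.
Qed.

(* The zero-energy ground state of the angular momentum l sector, for the
   potential [- 3 a ^ 2 |x| ^ (2 a - 2) / (1 + |x| ^ (2 a)) ^ 2]. *)
Lemma laplacian_harm_profile l a x : (a.+2 = n + l.*2)%N ->
  laplacian (fun x => harmP l x * profile a x) x =
  - 3 * a%:R ^+ 2 * nrm2 x ^+ a.-1 * profile a x ^+ 4 *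
  (harmP l x * profile a x).
Proof.
move=> an; have [sP _] := sym_harm l.
rewrite (laplacianM x sP (sym_profile a)) laplacian_harm mulr0 addr0.
rewrite laplacian_profile.
have -> : \sum_(i < n) 'd_i (harmP l) x * 'd_i (profile a) x =
    - a%:R * nrm2 x ^+ a.-1 * profile a x ^+ 3 * (l%:R * harmP l x).
  rewrite -euler_harm mulr_sumr; apply: eq_bigr => i _.
  by have [_ ->] := is_d_profile a i x; ring.
have := profile_sqr a x; have [a0|a0] := posnP a.
  by rewrite a0 => _; ring.
have -> : (a.-1%:R : R) = a%:R - 1 by rewrite -[in RHS](prednK a0) -natr1; ring.
have -> : (n%:R : R) = a%:R + 2 - 2 * l%:R.
  by have := congr1 (fun k => k%:R : R) an; rewrite -addn2 !natrD -mul2n natrM; lra.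
set q := nrm2 x ^+ a; set j := profile a x => jq.
have {}jq : q * j ^+ 2 = 1 - j ^+ 2 by lra.
rewrite -[3 * _ * q * _]mulrA jq; ring.
Qed.

End profiles.

(** * Lebesgue measure on R^n *)

Section borel_boxes.
Context {R : realType} {n : nat}.
Local Notation rV := 'rV[R]_n.
Local Notation rvec := {ffun 'I_n -> rat}.

(** Rational corners keep the family countable: open sets are countable unions of boxes, and the
    exceptional couplings are later indexed by boxes. Corners in the wrong order give the empty box,
    so the family is closed under intersection. *)
Definition rbox (p : rvec * rvec) : set rV :=
  [set x | forall i, ratr (p.1 i) < x 0 i < ratr (p.2 i)].

Definition rboxes : set (set rV) := range rbox.

Let ratr_max_lt (a c : rat) (t : R) :
  (ratr (Num.max a c) < t) = (ratr a < t) && (ratr c < t).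
Proof.
case: (leP a c) => ac; apply/idP/andP => [h|[]//]; split => //;
  by apply: le_lt_trans h; rewrite ler_rat// ltW.
Qed.

Let lt_ratr_min (a c : rat) (t : R) :
  (t < ratr (Num.min a c)) = (t < ratr a) && (t < ratr c).
Proof.
case: (leP a c) => ac; apply/idP/andP => [h|[]//]; split => //;
  by apply: lt_le_trans h _; rewrite ler_rat// ltW.
Qed.

Lemma rboxI : setI_closed rboxes.
Proof.
move=> _ _ [[a b] _ <-] [[c d] _ <-].
exists ([ffun i => Num.max (a i) (c i)], [ffun i => Num.min (b i) (d i)]) => //.
apply/seteqP; split => x.
  move=> h; split => i /=; have := h i;
  by rewrite /= !ffunE ratr_max_lt lt_ratr_min => /andP[/andP[? ?] /andP[? ?]];
    apply/andP.
move=> [/= h1 h2] i; move: (h1 i) (h2 i).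
by rewrite /= !ffunE ratr_max_lt lt_ratr_min => /andP[-> ->] /andP[-> ->].
Qed.

Lemma open_rbox (U : set rV) (x : rV) : open U -> U x ->
  exists2 p, rbox p x & rbox p `<=` U.
Proof.
move=> oU Ux; have /nbhs_ballP[e /= e0 xe] := open_nbhs_nbhs (conj oU Ux).
have ha i : exists q, ratr q \in `](x 0 i - e), (x 0 i)[.
  by apply: rat_in_itvoo; rewrite ltrBlDr ltrDl.
have hb i : exists q, ratr q \in `](x 0 i), (x 0 i + e)[.
  by apply: rat_in_itvoo; rewrite ltrDl.
have [a ha'] := choice ha; have [b hb'] := choice hb.
exists ([ffun i => a i], [ffun i => b i]) => [i|y hy] /=.
  rewrite !ffunE; have := ha' i; have := hb' i; rewrite !in_itv /=.
  by move=> /andP[-> _] /andP[_ ->].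
apply: xe; split => // i j; rewrite (ord1 i) /ball /= ltr_distlC.
have := hy j; rewrite /= !ffunE; have := ha' j; have := hb' j; rewrite !in_itv /=.
by move=> /andP[_ h1] /andP[h2 _] /andP[h3 h4]; rewrite (lt_trans h2 h3) (lt_trans h4 h1).
Qed.

Lemma open_rbox_measurable (U : set rV) : open U ->
  rboxes.-sigma.-measurable U.
Proof.
move=> oU; pose F (p : rvec * rvec) := if `[< rbox p `<=` U >] then rbox p else set0.
rewrite (_ : U = \bigcup_p F p).
  apply: (@countable_bigcupT_measurable _ (g_sigma_algebraType rboxes)) => // p.
  rewrite /F; case: ifPn => _; last exact: measurable0.
  by apply: sub_sigma_algebra; exists p.
apply/seteqP; split => [x Ux|x [p _]].
  have [p px pU] := open_rbox oU Ux; exists p => //; rewrite /F ifT//.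
  exact/asboolP.
by rewrite /F; case: ifPn => // /asboolP; apply.
Qed.

Lemma measurable_box (A : 'I_n -> set R) : (forall i, measurable (A i)) ->
  measurable [set x : rV | forall i, A i (x 0 i)].
Proof.
move=> mA; rewrite [X in measurable X](_ : _ = \bigcap_(i in [set: 'I_n])
    ((fun x : rV => x 0 i : R) @^-1` A i)).
  apply: fin_bigcap_measurable => [|i _]; first exact: finite_finset.
  rewrite -[X in measurable X]setTI.
  exact: (measurable_coord i measurableT (mA i)).
by apply/seteqP; split => [x h i _|x h i]; exact: h.
Qed.

Lemma measurable_rbox p : measurable (rbox p).
Proof.
rewrite (_ : rbox p = [set x : rV | forall i, `]ratr (p.1 i), ratr (p.2 i)[%classic (x 0 i)]).
  apply: (@measurable_box (fun i => `]ratr (p.1 i), ratr (p.2 i)[%classic)) => i.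
  exact: measurable_itv.
by apply/seteqP; split => x h i; have := h i; rewrite /= in_itv.
Qed.

Lemma measurable_rVE : (@measurable _ rV) = <<s rboxes >>.
Proof.
apply/seteqP; split; last first.
  apply: smallest_sub; first exact: sigma_algebra_measurable.
  by move=> _ [p _ <-]; exact: measurable_rbox.
apply: smallest_sub; first exact: smallest_sigma_algebra.
move=> A; rewrite -bigcup_seq/= => -[i _ [B mB <-]].
suff : measurable_fun setT (fun x : g_sigma_algebraType rboxes => (x : rV) 0 i : R).
  by apply.
apply: (measurability _ (RGenOInfty.measurableE R)) => //.
move=> _ [_ [x ->] <-]; rewrite setTI.
apply: open_rbox_measurable; apply: open_comp; first by move=> y _; exact: coord_cont.
exact: interval_open.
Qed.

Lemma open_measurable_rV (U : set rV) : open U -> measurable U.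
Proof. by move=> /open_rbox_measurable; rewrite measurable_rVE. Qed.

Lemma continuous_measurable_rV (f : rV -> R) : continuous f ->
  measurable_fun setT f.
Proof.
move=> cf; apply: (measurability _ (RGenOInfty.measurableE R)) => //.
move=> _ [_ [x ->] <-]; rewrite setTI.
apply: open_measurable_rV; apply: open_comp; first by move=> y _; exact: cf.
exact: interval_open.
Qed.

End borel_boxes.

Section leb.
Context {R : realType}.

(* A copy of lebesgue_rV, made to carry the sigma-finite structure. *)
Definition leb n : set 'rV[R]_n -> \bar R := lebesgue_rV n.

HB.instance Definition _ n := Measure.copy (@leb n) (lebesgue_rV n).

Lemma leb_cube n (k : R) : 0 <= k ->
  leb [set x : 'rV[R]_n | forall i, `[(- k), k]%classic (x 0 i)] = ((2 * k) ^+ n)%:E.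
Proof.
move=> k0; rewrite /leb (@lebesgue_rV_box R n (fun=> `[(- k), k]%classic)) => [|i].
  rewrite (eq_bigr (fun=> (2 * k)%:E)) => [|i _].
    elim: n => [|n IH]; first by rewrite big_ord0 expr0.
    by rewrite big_ord_recl /= IH -EFinM exprS.
  rewrite lebesgue_measure_itv /= lte_fin.
  case: ltP => [_|kk]; first by rewrite -EFinB; congr EFin; ring.
  by congr EFin; lra.
exact: measurable_itv.
Qed.

Lemma leb_sigma_finite n : sigma_finite setT (@leb n).
Proof.
exists (fun k => [set x : 'rV[R]_n | forall i, `[(- k%:R), k%:R]%classic (x 0 i)]).
  apply/esym/seteqP; split => // x _.
  have [k hk] : exists k : nat, japanese x <= k%:R.
    exists (Num.truncn (japanese x)).+1; exact/ltW/truncnS_gt.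
  exists k => // i; rewrite /= in_itv /= -ler_norml.
  exact: le_trans (le_coord_japanese x i) hk.
move=> k; split; last by rewrite leb_cube// ltry.
by apply: (@measurable_box _ _ (fun=> `[(- k%:R), k%:R]%classic)) => i; exact: measurable_itv.
Qed.

HB.instance Definition _ n := @Measure_isSigmaFinite.Build _ _ _ (@leb n)
  (leb_sigma_finite n).

End leb.

(** * Convergence theorems for integrals *)

Section ndseq.
Local Open Scope ereal_scope.
Context d (T : measurableType d) (R : realType) (mu : {measure set T -> \bar R}).

Lemma cvg_integral_ndseq (f : T -> \bar R) (F : (set T)^nat) :
  mu.-integrable setT f -> (forall k, measurable (F k)) ->
  nondecreasing_seq F ->
  \int[mu]_(x in F k) f x @[k --> \oo] --> \int[mu]_(x in \bigcup_k F k) f x.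
Proof.
move=> fi mF ndF; under eq_fun do rewrite integral_mkcond.
rewrite integral_mkcond.
have mU : measurable (\bigcup_k F k) by exact: bigcupT_measurable.
have mf := measurable_int _ fi.
have [] // := @dominated_convergence _ _ _ mu setT measurableT
  (fun k => f \_ (F k)) (f \_ (\bigcup_k F k)) (fun x => `|f x|).
- by move=> k /=; apply: (measurable_restrictT f (mF k)).1; exact: measurable_funTS mf.
- by apply: (measurable_restrictT f mU).1; exact: measurable_funTS mf.
- apply: aeW => x _; rewrite /patch; case: ifPn => [/set_mem[k _ Fkx]|xF].
    apply: cvg_near_cst; exists k => // m /= km; rewrite ifT//.
    by apply/mem_set; move: (ndF _ _ km) => /subsetPset; apply.
  apply: cvg_near_cst; near=> k; rewrite ifF//; apply/negbTE.
  apply: contra xF => /set_mem Fx; apply/mem_set.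
  by exists k.
- exact: (integrable_abse fi).
- apply: aeW => x k _; rewrite /patch; case: ifPn => // _.
  by rewrite abse0.
Unshelve. all: by end_near. Qed.


Lemma real_dominated_convergence (f_ : nat -> T -> R) (f g : T -> R) :
  (forall k, measurable_fun setT (f_ k)) ->
  {ae mu, forall x, f_ ^~ x @ \oo --> f x}%R -> measurable_fun setT f ->
  mu.-integrable setT (EFin \o g) -> (forall k x, `|f_ k x| <= g x)%R ->
  \int[mu]_x (f_ k x)%:E @[k --> \oo] --> \int[mu]_x (f x)%:E.
Proof.
move=> mf_ ff mf gi fg.
have [] // := @dominated_convergence _ _ _ mu setT measurableT
  (fun k x => (f_ k x)%:E) (EFin \o f) (EFin \o g).
- by move=> k; apply/measurable_EFinP.
- exact/measurable_EFinP.
- apply: filterS ff => x ff _.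
  by apply: cvg_EFin; first exact: nearW.
- by apply: aeW => x k _; rewrite /= lee_fin fg.
Qed.

Lemma real_le_integrable (f g : T -> R) : measurable_fun setT f ->
  (forall x, `|f x| <= g x)%R -> mu.-integrable setT (EFin \o g) ->
  mu.-integrable setT (EFin \o f).
Proof.
move=> mf fg; apply: le_integrable => //; first exact/measurable_EFinP.
move=> x _ /=; rewrite lee_fin (le_trans (fg x))//; exact: ler_norm.
Qed.

End ndseq.

Section box_integrals.
Context {R : realType} {n : nat}.
Local Notation rV := 'rV[R]_n.
Local Notation mu := (@leb R n).
Implicit Types (f g : rV -> \bar R).

Definition rcube (k : nat) : set rV :=
  rbox ([ffun=> - k%:R], [ffun=> k%:R]).

Lemma rcubeE (k : nat) : rcube k = [set x : rV | forall i, - k%:R < x 0 i < k%:R].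
Proof.
by apply/seteqP; split => x h i; have := h i;
  rewrite /= !ffunE rmorphN /= ratr_nat.
Qed.

Lemma rcube_nd : nondecreasing_seq rcube.
Proof.
move=> k m km; apply/subsetPset; rewrite !rcubeE => x h i.
have /andP[h1 h2] := h i; have : (k%:R : R) <= m%:R by rewrite ler_nat.
by move=> h3; apply/andP; split; lra.
Qed.

Lemma rcube_cover : \bigcup_k rcube k = setT.
Proof.
apply/seteqP; split => // x _.
exists (Num.truncn (japanese x)).+1 => //; rewrite rcubeE => i.
rewrite -ltr_norml; apply: le_lt_trans (le_coord_japanese x i) _.
exact: truncnS_gt.
Qed.

(** A pi-lambda argument: the sets over which the two integrals agree form a lambda-system,
    integrability permitting subtraction, and the whole space is the increasing union of the cubes
    [rcube k]. *)
Lemma rbox_ae_eq f g : mu.-integrable setT f ->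
  mu.-integrable setT g ->
  (forall p, \int[mu]_(x in rbox p) f x = \int[mu]_(x in rbox p) g x)%E ->
  ae_eq mu setT f g.
Proof.
move=> fi gi fg; apply: integral_ae_eq => //; first exact: measurable_int gi.
suff H : <<s rboxes >> `<=` [set E | measurable E /\
    (\int[mu]_(x in E) f x = \int[mu]_(x in E) g x)%E].
  by move=> E _; rewrite measurable_rVE => /H[].
have mE (E : set rV) : measurable E -> mu.-integrable E f /\
    mu.-integrable E g.
  by move=> mE; split; exact: integrableS measurableT _ _ _.
apply: lambda_system_subset => //; [exact: rboxI| |]; last first.
  by move=> _ [p _ <-]; split; [exact: measurable_rbox|exact: fg].
have ndc (F : (set rV)^nat) : (forall k, measurable (F k)) -> nondecreasing_seq F ->
    (forall k, \int[mu]_(x in F k) f x = \int[mu]_(x in F k) g x)%E ->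
    (\int[mu]_(x in \bigcup_k F k) f x = \int[mu]_(x in \bigcup_k F k) g x)%E.
  move=> mF ndF e; have H1 := cvg_integral_ndseq fi mF ndF.
  have H2 := cvg_integral_ndseq gi mF ndF.
  have E : (fun k => \int[mu]_(x in F k) f x)%E = (fun k => \int[mu]_(x in F k) g x)%E.
    by apply/funext => k; exact: e.
  by rewrite E in H1; exact: (cvg_unique (@ereal_hausdorff R) H1 H2).
have eT : (\int[mu]_(x in setT) f x = \int[mu]_(x in setT) g x)%E.
  rewrite -rcube_cover; apply: ndc => [k||k]; [exact: measurable_rbox| |exact: fg].
  exact: rcube_nd.
split => //.
- move=> A B AB [mA eA] [mB eB]; split; first exact: measurableD.
  have eD (h : rV -> \bar R) : mu.-integrable setT h ->
      (\int[mu]_(x in A `\` B) h x =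
       \int[mu]_(x in A) h x - \int[mu]_(x in B) h x)%E.
    move=> hi; have hB := integrableS measurableT mB (@subsetT _ _) hi.
    rewrite -[in X in _ = (X - _)%E](setDUK AB) setUC integral_setU //=.
    - by rewrite addeK// integrable_fin_num.
    - exact: measurableD.
    - exact: measurable_funTS (measurable_int _ hi).
    - by rewrite disj_set2E setDE setIAC -setIA setICr setI0.
  by rewrite !eD// eA eB.
- move=> F ndF mF; split; first by apply: bigcupT_measurable => k; case: (mF k).
  by apply: ndc => // k; case: (mF k).
Qed.

End box_integrals.

(** * Affine changes of variables in integrals *)

Section change_of_variables.
Context {R : realType} {n : nat}.
Local Notation rV := 'rV[R]_n.
Local Notation mu := (@leb R n).

Lemma leb_obox (a b : 'I_n -> R) :
  leb [set x : rV | forall i, a i < x 0 i < b i] =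
  (\prod_(i < n) Num.max 0 (b i - a i))%:E.
Proof.
rewrite (_ : mkset _ = [set x : rV | forall i, `]a i, b i[%classic (x 0 i)]).
  rewrite /leb (@lebesgue_rV_box R n (fun i => `]a i, b i[%classic)) => [|i]; last exact: measurable_itv.
  elim/big_ind2 : _ => // [x s z t -> ->|i _]; first by rewrite EFinM.
  rewrite lebesgue_measure_itv /= lte_fin.
  case: ltP => ab; first by rewrite -EFinB max_r// subr_ge0 ltW.
  by rewrite max_l// subr_le0.
by apply/seteqP; split => x h i; have := h i; rewrite /= in_itv.
Qed.

Lemma measurable_affine (c : R) (y : rV) :
  measurable_fun setT (fun x : rV => c *: x + y).
Proof.
apply: measurable_fun_coordP => i.
under eq_fun do rewrite !mxE.
by apply: measurable_funD => //; apply: measurable_funM => //; exact: measurable_coord.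
Qed.

(** Both sides are measures in [A]; they agree on the pi-system of boxes and are finite on the
    exhausting cubes. *)
Lemma leb_affine (c : R) (y : rV) (A : set rV) : 0 < c -> measurable A ->
  mu ((fun x => c *: x + y) @^-1` A) = ((c ^- n)%:E * mu A)%E.
Proof.
move=> c0 mA; have cn0 : 0 <= c ^- n by rewrite invr_ge0 exprn_ge0// ltW.
pose m1 := measure_function_pushforward__canonical__measure_function_Measure mu
  (measurable_affine c y).
pose m2 : {measure set rV -> \bar R} := mscale (NngNum cn0) mu.
have m12 p : m1 (rbox p) = m2 (rbox p).
  rewrite /m1 /m2 /= /mscale /pushforward /= leb_obox -EFinM.
  rewrite (_ : _ @^-1` _ = [set x : rV | forall i,
      (ratr (p.1 i) - y 0 i) / c < x 0 i < (ratr (p.2 i) - y 0 i) / c]).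
    rewrite leb_obox; congr EFin.
    transitivity (\prod_(i < n) (c^-1 * Num.max 0 (ratr (p.2 i) - ratr (p.1 i)) : R)).
      apply: eq_bigr => i _; rewrite -mulrBl opprB addrA subrK.
      rewrite [X in Num.max _ X]mulrC !maxEle pmulr_rge0 ?invr_gt0//.
      by case: ifP => // _; rewrite mulr0.
    by rewrite big_split /= prodr_const card_ord exprVn.
  apply/seteqP; split => x h i; have := h i;
    rewrite /= !mxE; move: (ratr (p.1 i)) (ratr (p.2 i)) => a b;
    by rewrite ltr_pdivrMr// ltr_pdivlMr// ltrBlDr ltrBrDr [x 0 i * c]mulrC.
suff : m1 A = m2 A by [].
apply: (@measure_unique _ _ _ rboxes rcube) => //.
- exact: measurable_rVE.
- exact: rboxI.
- by move=> k; exists ([ffun=> - k%:R], [ffun=> k%:R]).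
- exact: rcube_cover.
- by move=> _ [p _ <-]; exact: m12.
- by move=> k; rewrite m12 /m2 /= /mscale /= leb_obox -EFinM ltry.
Qed.

Lemma ge0_integral_affine (c : R) (y : rV) (f : rV -> \bar R) : 0 < c ->
  measurable_fun setT f -> (forall x, 0 <= f x)%E ->
  (\int[mu]_x f (c *: x + y)%R = (c ^- n)%:E * \int[mu]_x f x)%E.
Proof.
move=> c0 mf f0; have cn0 : 0 <= c ^- n by rewrite invr_ge0 exprn_ge0// ltW.
rewrite -(@ge0_integral_mscale _ _ _ mu setT measurableT (NngNum cn0))//.
have := @ge0_integral_pushforward _ _ _ _ _ _ (measurable_affine c y) mu setT f.
rewrite preimage_setT => <- //.
pose m1 := measure_function_pushforward__canonical__measure_function_Measure mu
  (measurable_affine c y).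
apply: (@eq_measure_integral _ _ _ _ (mscale (NngNum cn0) mu) m1) => A mA _.
exact: leb_affine.
Qed.

Lemma integral_shift (y : rV) (f : rV -> \bar R) : measurable_fun setT f ->
  (\int[mu]_x f (x + y)%R = \int[mu]_x f x)%E.
Proof.
move=> mf; rewrite integralE [RHS]integralE.
have E (g : rV -> \bar R) : measurable_fun setT g -> (forall x, 0 <= g x)%E ->
    (\int[mu]_x g (x + y)%R = \int[mu]_x g x)%E.
  move=> mg g0; have := @ge0_integral_affine 1 y g ltr01 mg g0.
  rewrite expr1n invr1 mul1e => <-.
  by apply: eq_integral => x _; rewrite scale1r.
congr (_ - _)%E.
  rewrite -(E f^\+%E (measurable_funepos mf) (funepos_ge0 f)).
  by apply: eq_integral => x _; rewrite !funeposE.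
rewrite -(E f^\-%E (measurable_funeneg mf) (funeneg_ge0 f)).
by apply: eq_integral => x _; rewrite !funenegE.
Qed.


Definition ccube (e : R) : set rV := [set x | forall i, `[(- e), e]%classic (x 0 i)].

Lemma measurable_ccube e : measurable (ccube e).
Proof.
by apply: (@measurable_box _ _ (fun=> `[(- e), e]%classic)) => i; exact: measurable_itv.
Qed.

Lemma ccubeP e x : ccube e x <-> forall i, `|x 0 i| <= e.
Proof.
by split => h i; have := h i; rewrite /= ?in_itv /= ler_norml.
Qed.

Lemma leb_ccube e : 0 <= e -> mu (ccube e) = ((2 * e) ^+ n)%:E.
Proof. exact: leb_cube. Qed.

(** Dyadic layers take the place of polar coordinates: a radial weight is dominated by a sum of
    multiples of indicators of cubes, whose volumes are explicit. *)
Lemma integral_dyadic (c e : nat -> R) :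
  (forall k, 0 <= c k) -> (forall k, 0 <= e k) ->
  (\int[mu]_x (\sum_(k <oo) (c k * \1_(ccube (e k)) x)%:E) =
   \sum_(k <oo) (c k * (2 * e k) ^+ n)%:E)%E.
Proof.
move=> c0 e0; rewrite integral_nneseries//.
- apply: eq_eseriesr => k _; under eq_integral do rewrite EFinM.
  rewrite ge0_integralZl_EFin //; last first.
    by apply/measurable_EFinP/measurable_indic; exact: measurable_ccube.
  rewrite integral_indic// ?setIT; last exact: measurable_ccube.
  by rewrite EFinM; congr (_ * _)%E; exact: leb_ccube.
- move=> k; apply/measurable_EFinP; apply: measurable_funM => //.
  by apply: measurable_indic; exact: measurable_ccube.
- by move=> k x _; rewrite lee_fin mulr_ge0.
Qed.

End change_of_variables.

(** * Integrable weights and a majorant of the Newtonian kernel *)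

Section geometric_sums.
Context {R : realType}.

Lemma geometric_eseries_lty (a z : R) : 0 <= a -> 0 < z < 1 ->
  (\sum_(k <oo) (a * z ^+ k)%:E < +oo)%E.
Proof.
move=> a0 /andP[z0 z1]; apply: (@le_lt_trans _ _ (a * (1 - z)^-1)%:E); last exact: ltry.
apply: lime_le.
  by apply: is_cvg_nneseries => k _ _; rewrite lee_fin mulr_ge0// exprn_ge0// ltW.
apply: nearW => N; rewrite sumEFin lee_fin.
by apply: geometric_le_lim => //; rewrite ger0_norm// ltW.
Qed.

End geometric_sums.

Section kernels.
Context {R : realType} {n : nat}.
Local Notation rV := 'rV[R]_n.
Local Notation mu := (@leb R n).

Lemma eseries_ge_term (u : nat -> \bar R) k : (forall j, 0 <= u j)%E ->
  (u k <= \sum_(j <oo) u j)%E.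
Proof.
move=> u0; apply: le_trans (nneseries_lim_ge k.+1 _) => //.
by rewrite big_nat_recr//= leeDr// sume_ge0.
Qed.

Lemma measurable_japanese : measurable_fun setT (@japanese R n).
Proof.
apply: (@measurableT_comp _ _ _ _ _ _ (@Num.sqrt R)).
  exact: continuous_measurable_fun (@sqrt_continuous R).
rewrite (_ : (fun x => _) = (fun x => 1 + nrm2 x)); last first.
  by apply/funext => x; rewrite enorm2.
apply: continuous_measurable_rV; apply: sym_cont (2 : R) _ _.
by apply: symD; [apply: sym_le (sym_cst 1)|exact: sym_nrm2].
Qed.

Lemma measurable_powj (m : R) : measurable_fun setT (fun x : rV => japanese x `^ m).
Proof.
apply: (@measurableT_comp _ _ _ _ _ _ (@powR R ^~ m)); first exact: measurable_powR.
exact: measurable_japanese.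
Qed.

Lemma measurable_dyadic (c e : nat -> R) : (forall k, 0 <= c k) ->
  measurable_fun setT
    (fun x : rV => \sum_(k <oo) (c k * \1_(ccube (e k)) x)%:E)%E.
Proof.
move=> c0; apply: ge0_emeasurable_sum => [k x _ _|k _].
  by rewrite lee_fin mulr_ge0.
apply/measurable_EFinP; apply: measurable_funM => //.
by apply: measurable_indic; exact: measurable_ccube.
Qed.

Lemma powj_integrable (eta : R) : 0 < eta ->
  mu.-integrable setT (fun x => (japanese x `^ (- (n%:R + eta)))%:E).
Proof.
move=> eta0; apply/integrableP; split.
  by apply/measurable_EFinP; exact: measurable_powj.
(* The layer 2^k <= <x> <= 2^(k+1) lies in [ccube (e k)], and the weight is at most [c k] there. The
   volumes cancel the factor 2^(-kn) in [c k], leaving a geometric series of ratio 2^(-eta). *)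
pose c (k : nat) : R := (2 ^+ k) `^ (- (n%:R + eta)).
pose e (k : nat) : R := 2 ^+ k.+1.
have c0 k : 0 <= c k by exact: powR_ge0.
have e0 k : 0 <= e k by exact: exprn_ge0.
have le1 x : (`|(japanese x `^ (- (n%:R + eta)))%:E| <=
    \sum_(k <oo) (c k * \1_(ccube (e k)) (x : rV))%:E)%E.
  have exk : exists k : nat, japanese x <= e k.
    exists (Num.truncn (japanese x)); apply: ltW; apply: lt_le_trans (truncnS_gt _) _.
    by rewrite /e -natrX ler_nat ltnW// ltn_expl.
  case: (ex_minnP exk) => k jk mk.
  have jk' : 2 ^+ k <= japanese x.
    case: k jk mk => [|k] jk mk; first by rewrite expr0.
    rewrite leNgt; apply/negP => jk1; have := mk k (ltW jk1).
    by rewrite ltnn.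
  apply: le_trans (@eseries_ge_term _ k _); last first.
    by move=> j; rewrite lee_fin mulr_ge0.
  rewrite /= lee_fin indicE mem_set ?mulr1; last first.
    by apply/ccubeP => i; exact: le_trans (le_coord_japanese x i) jk.
  rewrite ger0_norm ?powR_ge0// /c !powRN lef_pV2 ?posrE ?powR_gt0 ?exprn_gt0//.
  by apply: powR_le2; rewrite ?exprn_ge0 ?addr_ge0 ?(ltW eta0).
apply: (@le_lt_trans _ _ (\int[mu]_x (\sum_(k <oo) (c k * \1_(ccube (e k)) (x : rV))%:E))%E).
  apply: ge0_le_integral => //.
  - apply: measurableT_comp => //; apply/measurable_EFinP; exact: measurable_powj.
  - exact: measurable_dyadic.
rewrite integral_dyadic//.
have z01 : 0 < (2 : R) `^ (- eta) < 1.
  rewrite powR_gt0//= powRN invf_lt1 ?powR_gt0//.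
  have : (1 : R) `^ eta < 2 `^ eta.
    by apply: (gt0_ltr_powR eta0); rewrite ?nnegrE ?ltr1n.
  by rewrite powR1.
rewrite (eq_eseriesr (g := fun k => (4 ^+ n * (2 `^ (- eta)) ^+ k)%:E)).
  by apply: geometric_eseries_lty => //; exact: exprn_ge0.
move=> k _; congr EFin; rewrite /c /e.
have -> : (2 ^+ k : R) `^ (- (n%:R + eta)) = ((2 ^+ k) ^+ n)^-1 * (2 `^ (- eta)) ^+ k.
  rewrite opprD powRD; last by apply/implyP => _; rewrite gt_eqF// exprn_gt0.
  have -> : (2 ^+ k : R) `^ (- n%:R) = ((2 ^+ k) ^+ n)^-1.
    by rewrite powRN powR_mulrn ?exprn_ge0.
  congr (_ * _); rewrite -(@powR_mulrn _ 2 k)//.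
  transitivity ((2 : R) `^ (k%:R * - eta)); first by rewrite powRrM.
  by rewrite [_ * - eta]mulrC powRrM powR_mulrn ?powR_ge0.
have -> : 2 * 2 ^+ k.+1 = 4 * 2 ^+ k :> R by rewrite exprS; ring.
by rewrite exprMn; field; rewrite !expf_neq0.
Qed.

(* A dyadic majorant of [|x| ^ (2 - n)], integrable over R^n near 0. *)
Definition newton_dyadic (x : rV) : \bar R :=
  (\sum_(k <oo) ((2 ^+ k.+1) ^+ (n - 2) * \1_(ccube (2 ^- k)) x)%:E)%E.

Lemma newton_dyadic_ge0 x : (0 <= newton_dyadic x)%E.
Proof. by apply: nneseries_ge0 => k _ _; rewrite lee_fin mulr_ge0// !exprn_ge0. Qed.

Lemma measurable_newton_dyadic : measurable_fun setT newton_dyadic.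
Proof. by apply: measurable_dyadic => k; rewrite !exprn_ge0. Qed.

(** Up to constants the k-th term is 2^(k(n-2)) 2^(-kn), so the ratio is 1/4 in every dimension. *)
Lemma newton_dyadic_lty : (2 <= n)%N -> (\int[mu]_x newton_dyadic x < +oo)%E.
Proof.
move=> n2; rewrite integral_dyadic => [|k|k]; rewrite ?invr_ge0 ?exprn_ge0//.
rewrite (eq_eseriesr (g := fun k => (2 ^+ (n - 2) * 2 ^+ n * (4^-1) ^+ k)%:E)).
  by apply: geometric_eseries_lty; lra || by rewrite mulr_ge0 ?exprn_ge0.
move=> k _; congr EFin.
rewrite exprSr !exprMn [X in _ = _ * X]exprVn.
have -> : (4 : R) ^+ k = 2 ^+ k ^+ 2 by rewrite exprAC expr2; congr (_ ^+ _); lra.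
rewrite -[X in _ * (_ * (2 ^- k) ^+ X) = _](subnK n2) exprVn exprD.
have k0 : 2 ^+ k != 0 :> R by rewrite expf_neq0.
by field; rewrite expf_neq0//= k0.
Qed.

Lemma newton_dyadic_opp x : newton_dyadic (- x) = newton_dyadic x.
Proof.
apply: eq_eseriesr => k _; congr (_ * _)%:E; rewrite !indicE; congr (_%:R).
congr nat_of_bool; apply/idP/idP => /set_mem/ccubeP h; apply/mem_set/ccubeP => i;
  by have := h i; rewrite mxE normrN.
Qed.

(** Three cases. If a coordinate exceeds 1 in modulus, then [F <= 1]. If x lies in every dyadic
    cube, that is x = 0, one term with 2^(k+1) above [F] is enough. Otherwise the last dyadic cube
    containing x contributes a term at least [F]. *)
Lemma le_newton_dyadic (F : R) (x : rV) : (3 <= n)%N -> 0 <= F ->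
  (forall i, F * `|x 0 i| ^+ (n - 2) <= 1) ->
  (F%:E <= newton_dyadic x + 1)%E.
Proof.
move=> n3 F0 hF.
have N0 : (0 < n - 2)%N by rewrite subn_gt0.
have nd0 := newton_dyadic_ge0 x.
suff [F1|[k hk Fk]] : F <= 1 \/ exists2 k, ccube (2 ^- k) x & F <= (2 ^+ k.+1) ^+ (n - 2).
- by apply: (@le_trans _ _ 1%E); [rewrite lee_fin|rewrite leeDr].
- apply: (@le_trans _ _ (newton_dyadic x)); last by rewrite leeDl.
  apply: le_trans (@eseries_ge_term _ k _); last first.
    by move=> j; rewrite lee_fin mulr_ge0// !exprn_ge0.
  by rewrite lee_fin indicE mem_set// mulr1.
have [hx|] := pselect (forall i, `|x 0 i| <= 1); last first.
  move=> /existsNP[i /negP]; rewrite -ltNge => xi; left.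
  by apply: le_trans (hF i); rewrite ler_peMr// exprn_ege1// ltW.
have [h|] := pselect (forall k : nat, ccube (2 ^- k) x).
  right; exists (Num.truncn F) => //.
  apply: (@le_trans _ _ (2 ^+ (Num.truncn F).+1)).
    apply: ltW; apply: lt_le_trans (truncnS_gt _) _.
    by rewrite -natrX ler_nat ltnW// ltn_expl.
  by rewrite ler_eXnr// -natrX ler1n expn_gt0.
move=> /existsNP hk.
have ex : exists k : nat, ~~ `[< ccube (2 ^- k) x >].
  by have [k hk'] := hk; exists k; apply/asboolPn.
have [k /asboolPn hk1 mk] := ex_minnP ex.
case: k hk1 mk => [|k] hk1 mk.
  by case: hk1; apply/ccubeP => i; rewrite expr0 invr1.
right; exists k.
  apply: contrapT => hk2; have := mk k; rewrite ltnn => H.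
  by have := H (introT (asboolPn _) hk2).
move: hk1 => /ccubeP/existsNP[i /negP]; rewrite -ltNge => xi.
have xi0 : 0 < `|x 0 i| by apply: lt_trans xi; rewrite invr_gt0 exprn_gt0.
have := hF i; rewrite -ler_pdivlMr ?exprn_gt0// div1r => /le_trans; apply.
rewrite -exprVn; apply: lerXn2r; rewrite ?nnegrE ?invr_ge0 ?exprn_ge0//.
by rewrite -[leRHS]invrK lef_pV2 ?posrE ?invr_gt0 ?exprn_gt0// ltW.
Qed.

End kernels.

(** * Integration by parts for functions of compact support *)

Section integration_by_parts.
Context {R : realType} {n : nat}.
Local Notation rV := 'rV[R]_n.
Local Notation mu := (@leb R n).

Lemma integrable_ccube (f : rV -> R) (C e : R) : measurable_fun setT f ->
  0 <= e -> (forall x, `|f x| <= C) -> (forall x, ~ ccube e x -> f x = 0) ->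
  mu.-integrable setT (EFin \o f).
Proof.
move=> mf e0 fC f0; apply: (@real_le_integrable _ _ _ mu f (fun x => C * \1_(ccube e) x)) => //.
  move=> x; rewrite indicE; have [h|h] := pselect (ccube e x).
    by rewrite mem_set// mulr1.
  by rewrite f0// normr0 memNset// mulr0.
have -> : EFin \o (fun x : rV => C * \1_(ccube e) x) =
  (fun x => C%:E * (EFin \o \1_(ccube e)) x)%E by apply/funext => x /=; rewrite EFinM.
apply: integrableZl => //.
apply/integrableP; split.
  by apply/measurable_EFinP; apply: measurable_indic; exact: measurable_ccube.
under eq_integral do rewrite /= ger0_norm//.
rewrite integral_indic// ?setIT; last exact: measurable_ccube.
by apply: le_lt_trans (ltry ((2 * e) ^+ n)); rewrite -(@leb_ccube R n e e0).
Qed.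

Lemma cvg_invS_dnbhs : (fun k : nat => k.+1%:R^-1 : R) @ \oo --> 0^'.
Proof.
move=> P P0; have H : \forall k \near \oo, (harmonic k != 0 :> R -> P (harmonic k)).
  exact: (@cvg_harmonic R _ P0).
by apply: filterS H => k; apply; rewrite /= invr_eq0 pnatr_eq0.
Qed.

Lemma mean_value_bound (i : 'I_n) (F G : rV -> R) (S t : R) (x : rV) : 0 <= t ->
  (forall x, is_derive x (basis_vec i) F (G x)) ->
  (forall x, `|G x| <= S) -> `|F (x + t *: basis_vec i) - F x| <= S * t.
Proof.
move=> t0 FG GS.
have [c _] := @MVT_segment R (fun t : R => F (t *: basis_vec i + x))
  (fun t => G (t *: basis_vec i + x)) 0 t t0
  (fun t _ => is_derive_line (erefl _) (FG _))
  (continuous_subspaceT (fun t : R => differentiable_continuous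
    ((derivable1_diffP _ _).1 (@ex_derive _ _ _ _ _ _ _
      (is_derive_line (erefl _) (FG (t *: basis_vec i + x))))))).
rewrite scale0r add0r subr0 [x + _]addrC => ->.
by rewrite normrM (ger0_norm t0) ler_wpM2r.
Qed.

(** By translation invariance every difference quotient of [F] has integral 0. The mean value
    theorem bounds the quotients by [S], on a cube containing the supports of all translates used,
    and dominated convergence concludes. *)
Lemma integral_deriv0 (i : 'I_n) (F G : rV -> R) (S e : R) :
  0 < e -> measurable_fun setT F -> measurable_fun setT G ->
  (forall x, is_derive x (basis_vec i) F (G x)) ->
  (forall x, `|G x| <= S) -> (forall x, ~ ccube e x -> F x = 0) ->
  (\int[mu]_x (G x)%:E = 0)%E.
Proof.
move=> e0 mF mG FG GS F0.
pose h (k : nat) : R := k.+1%:R^-1.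
have h0 k : 0 < h k by rewrite invr_gt0.
have h1 k : h k <= 1 by rewrite invf_le1// ler1n.
(* From a point of [ccube e], a translation by 2 e + 1 leaves the cube, hence reaches a zero of
   [F]. *)
have FS x : `|F x| <= S * (2 * e + 1).
  have t0 : 0 <= 2 * e + 1 by lra.
  have := mean_value_bound x t0 FG GS.
  have [xe|/F0 ->] := pselect (ccube e x); last first.
    by rewrite subr0 normr0 => H; apply: le_trans H.
  rewrite F0 ?sub0r ?normrN// => /ccubeP/(_ i); rewrite !mxE !eqxx mulr1.
  move/ccubeP : xe => /(_ i); rewrite !ler_norml => /andP[? ?] /andP[? ?]; lra.
pose q k x := (h k)^-1 * (F (x + h k *: basis_vec i) - F x).
have mvt k x : `|q k x| <= S.
  rewrite /q normrM gtr0_norm ?invr_gt0// mulrC ler_pdivrMr//.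
  exact: mean_value_bound (ltW (h0 k)) FG GS.
have F0' k x : ~ ccube (e + 1) x -> F (x + h k *: basis_vec i) = 0.
  move=> nx; apply: F0 => /ccubeP ye; apply: nx; apply/ccubeP => j.
  have := ye j; rewrite !mxE eqxx /= => {}ye.
  have -> : x 0 j = (x 0 j + h k * (j == i)%:R) - h k * (j == i)%:R by rewrite addrK.
  apply: le_trans (ler_normB _ _) _; apply: lerD => //.
  rewrite normrM (gtr0_norm (h0 k)).
  by rewrite mulr_ile1// ?(ltW (h0 k))//; case: (j == i); rewrite ?normr1 ?normr0.
have F01 x : ~ ccube (e + 1) x -> F x = 0.
  move=> nx; apply: F0 => /ccubeP xe; apply: nx; apply/ccubeP => j.
  by rewrite (le_trans (xe j))// lerDl.
have e1 : 0 <= e + 1 by rewrite addr_ge0// ltW.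
have mshift k : measurable_fun setT (fun x : rV => F (x + h k *: basis_vec i)).
  apply: (@measurableT_comp _ _ _ _ _ _ F) => //.
  have := measurable_affine 1 (h k *: basis_vec i : rV).
  by under eq_fun do rewrite scale1r.
have mq k : measurable_fun setT (q k).
  by apply: measurable_funM => //; apply: measurable_funB.
have iF : mu.-integrable setT (EFin \o F) by exact: integrable_ccube FS F01.
have iFk k : mu.-integrable setT (EFin \o (fun x => F (x + h k *: basis_vec i))).
  exact: integrable_ccube (mshift k) e1 (fun x => FS _) (F0' k).
have intq k : (\int[mu]_x (q k x)%:E = 0)%E.
  under eq_integral do rewrite /q EFinM EFinB.
  rewrite (integralZl measurableT (integrableB measurableT (iFk k) iF)).
  rewrite integralB// (integral_shift _ (f := EFin \o F)); last exact/measurable_EFinP.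
  by rewrite subee ?mule0// integrable_fin_num.
have qG x : q ^~ x @ \oo --> G x.
  have [dF <-] := FG x.
  have H : h^-1 *: ((F \o shift x) (h *: basis_vec i) - F x) @[h --> 0^'] --> 'D_(basis_vec i) F x.
    exact: dF.
  have := cvg_comp _ _ cvg_invS_dnbhs H.
  by apply: cvg_trans; apply: near_eq_cvg; near=> k; rewrite /q /= [x + _]addrC.
have S0 : 0 <= S by apply: le_trans (GS 0).
have iS : mu.-integrable setT (EFin \o (fun x => S * \1_(ccube (e + 1)) x)).
  apply: (@integrable_ccube _ S (e + 1)) => //.
  - apply: measurable_funM => //; apply: measurable_indic; exact: measurable_ccube.
  - by move=> x; rewrite indicE ger0_norm ?mulr_ge0// ler_piMr//; case: (_ \in _).
  - by move=> x nx; rewrite indicE memNset// mulr0.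
have H := @real_dominated_convergence _ _ _ mu q G
  (fun x => S * \1_(ccube (e + 1)) x) mq (aeW _ qG) mG iS.
have bq k x : `|q k x| <= S * \1_(ccube (e + 1)) x.
  rewrite indicE; have [xe|xe] := pselect (ccube (e + 1) x).
    by rewrite mem_set// mulr1.
  by rewrite memNset// /q F0'// F01// subrr mulr0 normr0 mulr0.
have {H} := H bq; rewrite (_ : (fun k => \int[mu]_x (q k x)%:E)%E = cst 0%E); last first.
  by apply/funext => k; rewrite intq.
move=> H; exact: (cvg_unique (@ereal_hausdorff R) H (cvg_cst 0%E)).
Unshelve. all: by end_near. Qed.

End integration_by_parts.

(** * Test functions and weak solutions *)

Section test_functions.
Context {R : realType} {n : nat}.
Local Notation rV := 'rV[R]_n.
Local Notation mu := (@leb R n).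
Implicit Types (f g phi psi : rV -> R).

Lemma compact_ccube (e : R) : compact (ccube e : set rV).
Proof. by apply: (@rV_compact R n (fun=> `[(- e), e]%classic)) => _; exact: segment_compact. Qed.

Lemma closed_ccube (e : R) : closed (ccube e : set rV).
Proof.
rewrite (_ : ccube e = \bigcap_(i in [set: 'I_n])
    ((fun x : rV => x 0 i : R) @^-1` `[(- e), e]%classic)).
  apply: closed_bigI => i _; apply: closed_comp; last exact: interval_closed.
  by move=> x _; exact: coord_cont.
by apply/seteqP; split => [x h i _|x h i]; exact: h.
Qed.

Lemma continuous_ccube_bounded f (e : R) : continuous f ->
  (forall x, ~ ccube e x -> f x = 0) ->
  exists2 C, 0 <= C & forall x, `|f x| <= C.
Proof.
move=> cf f0.
have : compact (f @` (ccube e)).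
  by apply: continuous_compact (@compact_ccube e); exact: continuous_subspaceT.
move/compact_bounded => [M [_ hM]].
exists (`|M| + 1) => [|x]; first by rewrite addr_ge0.
have [xe|/f0 ->] := pselect (ccube e x); last by rewrite normr0 addr_ge0.
apply: hM; last by exists x.
by rewrite (le_lt_trans (ler_norm M))// ltrDl.
Qed.

Lemma derive_out_ccube f (e : R) (i : 'I_n) x :
  (forall x, ~ ccube e x -> f x = 0) -> ~ ccube e x ->
  'D_(basis_vec i) f x = 0.
Proof.
move=> f0 xe.
have [//|_ ->//] := @near_eq_is_derive _ _ _ (fun=> 0) f x (basis_vec i) 0 _
  (is_dcst 0 x (basis_vec i)).
have : open (~` (ccube e : set rV)) by rewrite openC; exact: closed_ccube.
move=> oC; have := open_nbhs_nbhs (conj oC xe); apply: filterS => y ye.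
by rewrite f0.
Qed.

Lemma test_function_support phi : test_function phi ->
  exists2 e, 0 < e & forall s x, ~ ccube e x -> partials s phi x = 0.
Proof.
move=> [sphi /compact_bounded[M [_ hM]]].
pose e := `|M| + 1; have e0 : 0 < e by rewrite ltr_wpDl.
exists e => //; elim => [|i s IH] x xe /=; last exact: derive_out_ccube IH xe.
apply: contrapT => /eqP phix; apply: xe; apply/ccubeP => i.
have : `|x| <= e.
  apply: hM; last exact: subset_closure.
  by rewrite (le_lt_trans (ler_norm M))// ltrDl.
apply: le_trans; rewrite [leRHS]/Num.Def.normr /= mx_normrE.
by apply/bigmax_geP; right; exists (0, i).
Qed.

Lemma test_function_intro (m e : R) phi : sym m phi ->
  (forall x, ~ ccube e x -> phi x = 0) -> test_function phi.
Proof.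
move=> sphi phi0; split; first exact: sym_smooth sphi.
apply: subclosed_compact (@compact_ccube e) _; first exact: closed_closure.
rewrite [X in _ `<=` X]((closure_id _).1 (@closed_ccube e)).
apply: closure_subset => x /eqP phix; apply: contrapT => xe.
by apply: phix; rewrite phi0.
Qed.

Lemma smooth_cont phi s : smooth phi -> continuous (partials s phi : rV -> R).
Proof. by move=> /(_ s)[]. Qed.

Lemma smooth_is_d phi s i x : smooth phi ->
  is_derive x (basis_vec i) (partials s phi : rV -> R) (partials (i :: s) phi x).
Proof. by move=> /(_ s)[_ /(_ i x)/derivableP]. Qed.

Lemma smooth_measurable phi s : smooth phi ->
  measurable_fun setT (partials s phi : rV -> R).
Proof. by move=> h; apply: continuous_measurable_rV; exact: smooth_cont. Qed.

Lemma laplacian_measurable phi : smooth phi ->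
  measurable_fun setT (laplacian phi).
Proof.
move=> h; apply: measurable_sum => i.
exact: smooth_measurable.
Qed.

Lemma test_bounded phi s : test_function phi ->
  exists2 C, 0 <= C & forall x, `|partials s phi x| <= C.
Proof.
move=> tphi; have [e _ phi0] := test_function_support tphi.
by apply: (@continuous_ccube_bounded _ e); [exact: smooth_cont tphi.1|exact: phi0].
Qed.

Lemma laplacian_bounded phi : test_function phi ->
  exists2 C, 0 <= C & forall x, `|laplacian phi x| <= C.
Proof.
move=> tphi; have [e _ phi0] := test_function_support tphi.
apply: (@continuous_ccube_bounded _ e).
  rewrite (_ : laplacian phi = \sum_i (partials [:: i; i] phi : rV -> R)).
    apply: (big_ind (fun f : rV -> R => continuous f)) => [|f g cf cg|i _]; first exact: cst_continuous.
      by move=> x; apply: (@continuousD _ _ _ f g); [exact: cf|exact: cg].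
    exact: smooth_cont tphi.1.
  by apply/funext => x; rewrite fct_sumE.
by move=> x xe; apply: big1 => i _; exact: phi0.
Qed.

Let green_ring (a b c d e h : R) :
  (a * b + c * d) + - (e * h + d * c) = a * b - e * h.
Proof. by ring. Qed.

Let green_bound (a b c d A B C D : R) : `|a| <= A -> `|b| <= B ->
  `|c| <= C -> `|d| <= D -> `|a * b - c * d| <= A * B + C * D.
Proof.
move=> aA bB cC dD; apply: le_trans (ler_normB _ _) _.
by rewrite !normrM lerD// ler_pM.
Qed.

Lemma green phi psi : test_function phi -> test_function psi ->
  \int[mu]_x (psi x * laplacian phi x) = \int[mu]_x (phi x * laplacian psi x).
Proof.
move=> tphi tpsi.
have [e e0 phi0] := test_function_support tphi.
have [e' e'0 psi0] := test_function_support tpsi.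
have ip f g s s' : test_function f -> test_function g ->
    mu.-integrable setT (EFin \o (fun x => partials s f x * partials s' g x)).
  move=> tf tg; have [a a0 f0] := test_function_support tf.
  have [C C0 fC] := test_bounded s tf; have [D D0 gD] := test_bounded s' tg.
  apply: (@integrable_ccube _ _ _ (C * D) a) => //; last first.
  - by move=> x xa; rewrite f0// mul0r.
  - by move=> x; rewrite normrM ler_pM.
  - exact: ltW.
  - by apply: measurable_funM; [apply: smooth_measurable tf.1|apply: smooth_measurable tg.1].
have E f g : test_function f -> test_function g ->
    \int[mu]_x (f x * laplacian g x) =
    \sum_(i < n) \int[mu]_x (f x * partials [:: i; i] g x).
  move=> tf tg; rewrite /Rintegral.
  under eq_integral do rewrite /laplacian mulr_sumr -sumEFin.
  rewrite integral_sum//=; last by move=> i; exact: (ip f g [::] [:: i; i]).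
  rewrite -sum_fine// => i _; apply: integrable_fin_num => //.
  exact: (ip f g [::] [:: i; i]).
apply: (etrans (E psi phi tpsi tphi)); apply: esym.
apply: (etrans (E phi psi tphi tpsi)); apply: eq_bigr => i _; apply: esym.
have i1 : mu.-integrable setT (EFin \o (fun x => psi x * partials [:: i; i] phi x)).
  exact: (ip psi phi [::] [:: i; i]).
have i2 : mu.-integrable setT (EFin \o (fun x => phi x * partials [:: i; i] psi x)).
  exact: (ip phi psi [::] [:: i; i]).
apply: subr0_eq; rewrite -(RintegralB measurableT i1 i2) /Rintegral.
have [C1 C10 h1] := test_bounded [::] tphi.
have [C2 C20 h2] := test_bounded [:: i; i] tphi.
have [C3 C30 h3] := test_bounded [::] tpsi.
have [C4 C40 h4] := test_bounded [:: i; i] tpsi.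
(* In the derivative of [F] the products of first derivatives cancel, so [G] is a pure derivative
   and has integral 0. *)
pose F x : R := psi x * partials [:: i] phi x + - (phi x * partials [:: i] psi x).
pose G x : R := psi x * partials [:: i; i] phi x - phi x * partials [:: i; i] psi x.
have dFG x : is_derive x (basis_vec i) F (G x).
  have := is_dD (is_dM (smooth_is_d [::] i x tpsi.1) (smooth_is_d [:: i] i x tphi.1))
    (is_dN (is_dM (smooth_is_d [::] i x tphi.1) (smooth_is_d [:: i] i x tpsi.1))).
  by congr is_derive; exact: green_ring.
have mp s : measurable_fun setT (partials s phi : rV -> R) by apply: smooth_measurable tphi.1.
have mq s : measurable_fun setT (partials s psi : rV -> R) by apply: smooth_measurable tpsi.1.
have mF : measurable_fun setT F.
  apply: measurable_funD; first exact: (measurable_funM (mq [::]) (mp [:: i])).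
  by apply: measurableT_comp => //; exact: (measurable_funM (mp [::]) (mq [:: i])).
have mG : measurable_fun setT G.
  by apply: measurable_funB; [exact: (measurable_funM (mq [::]) (mp [:: i; i]))|
    exact: (measurable_funM (mp [::]) (mq [:: i; i]))].
have GS x : `|G x| <= C3 * C2 + C1 * C4.
  exact: (green_bound (h3 x) (h2 x) (h1 x) (h4 x)).
have F0 x : ~ ccube e x -> F x = 0.
  move=> xe; rewrite /F (phi0 [:: i] x xe) (phi0 [::] x xe : phi x = 0).
  by rewrite mulr0 mul0r subr0.
by have -> := integral_deriv0 e0 mF mG dFG GS F0.
Qed.

End test_functions.

(** * Weak solutions tested against symbols *)

Section weak_solutions.
Context {R : realType} {n : nat}.
Local Notation rV := 'rV[R]_n.
Local Notation mu := (@leb R n).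
Local Notation J m x := (japanese x `^ m).
Implicit Types (f g v V : rV -> R).

(** Uniformity in [r] is the point. Each derivative costs a factor 1/r, and <x> <= r <x/r> for r >=
    1 turns r^(-k) <x/r>^(-k) into at most <x>^(-k). *)
Lemma cutoff_scale_bound (s : seq 'I_n) : exists2 C, 0 <= C &
  forall (r : R) (x : rV), 1 <= r ->
  `|partials s (fun x => cutoff (r^-1 *: x)) x| <= C * J (- (size s)%:R) x.
Proof.
have sc : sym 0 (@cutoff R n) by exact: sym_cutoff.
have [C C0 hC] := sym_bnd (sym_partials s sc); exists C; first exact: C0.
move=> r x r1; have r0 : 0 < r by apply: lt_le_trans r1.
rewrite (partials_scale _ _ _ (sym_smooth sc)) normrM.
have := hC (r^-1 *: x); rewrite sub0r.
move: (partials s cutoff (r^-1 *: x)) (size s) => p k h.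
have rk : 0 <= r^-1 ^+ k by rewrite exprn_ge0// invr_ge0 ltW.
rewrite (ger0_norm rk); apply: le_trans (ler_wpM2l rk h) _.
rewrite mulrCA ler_wpM2l// !powRN exprVn -invfM -powR_mulrn ?(ltW r0)//.
have j0 : 0 <= japanese (r^-1 *: x) by exact: ltW (japanese_gt0 _).
rewrite -powRM ?(ltW r0)// lef_pV2 ?posrE ?powR_gt0 ?mulr_gt0 ?japanese_gt0//.
apply: powR_le2 => //; first exact: ltW (japanese_gt0 _).
rewrite -(@ler_pXn2r _ 2)// ?nnegrE ?mulr_ge0 ?(ltW r0) ?(ltW (japanese_gt0 x))//.
rewrite exprMn !japanese_sqr.
have -> : nrm2 (r^-1 *: x) = r^-1 ^+ 2 * nrm2 x.
  by rewrite /nrm2 mulr_sumr; apply: eq_bigr => i _; rewrite mxE exprMn.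
rewrite mulrDr mulr1 mulrA -exprMn divff ?gt_eqF// expr1n mul1r lerD2r.
by rewrite exprn_ege1.
Qed.

Lemma nrm2_scale (c : R) (x : rV) : nrm2 (c *: x) = c ^+ 2 * nrm2 x.
Proof. by rewrite /nrm2 mulr_sumr; apply: eq_bigr => i _; rewrite mxE exprMn. Qed.

Lemma sym_laplacian m f : sym m f -> sym (m - 2) (laplacian f).
Proof. by move=> sf; apply: sym_sum => i; exact: (sym_partials [:: i; i] sf). Qed.

Lemma cutoff_scale_unif : exists2 C, 0 <= C &
  forall (r : R) (x : rV), 1 <= r -> let chi := fun x : rV => cutoff (r^-1 *: x) in
  [/\ `|chi x| <= C, forall i, `|'D_(basis_vec i) chi x| <= C * J (- 1) x &
      `|laplacian chi x| <= C * J (- 2) x].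
Proof.
have [C0 C00 h0] := cutoff_scale_bound [::].
have /choice[C1 h1] : forall i : 'I_n, exists C, 0 <= C /\ forall (r : R) (x : rV), 1 <= r ->
    `|partials [:: i] (fun x => cutoff (r^-1 *: x)) x| <= C * J (- 1) x.
  by move=> i; have [C ? h] := cutoff_scale_bound [:: i]; exists C.
have /choice[C2 h2] : forall i : 'I_n, exists C, 0 <= C /\ forall (r : R) (x : rV), 1 <= r ->
    `|partials [:: i; i] (fun x => cutoff (r^-1 *: x)) x| <= C * J (- 2) x.
  by move=> i; have [C ? h] := cutoff_scale_bound [:: i; i]; exists C.
have s1 : 0 <= \sum_i C1 i by apply: sumr_ge0 => i _; case: (h1 i).
have s2 : 0 <= \sum_i C2 i by apply: sumr_ge0 => i _; case: (h2 i).
exists (C0 + \sum_i C1 i + \sum_i C2 i); first by rewrite !addr_ge0.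
move=> r x r1 chi; split.
- have := h0 r x r1; rewrite oppr0 powRr0 mulr1 => H.
  by apply: (le_trans H); rewrite -addrA lerDl addr_ge0.
- move=> i; have [C1i H] := h1 i; apply: (le_trans (H r x r1)).
  apply: ler_wpM2r; first exact: powR_ge0.
  rewrite (bigD1 i)//= [C0 + _]addrC -!addrA lerDl !addr_ge0//.
  by apply: sumr_ge0 => j _; case: (h1 j).
- apply: (le_trans (ler_norm_sum _ _ _)).
  apply: (@le_trans _ _ (\sum_i C2 i * J (- 2) x)).
    by apply: ler_sum => i _; case: (h2 i) => _ /(_ r x r1).
  by rewrite -mulr_suml; apply: ler_wpM2r; [exact: powR_ge0|rewrite lerDr addr_ge0].
Qed.

(* Both conditions hold as soon as <x>^m v is square integrable for some
   m > -3/2, so this covers eigenfunctions and resonances at once. *)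
Definition zclass v := [/\ measurable_fun setT v,
  mu.-integrable setT (EFin \o (fun x => v x * J (- n%:R) x)) &
  mu.-integrable setT (EFin \o (fun x => v x ^+ 2 * J (- 3) x))].

Definition zsol V v := forall phi : rV -> R, test_function phi ->
  \int[mu]_x (v x * (- laplacian phi x + V x * phi x)) = 0.

Lemma zclass_integrable v f : zclass v -> measurable_fun setT f ->
  (exists C, forall x, `|f x| <= C * J (- n%:R) x) ->
  mu.-integrable setT (EFin \o (fun x => v x * f x)).
Proof.
move=> [mv iv _] mf [C fC].
have ia : mu.-integrable setT (EFin \o (fun x => C * `|v x * J (- n%:R) x|)).
  have := integrableZl measurableT C (integrable_abse iv).
  by apply: eq_integrable => // x _ /=; rewrite EFinM.
apply: real_le_integrable ia; first exact: measurable_funM.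
move=> x; rewrite !normrM mulrCA ler_wpM2l// (ger0_norm (powR_ge0 _ _)).
exact: fC.
Qed.

(** The admissible test functions are extended to symbols of the order of the Newtonian kernel.
    Truncation of [Phi] at radius comparable to [k.+1] gives terms bounded by <x>^(-n) uniformly in
    [k], which [zclass] makes integrable against [v]. *)
Lemma weak_eq_sym V v (CV : R) (Phi : rV -> R) : zclass v ->
  measurable_fun setT V -> (forall x, `|V x| <= CV * J (- 2) x) ->
  zsol V v -> sym (2 - n%:R) Phi ->
  (\int[mu]_x (v x * (- laplacian Phi x + V x * Phi x))%:E = 0)%E.
Proof.
move=> zv mV VC sol sPhi.
pose r (k : nat) : R := k.+1%:R.
have r1 k : 1 <= r k by rewrite ler1n.
have r0 k : 0 < r k by rewrite ltr0n.
pose chi (k : nat) (x : rV) : R := cutoff ((r k)^-1 *: x : rV).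
have schi k m : sym m (chi k).
  rewrite (_ : chi k = fun x => cutoff ((r k)^-1 *: x + 0)); last first.
    by apply/funext => x; rewrite addr0.
  by apply: sym_affine; [rewrite invr_eq0 gt_eqF|exact: sym_cutoff].
have tf k : test_function (fun x => Phi x * chi k x).
  apply: (@test_function_intro _ _ _ (2 * r k) _ (symM sPhi (schi k 0))) => x nx.
  rewrite /chi cutoff_out ?mulr0// nrm2_scale exprVn ler_pdivlMl ?exprn_gt0//.
  move/ccubeP : nx => /existsNP[i /negP]; rewrite -ltNge => xi.
  have xi2 : (2 * r k) ^+ 2 <= x 0 i ^+ 2.
    rewrite -(real_normK (num_real (x 0 i))) ler_pXn2r// ?nnegrE ?mulr_ge0 ?(ltW (r0 k))//.
    exact: ltW.
  rewrite (_ : _ * 4 = (2 * r k) ^+ 2); last by rewrite exprMn; ring.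
  apply: (le_trans xi2); rewrite /nrm2 (bigD1 i)//= lerDl.
  by apply: sumr_ge0 => j _; exact: sqr_ge0.
have mPhi : measurable_fun setT Phi.
  by apply: continuous_measurable_rV; exact: sym_cont sPhi.
have msm f m : sym m f -> measurable_fun setT f.
  by move=> /sym_cont; exact: continuous_measurable_rV.
have mlap f m : sym m f -> measurable_fun setT (laplacian f).
  by move=> /sym_smooth; exact: laplacian_measurable.
pose T k x : R := - laplacian (fun x => Phi x * chi k x) x + V x * (Phi x * chi k x).
pose T0 x : R := - laplacian Phi x + V x * Phi x.
have mT k : measurable_fun setT (T k).
  apply: measurable_funD; first by apply: measurableT_comp => //; exact: mlap (symM sPhi (schi k 0)).
  by apply: measurable_funM => //; exact: msm (symM sPhi (schi k 0)).
have mT0 : measurable_fun setT T0.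
  apply: measurable_funD; last exact: measurable_funM.
  by apply: measurableT_comp => //; exact: mlap sPhi.
have lapE k x : laplacian (fun x => Phi x * chi k x) x =
    Phi x * laplacian (chi k) x
    + 2 * \sum_(i < n) 'D_(basis_vec i) Phi x * 'D_(basis_vec i) (chi k) x
    + chi k x * laplacian Phi x by exact: laplacianM sPhi (schi k 0).
have [C Cb] : exists C, forall k x, `|T k x| <= C * J (- n%:R) x.
  have [B B0 hB] := cutoff_scale_unif.
  have [A0 A00 hA0] := sym_bnd sPhi.
  have [A2 A20 hA2] := sym_bnd (sym_laplacian sPhi).
  have /choice[A1 hA1] : forall i : 'I_n, exists A, 0 <= A /\
      forall x, `|'D_(basis_vec i) Phi x| <= A * J (2 - n%:R - 1) x.
    by move=> i; have [A ? h] := sym_bnd (sym_d i sPhi); exists A.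
  exists (A0 * B + 2 * (\sum_i A1 i * B) + B * A2 + CV * (A0 * B)) => k x.
  have [b0 b1 b2] := hB (r k) x (r1 k).
  have e1 : J (2 - n%:R) x * J (- 2) x = J (- n%:R) x.
    by rewrite -powjD; congr powR; ring.
  have e2 : J (2 - n%:R - 1) x * J (- 1) x = J (- n%:R) x.
    by rewrite -powjD; congr powR; ring.
  have e3 : J (2 - n%:R - 2) x = J (- n%:R) x by congr powR; ring.
  have H1 : `|Phi x * laplacian (chi k) x| <= A0 * B * J (- n%:R) x.
    by rewrite normrM -e1 mulrACA; exact: ler_pM.
  have H2 : `|2 * \sum_(i < n) 'D_(basis_vec i) Phi x * 'D_(basis_vec i) (chi k) x|
      <= 2 * (\sum_i A1 i * B) * J (- n%:R) x.
    rewrite normrM ger0_norm// -mulrA ler_pM2l// mulr_suml.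
    apply: (le_trans (ler_norm_sum _ _ _)); apply: ler_sum => i _.
    by rewrite normrM -e2 mulrACA; apply: ler_pM => //; case: (hA1 i).
  have H3 : `|chi k x * laplacian Phi x| <= B * A2 * J (- n%:R) x.
    by rewrite normrM -e3 -mulrA; exact: ler_pM.
  have H4 : `|V x * (Phi x * chi k x)| <= CV * (A0 * B) * J (- n%:R) x.
    rewrite normrM -e1 [J _ x * _]mulrC mulrACA; apply: ler_pM => //.
    by rewrite normrM mulrAC; apply: ler_pM.
  rewrite /T lapE [leRHS]mulrDl; apply: (le_trans (ler_normD _ _)); apply: lerD => //.
  rewrite normrN [leRHS]mulrDl; apply: (le_trans (ler_normD _ _)).
  apply: lerD H3; rewrite [leRHS]mulrDl; apply: (le_trans (ler_normD _ _)).
  exact: lerD H1 H2.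
(* At a fixed point the truncation is eventually 1 with vanishing derivatives, so the sequence is
   stationary. *)
have Tcvg x : T ^~ x @ \oo --> T0 x.
  apply: cvg_near_cst; near=> k.
  have xk : nrm2 ((r k)^-1 *: x) < 1.
    rewrite nrm2_scale exprVn ltr_pdivrMl ?exprn_gt0// mulr1.
    have : nrm2 x < r k.
      near: k; exists (Num.truncn (nrm2 x)) => // k /= hk.
      by apply: lt_le_trans (truncnS_gt _) _; rewrite ler_nat ltnS.
    by move/lt_le_trans; apply; rewrite -[leLHS]mulr1 expr2 ler_pM2l.
  have c1 : chi k x = 1 by apply: cutoff_in; exact: ltW.
  have sm : smooth (@cutoff R n) by exact: sym_smooth (sym_cutoff 0).
  have dchi s : (0 < size s)%N -> partials s (chi k) x = 0.
    move=> hs; apply: (etrans (partials_scale (r k)^-1 s x sm)).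
    apply: (etrans (congr1 (fun t => (r k)^-1 ^+ size s * t) (cutoff_partials_in xk hs))).
    exact: mulr0.
  have lchi : laplacian (chi k) x = 0.
    by apply: big1 => i _; exact: (dchi [:: i; i]).
  rewrite /T /T0 lapE c1 lchi mulr0 add0r mul1r mulr1.
  rewrite big1 ?mulr0 ?add0r// => i _.
  by rewrite (dchi [:: i] isT : 'D_(basis_vec i) (chi k) x = 0) mulr0.
have [mv _ _] := zv.
have iB : mu.-integrable setT (EFin \o (fun x => `|v x * (C * J (- n%:R) x)|)).
  apply: (integrable_abse (zclass_integrable zv _ _)); last first.
    by exists `|C| => x; rewrite normrM ler_wpM2l// ger0_norm// powR_ge0.
  by apply: measurable_funM => //; exact: measurable_powj.
have mvT k : measurable_fun setT (fun x => v x * T k x) by exact: measurable_funM.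
have vTcvg x : (fun k => v x * T k x) @ \oo --> v x * T0 x.
  by apply: cvgM; [exact: cvg_cst|exact: Tcvg].
have H := @real_dominated_convergence _ _ _ mu (fun k x => v x * T k x)
  (fun x => v x * T0 x) (fun x => `|v x * (C * J (- n%:R) x)|) mvT
  (aeW _ vTcvg) (measurable_funM mv mT0) iB.
have vTb k x : `|v x * T k x| <= `|v x * (C * J (- n%:R) x)|.
  rewrite !normrM ler_wpM2l//; apply: (le_trans (Cb k x)).
  by rewrite -normrM ler_norm.
have {}H := H vTb.
have E : (fun k => \int[mu]_x (v x * T k x)%:E)%E = cst 0%E.
  apply/funext => k; have := sol _ (tf k); rewrite /Rintegral => e.
  rewrite -[LHS]fineK ?[X in X%:E]e//.
  by apply: integrable_fin_num => //; exact: real_le_integrable (vTb k) iB.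
rewrite E in H.
have E0 : (\int[mu]_x (v x * T0 x)%:E = 0)%E := cvg_unique (@ereal_hausdorff R) H (cvg_cst 0%E).
exact: E0.
Unshelve. all: by end_near. Qed.

End weak_solutions.

(** * Positivity of integrals of continuous functions *)

Section positivity.
Context {R : realType} {n : nat}.
Local Notation rV := 'rV[R]_n.
Local Notation mu := (@leb R n).

Lemma leb_open_gt0 (U : set rV) (x : rV) : open U -> U x -> (0 < mu U)%E.
Proof.
move=> oU Ux; have [p px pU] := open_rbox oU Ux.
apply: (@lt_le_trans _ _ (mu (rbox p))); last first.
  by apply: le_measure => //; rewrite inE; [exact: measurable_rbox|exact: open_measurable_rV].
apply: (@lt_le_trans _ _ (\prod_(i < n) Num.max 0 (ratr (p.2 i) - ratr (p.1 i)))%:E).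
  rewrite lte_fin; apply: prodr_gt0 => i _; rewrite lt_max subr_gt0.
  by have /andP[h1 h2] := px i; rewrite (lt_trans h1 h2) orbT.
by rewrite -(@leb_obox R n (fun i => ratr (p.1 i)) (fun i => ratr (p.2 i))).
Qed.

Lemma integral_continuous_gt0 (f : rV -> R) (x : rV) : continuous f ->
  (forall y, 0 <= f y) -> 0 < f x -> (0 < \int[mu]_y (f y)%:E)%E.
Proof.
move=> cf f0 fx; rewrite lt0e integral_ge0 ?andbT; last by move=> y _; rewrite lee_fin.
have mf : measurable_fun setT (EFin \o f).
  by apply/measurable_EFinP; exact: continuous_measurable_rV.
apply/negP => /eqP I0.
have : (\int[mu]_y `|(EFin \o f) y| = 0)%E.
  by rewrite -I0; apply: eq_integral => y _ /=; rewrite ger0_norm.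
move/(ae_eq_integral_abs mu measurableT mf) => [N [mN N0 fN]].
have oU : open [set y | 0 < f y] by exact: (@open_comp _ _ f [set r | 0 < r] (fun y _ => cf y) (@open_gt _ 0)).
have := leb_open_gt0 oU fx.
suff : (mu [set y | (0 < f y)%R] <= 0)%E by rewrite leNgt => /negbTE ->.
rewrite -N0; apply: le_measure; rewrite ?inE//; first exact: open_measurable_rV.
move=> y /= fy; apply: fN => /= /(_ I) [] fy0.
by rewrite fy0 ltxx in fy.
Qed.

End positivity.

(** * Newtonian potentials and reciprocity *)

Section bubbles.
Context {R : realType} {n : nat}.
Local Notation rV := 'rV[R]_n.
Local Notation mu := (@leb R n).
Local Notation J m x := (japanese x `^ m).
Local Notation a := (n - 2)%N.
Hypothesis n3 : (3 <= n)%N.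

(** Minus the Laplacian of [profile (n - 2)]; its sign expresses that this truncation of |x|^(2 - n)
    is superharmonic. *)
Definition bump_density (x : rV) : R :=
  3 * a%:R ^+ 2 * nrm2 x ^+ a.-1 * profile a x ^+ 5.

(* bubble k increases to |x|^(2 - n), and - laplacian (bubble k) = approx_id k is
   an approximate identity of total mass bump_mass. *)
Definition bubble (k : nat) (z : rV) : R := k.+1%:R ^+ a * profile a (k.+1%:R *: z).

Definition approx_id (k : nat) (z : rV) : R := k.+1%:R ^+ n * bump_density (k.+1%:R *: z).

Let a0 : (0 < a)%N. Proof. by rewrite subn_gt0. Qed.
Let an : (a + 2 = n)%N. Proof. by rewrite subnK// ltnW. Qed.
Let aR : a%:R = n%:R - 2 :> R. Proof. by rewrite natrB// ltnW. Qed.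

Lemma laplacian_bubble_profile (x : rV) : laplacian (profile a) x = - bump_density x.
Proof.
rewrite laplacian_profile /bump_density.
have := profile_sqr a x; set q := nrm2 x ^+ a; set j := profile a x => jq.
have e1 : (a.-1%:R : R) = a%:R - 1 by rewrite -[in RHS](prednK a0) -natr1; ring.
have e2 : (n%:R : R) = a%:R + 2 by rewrite aR; ring.
have {}jq : q * j ^+ 2 = 1 - j ^+ 2 by lra.
rewrite e1 e2 -[3 * _ * q * _]mulrA jq; ring.
Qed.

Lemma laplacian_affine (m c C : R) (y : rV) (f : rV -> R) (x : rV) : sym m f ->
  laplacian (fun x => C * f (c *: x + y)) x = C * (c ^+ 2 * laplacian f (c *: x + y)).
Proof.
move=> sf; rewrite /laplacian !mulr_sumr; apply: eq_bigr => i _ /=.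
rewrite (_ : 'D_(basis_vec i) _ = fun x => C * (c * 'D_(basis_vec i) f (c *: x + y))).
  have [_ ->] := is_dZ C (is_dZ c (is_derive_affine (sym_is_d i (c *: x + y) (sym_d i sf)))).
  by rewrite [c * (c * _)]mulrA -expr2.
apply/funext => z.
by have [_ ->] := is_dZ C (is_derive_affine (sym_is_d i (c *: z + y) sf)).
Qed.

Lemma bubble_affine k (y : rV) : (fun x => bubble k (x - y)) =
  (fun x => k.+1%:R ^+ a * profile a (k.+1%:R *: x + - (k.+1%:R *: y))).
Proof. by apply/funext => x; rewrite /bubble scalerBr. Qed.

Lemma sym_bubble k (y : rV) : sym (2 - n%:R) (fun x => bubble k (x - y)).
Proof.
rewrite bubble_affine; apply: symZ; apply: sym_affine; first by rewrite pnatr_eq0.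
by have := @sym_profile R n a; rewrite aR opprB.
Qed.

Lemma laplacian_bubble k (y x : rV) :
  laplacian (fun x => bubble k (x - y)) x = - approx_id k (x - y).
Proof.
rewrite bubble_affine (laplacian_affine _ _ _ _ (@sym_profile R n a)).
rewrite laplacian_bubble_profile -scalerBr /approx_id -[in k.+1%:R ^+ n]an exprD.
by rewrite !mulrN mulrA.
Qed.

Lemma nrm2N (x : rV) : nrm2 (- x) = nrm2 x.
Proof. by apply: eq_bigr => i _; rewrite mxE sqrrN. Qed.

Lemma bubbleN k (x : rV) : bubble k (- x) = bubble k x.
Proof. by rewrite /bubble /profile scalerN nrm2N. Qed.

Lemma approx_idN k (x : rV) : approx_id k (- x) = approx_id k x.
Proof. by rewrite /approx_id /bump_density /profile scalerN nrm2N. Qed.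

Lemma bubble_ge0 k x : 0 <= bubble k x.
Proof. by rewrite mulr_ge0 ?exprn_ge0// ltW// profile_gt0. Qed.

Lemma bump_density_ge0 x : 0 <= bump_density x.
Proof.
have p0 := ltW (profile_gt0 a x); rewrite /bump_density.
by apply: mulr_ge0; rewrite ?exprn_ge0//; apply: mulr_ge0;
  rewrite ?exprn_ge0 ?nrm2_ge0// mulr_ge0 ?sqr_ge0.
Qed.

Lemma approx_id_ge0 k x : 0 <= approx_id k x.
Proof. by rewrite mulr_ge0 ?exprn_ge0// bump_density_ge0. Qed.

Lemma bubble_le k x : bubble k x <= k.+1%:R ^+ a.
Proof. by rewrite ler_piMr ?exprn_ge0// profile_le1. Qed.

(** Rescaling yields bubble k x = ((k+1)^(-2a) + |x|^(2a))^(-1/2); monotonicity in [k] and the bound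
    by |x|^(2 - n) are read off from this form. *)
Lemma bubble_sqr k x :
  bubble k x ^+ 2 * (k.+1%:R ^- (2 * a) + nrm2 x ^+ a) = 1.
Proof.
have := profile_sqr a (k.+1%:R *: x); rewrite /bubble nrm2_scale.
move: (profile a _) => p; rewrite !exprMn -!exprM [(a * 2)%N]mulnC => e.
have k0 : k.+1%:R ^+ (2 * a) != 0 :> R by rewrite expf_neq0// pnatr_eq0.
move: e; rewrite -[k.+1%:R ^+ a * k.+1%:R ^+ a]exprD addnn -mul2n; move: k0.
move: (k.+1%:R ^+ (2 * a)) (nrm2 x ^+ a) => T q k0 e.
by rewrite -[RHS]e; field.
Qed.

Lemma bubble_nd x : nondecreasing_seq (fun k => bubble k x).
Proof.
apply/nondecreasing_seqP => k; rewrite leNgt; apply/negP => lt.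
have := bubble_sqr k x; have := bubble_sqr k.+1 x.
have p1 := bubble_ge0 k.+1 x; have q0 : 0 <= nrm2 x ^+ a by rewrite exprn_ge0// nrm2_ge0.
have lt2 : bubble k.+1 x ^+ 2 < bubble k x ^+ 2.
  have p0 := bubble_ge0 k x; move: lt p0 p1.
  by move: (bubble k x) (bubble k.+1 x) => u w; rewrite -subr_gt0; nra.
have i0 : 0 < k.+1%:R ^- (2 * a) :> R by rewrite invr_gt0 exprn_gt0.
have i1 : k.+2%:R ^- (2 * a) <= k.+1%:R ^- (2 * a) :> R.
  rewrite lef_pV2 ?posrE ?exprn_gt0//; apply: lerXn2r; rewrite ?nnegrE ?ler0n//.
  by rewrite ler_nat.
have b0 : 0 <= bubble k.+1 x ^+ 2 by exact: exprn_ge0.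
move: lt2 i0 i1 b0 q0.
move: (bubble k.+1 x ^+ 2) (bubble k x ^+ 2) (k.+1%:R ^- _) (k.+2%:R ^- _) (nrm2 x ^+ a).
move=> A B C D Q; nra.
Qed.

Lemma bubble_newton k x : ((bubble k x)%:E <= newton_dyadic x + 1)%E.
Proof.
apply: le_newton_dyadic => //; first exact: bubble_ge0.
move=> i; have p0 := bubble_ge0 k x.
have b0 : 0 <= bubble k x * `|x 0 i| ^+ a by rewrite mulr_ge0// exprn_ge0.
rewrite -(@expr_le1 _ 2)//; rewrite exprMn -exprM mulnC exprM real_normK ?num_real//.
rewrite -(bubble_sqr k x) ler_wpM2l ?exprn_ge0//.
apply: (@le_trans _ _ (nrm2 x ^+ a)); last by rewrite lerDr invr_ge0 exprn_ge0.
apply: lerXn2r; rewrite ?nnegrE ?sqr_ge0 ?nrm2_ge0//.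
by rewrite /nrm2 (bigD1 i)//= lerDl sumr_ge0// => j _; exact: sqr_ge0.
Qed.

Lemma sym_bump_density : sym (- n%:R - 1) bump_density.
Proof.
have h := symM (symZ (3 * a%:R ^+ 2) (symX a.-1 (@sym_nrm2 R n)))
  (symX 5 (@sym_profile R n a)).
apply: sym_le h.
have : (a.-1%:R : R) = a%:R - 1 by rewrite -[in RHS](prednK a0) -natr1; ring.
have : (3 : R) <= n%:R by rewrite ler_nat.
rewrite aR => h3 ->; lra.
Qed.

Lemma measurable_bump_density : measurable_fun setT bump_density.
Proof. by apply: continuous_measurable_rV; exact: sym_cont sym_bump_density. Qed.

Lemma integrable_bump_density : mu.-integrable setT (EFin \o bump_density).
Proof.
have [C C0 hC] := sym_bnd sym_bump_density.
have iJ := @powj_integrable R n 1 ltr01.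
apply: (real_le_integrable measurable_bump_density
  (g := fun x => C * J (- (n%:R + 1)) x)) => [x|].
  by rewrite opprD; exact: hC.
have := integrableZl measurableT C iJ.
by apply: eq_integrable => // x _; rewrite /= EFinM.
Qed.

Definition bump_mass : R := \int[mu]_x bump_density x.

Lemma bump_massE : (\int[mu]_x (bump_density x)%:E = bump_mass%:E)%E.
Proof.
by rewrite /bump_mass /Rintegral fineK// integrable_fin_num//; exact: integrable_bump_density.
Qed.

Lemma bump_mass_gt0 : 0 < bump_mass.
Proof.
rewrite -lte_fin -bump_massE.
pose i0 : 'I_n := Ordinal (ltnW (ltnW n3)).
apply: (@integral_continuous_gt0 _ _ _ (basis_vec i0)).
- exact: sym_cont sym_bump_density.
- exact: bump_density_ge0.
have e1 : 0 < nrm2 (basis_vec i0 : rV).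
  rewrite /nrm2 (bigD1 i0)//= mxE !eqxx expr1n ltr_pwDl//.
  by apply: sumr_ge0 => j _; exact: sqr_ge0.
have p0 := profile_gt0 a (basis_vec i0 : rV); rewrite /bump_density.
apply: mulr_gt0; last exact: exprn_gt0.
apply: mulr_gt0; last exact: exprn_gt0.
by apply: mulr_gt0 => //; rewrite exprn_gt0// ltr0n.
Qed.

End bubbles.

(** * Mollified indicators of boxes *)

Section mollified_boxes.
Context {R : realType} {n : nat}.
Local Notation rV := 'rV[R]_n.
Local Notation mu := (@leb R n).
Local Notation J m x := (japanese x `^ m).
Local Notation bmass := (@bump_mass R n).
Hypothesis n3 : (3 <= n)%N.

Definition mollified_box p (k : nat) (x : rV) : \bar R :=
  (\int[mu]_y (\1_(rbox p) y * approx_id k (x - y))%:E)%E.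

Lemma measurable_approx_id k (x : rV) :
  measurable_fun setT (fun y : rV => approx_id k (x - y)).
Proof.
apply: measurable_funM => //; apply: (@measurableT_comp _ _ _ _ _ _ (@bump_density R n)).
  exact: measurable_bump_density.
have := measurable_affine (- k.+1%:R) (k.+1%:R *: x).
apply: eq_measurable_fun => y _.
by rewrite scalerBr scaleNr addrC.
Qed.

Lemma integral_dilation (g h : rV -> R) (c : R) (x : rV) : 0 < c ->
  measurable_fun setT g -> measurable_fun setT h ->
  (forall y, 0 <= g y) -> (forall y, 0 <= h y) ->
  (\int[mu]_y (g y * (c ^+ n * h (c *: (y - x))%R))%:E =
   \int[mu]_z (g (c^-1 *: z + x)%R * h z)%:E)%E.
Proof.
move=> c0 mg mh g0 h0; pose f (y : rV) : \bar R := (g y * h (c *: (y - x)))%:E.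
have mf : measurable_fun setT f.
  apply/measurable_EFinP; apply: measurable_funM => //.
  apply: (@measurableT_comp _ _ _ _ _ _ h) => //.
  by under eq_fun do rewrite scalerBr; exact: measurable_affine.
have f0 y : (0 <= f y)%E by rewrite lee_fin mulr_ge0.
have si : 0 < c^-1 by rewrite invr_gt0.
have e2 : (\int[mu]_z f (c^-1 *: z + x)%R = \int[mu]_z (g (c^-1 *: z + x)%R * h z)%:E)%E.
  apply: eq_integral => z _; rewrite /f.
  by rewrite addrK scalerA divff ?gt_eqF// scale1r.
rewrite -e2 (ge0_integral_affine x si mf f0) exprVn invrK -ge0_integralZl_EFin//; last first.
  by rewrite exprn_ge0// ltW.
by apply: eq_integral => y _; rewrite /f -EFinM mulrCA.
Qed.

Lemma mollified_boxE p k x : mollified_box p k x =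
  (\int[mu]_z (\1_(rbox p) (k.+1%:R^-1 *: z + x)%R * bump_density z)%:E)%E.
Proof.
have s0 : 0 < k.+1%:R :> R by rewrite ltr0n.
have mi : measurable_fun setT (\1_(rbox p) : rV -> R).
  by apply: measurable_indic; exact: measurable_rbox.
have i0 (y : rV) : 0 <= (\1_(rbox p) y : R) by [].
have := @integral_dilation _ bump_density _ x s0 mi (@measurable_bump_density R n n3) i0 bump_density_ge0.
apply: etrans.
have E (y : rV) : \1_(rbox p) y * approx_id k (x - y) =
    \1_(rbox p) y * (k.+1%:R ^+ n * bump_density (k.+1%:R *: (y - x))) :> R.
  by rewrite -(approx_idN k (x - y)) opprB.
rewrite /mollified_box; apply: eq_integral => y _; exact: (congr1 EFin (E y)).
Qed.

Lemma leb_hyperplane (i : 'I_n) (c : R) : mu [set x : rV | x 0 i = c] = 0%E.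
Proof.
rewrite (_ : mkset _ = [set x : rV | forall j, (if j == i then [set c] else setT) (x 0 j)]).
  apply: (etrans (@lebesgue_rV_box R n (fun j => if j == i then [set c] else setT) _)).
    by move=> j; case: ifP.
  by rewrite (bigD1 i)//= eqxx lebesgue_measure_set1 mul0e.
apply/seteqP; split => [x /= xc j|x /(_ i)]; last by rewrite eqxx.
by case: eqP => // ->.
Qed.

(** Whole hyperplanes through the faces instead of the faces themselves: the set is still null, and
    off it the indicator of the box is locally constant. *)
Definition rbox_boundary (p : {ffun 'I_n -> rat} * {ffun 'I_n -> rat}) : set rV :=
  \big[setU/set0]_(i < n) ([set x | x 0 i = ratr (p.1 i)] `|` [set x | x 0 i = ratr (p.2 i)]).

Lemma rbox_boundary_ae p : {ae mu, forall x, ~ rbox_boundary p x}.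
Proof.
have mh i c : measurable [set x : rV | x 0 i = c].
  rewrite -[X in measurable X]setTI.
  exact: (measurable_coord i measurableT (measurable_set1 c)).
suff [mb b0] : measurable (rbox_boundary p) /\ mu (rbox_boundary p) = 0%E.
  by exists (rbox_boundary p); split => // x /= /contrapT.
have nU (A B : set rV) : measurable A /\ mu A = 0%E -> measurable B /\ mu B = 0%E ->
    measurable (A `|` B) /\ mu (A `|` B) = 0%E.
  move=> [mA A0] [mB B0]; split; first exact: measurableU.
  exact: null_set_setU.
rewrite /rbox_boundary; elim/big_ind : _ => [|A B|i _].
- by split; [exact: measurable0|exact: measure0].
- exact: nU.
- by apply: nU; split; [exact: mh|exact: leb_hyperplane|exact: mh|exact: leb_hyperplane].
Qed.

Lemma rbox_indic_locally_cst p (x : rV) : ~ rbox_boundary p x ->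
  \forall y \near x, (\1_(rbox p) y : R) = \1_(rbox p) x.
Proof.
move=> nb; have [xp|] := pselect (rbox p x).
  have H i : \forall y \near x, ratr (p.1 i) < (y : rV) 0 i < ratr (p.2 i).
    have /andP[h1 h2] := xp i.
    have h3 : \forall y \near x, (y : rV) 0 i < ratr (p.2 i).
      exact: (@coord_cont R n i x _ (lt_nbhsl h2)).
    have h4 : \forall y \near x, ratr (p.1 i) < (y : rV) 0 i.
      exact: (@coord_cont R n i x _ (lt_nbhsr h1)).
    by near=> y; apply/andP; split; near: y.
  have := filter_forall (nbhs_filter x) H.
  by apply: filterS => y yp; rewrite !indicE !mem_set.
move=> nxp; move: (nxp) => /existsNP[i xi].
have nbi c : (c = ratr (p.1 i) \/ c = ratr (p.2 i)) -> x 0 i != c.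
  move=> hc; apply/eqP => xc; apply: nb; rewrite /rbox_boundary -bigcup_seq.
  exists i; first by rewrite /= mem_index_enum.
  by case: hc => <-; [left|right].
have h1 := nbi _ (or_introl erefl); have h2 := nbi _ (or_intror erefl).
have cx := @coord_cont R n i x.
have [xlt|xlt] : x 0 i < ratr (p.1 i) \/ ratr (p.2 i) < x 0 i.
  move/negP: xi; rewrite negb_and -!leNgt => /orP[]; rewrite le_eqVlt.
    by rewrite (negbTE h1) => /= ?; left.
  by rewrite eq_sym (negbTE h2) => /= ?; right.
- have hx : \forall y \near x, (y : rV) 0 i < ratr (p.1 i) by exact: (cx _ (lt_nbhsl xlt)).
  near=> y; rewrite !indicE !memNset// => /(_ i) /andP[+ _].
  by apply/negP; rewrite -leNgt ltW//; near: y.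
- have hx : \forall y \near x, ratr (p.2 i) < (y : rV) 0 i by exact: (cx _ (lt_nbhsr xlt)).
  near=> y; rewrite !indicE !memNset// => /(_ i) /andP[_].
  by apply/negP; rewrite -leNgt ltW//; near: y.
Unshelve. all: by end_near. Qed.

(** After rescaling, the indicator is evaluated at z / (k+1) + x, where it is eventually constant;
    [bump_density] is the dominating function. *)
Lemma cvg_mollified_box p x : ~ rbox_boundary p x ->
  mollified_box p k x @[k --> \oo] --> (bmass * \1_(rbox p) x)%:E.
Proof.
move=> nb.
have mB := @measurable_bump_density R n n3.
have mi k : measurable_fun setT (fun z : rV => \1_(rbox p) (k.+1%:R^-1 *: z + x)%R : R).
  apply: (@measurableT_comp _ _ _ _ _ _ (\1_(rbox p) : rV -> R)).
    by apply: measurable_indic; exact: measurable_rbox.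
  exact: measurable_affine.
have cv z : (fun k => \1_(rbox p) (k.+1%:R^-1 *: z + x)%R * bump_density z) @ \oo -->
    (\1_(rbox p) x * bump_density z : R).
  apply: cvgM; last exact: cvg_cst.
  apply: cvg_near_cst.
  have xc : (fun k : nat => k.+1%:R^-1 *: z + x : rV) @ \oo --> x.
    have h : (fun k : nat => k.+1%:R^-1 *: z + x : rV) @ \oo --> 0 *: z + x.
      apply: cvgD; last exact: cvg_cst.
      by apply: cvgZr_tmp; exact: cvg_harmonic.
    by move: h; rewrite scale0r add0r.
  exact: xc _ (rbox_indic_locally_cst nb).
have H := @real_dominated_convergence _ _ _ mu
  (fun k z => \1_(rbox p) (k.+1%:R^-1 *: z + x)%R * bump_density z)
  (fun z => \1_(rbox p) x * bump_density z) (@bump_density R n)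
  (fun k => measurable_funM (mi k) mB) (aeW _ cv) (measurable_funM (measurable_cst _) mB)
  (@integrable_bump_density R n n3).
have b k z : `|\1_(rbox p) (k.+1%:R^-1 *: z + x)%R * bump_density z| <= bump_density z.
  have d0 := bump_density_ge0 z; rewrite normrM (ger0_norm d0) ler_piMl//.
  by rewrite indicE; case: (_ \in _); rewrite ?normr1 ?normr0.
have {}H := H b.
have -> : mollified_box p ^~ x = (fun k => \int[mu]_z
    (\1_(rbox p) (k.+1%:R^-1 *: z + x)%R * bump_density z)%:E)%E.
  by apply/funext => k; exact: mollified_boxE.
rewrite mulrC EFinM -(bump_massE n3) -integralZl//; last exact: integrable_bump_density.
Qed.

Lemma mollified_box_ge0 p k x : (0 <= mollified_box p k x)%E.
Proof. by apply: integral_ge0 => y _; rewrite lee_fin mulr_ge0// approx_id_ge0. Qed.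

Lemma japanese_scaleV (x : rV) : J (- n%:R) x = (japanese x ^+ n)^-1.
Proof. by rewrite powRN powR_mulrn// ltW// japanese_gt0. Qed.

(** Near the box the total mass is a bound. Far away, the distance from x to the box is comparable
    to <x>, and approx_id k z <= C |z|^(-n) with [C] independent of [k], because this bound is
    invariant under the scaling that defines [approx_id]. *)
Lemma mollified_box_bound p : exists2 C, 0 <= C & forall k x,
  (mollified_box p k x <= (C * J (- n%:R) x)%:E)%E.
Proof.
pose rho : R := 1 + \sum_(i < n) (`|ratr (p.1 i)| + `|ratr (p.2 i)|).
have rho1 : 1 <= rho.
  by rewrite lerDl; apply: sumr_ge0 => i _; rewrite addr_ge0.
have rho0 : 0 < rho by lra.
have pr y : rbox p y -> forall i, `|y 0 i| <= rho.
  move=> yp i; have /andP[h1 h2] := yp i.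
  have h : `|ratr (p.1 i)| + `|ratr (p.2 i)| <= rho.
    rewrite /rho (bigD1 i)//= addrCA lerDl; apply: addr_ge0 => //.
    by apply: sumr_ge0 => j _; rewrite addr_ge0.
  have h3 := ler_norm (ratr (p.2 i) : R); have h4 := ler_norm (- ratr (p.1 i) : R).
  rewrite normrN in h4; have h5 := normr_ge0 (ratr (p.1 i) : R).
  have h6 := normr_ge0 (ratr (p.2 i) : R).
  by rewrite ler_norml; apply/andP; split; lra.
have [C1 C10 hC1] := sym_bnd (@sym_bump_density R n n3).
pose M : R := Num.sqrt (1 + n%:R * (2 * rho) ^+ 2).
have M0 : 0 <= M by rewrite sqrtr_ge0.
pose b : R := (2 * rho) ^+ n.
pose C2 := C1 * (2 * (1 + n%:R)) ^+ n * b.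
have C20 : 0 <= C2.
  have b0 : 0 <= b by rewrite exprn_ge0// mulr_ge0// ltW.
  by apply: mulr_ge0 => //; apply: mulr_ge0 => //; rewrite exprn_ge0// mulr_ge0// addr_ge0.
have b0 : 0 <= b by rewrite exprn_ge0// mulr_ge0// ltW.
exists (bmass * M ^+ n + C2).
  by rewrite addr_ge0// mulr_ge0 ?exprn_ge0// ltW// bump_mass_gt0.
move=> k x.
have jx0 := japanese_gt0 x.
have [xe|] := pselect (ccube (2 * rho) x).
  apply: (@le_trans _ _ bmass%:E); last first.
    rewrite lee_fin mulrDl -[leLHS]addr0 lerD// ?mulr_ge0 ?powR_ge0//.
    rewrite -mulrA ler_peMr ?(ltW (bump_mass_gt0 n3))//.
    rewrite japanese_scaleV ler_pdivlMr ?exprn_gt0// mul1r lerXn2r ?nnegrE ?(ltW jx0)//.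
    rewrite -(@ler_pXn2r _ 2)// ?nnegrE ?(ltW jx0)// japanese_sqr sqr_sqrtr.
      rewrite lerD2l /nrm2 mulr_natl -[X in _ *+ X](card_ord n) -sumr_const.
      apply: ler_sum => i _; rewrite -(real_normK (num_real (x 0 i))).
      by rewrite lerXn2r ?nnegrE ?mulr_ge0 ?(ltW rho0)//; move/ccubeP : xe; apply.
    by rewrite addr_ge0// mulr_ge0// sqr_ge0.
  rewrite mollified_boxE -(bump_massE n3); apply: ge0_le_integral => //.
  - by move=> z _; rewrite lee_fin mulr_ge0// bump_density_ge0.
  - apply/measurable_EFinP; apply: measurable_funM; last exact: measurable_bump_density.
    apply: (@measurableT_comp _ _ _ _ _ _ (\1_(rbox p) : rV -> R)).
      by apply: measurable_indic; exact: measurable_rbox.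
    exact: measurable_affine.
  - by apply/measurable_EFinP; exact: measurable_bump_density.
  - by move=> z _; rewrite lee_fin ler_piMl ?bump_density_ge0.
move=> /ccubeP/existsNP[i0 /negP]; rewrite -ltNge => xi0.
(* The largest coordinate of x is comparable to <x>, and in that coordinate x keeps a distance of at
   least half its size from the box. *)
have [i hi] : exists i, forall j, `|x 0 j| <= `|x 0 i|.
  exists [arg max_(i > i0) `|x 0 i|]%O; case: arg_maxP => //= i _ hi j; exact: hi.
have xi : 2 * rho < `|x 0 i| by apply: lt_le_trans xi0 (hi i0).
have xi1 : 0 < `|x 0 i| by apply: lt_trans xi; rewrite mulr_gt0.
have jb : japanese x <= (1 + n%:R) * `|x 0 i|.
  have x2 : 1 <= x 0 i ^+ 2.
    by rewrite -(real_normK (num_real (x 0 i))) exprn_ege1//; lra.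
  have nx : nrm2 x <= n%:R * x 0 i ^+ 2.
    rewrite /nrm2 mulr_natl -[X in _ *+ X](card_ord n) -sumr_const.
    apply: ler_sum => j _; rewrite -(real_normK (num_real (x 0 j))).
    by rewrite -(real_normK (num_real (x 0 i))) lerXn2r ?nnegrE.
  rewrite -(@ler_pXn2r _ 2)// ?nnegrE ?(ltW jx0) ?mulr_ge0 ?addr_ge0//.
  rewrite japanese_sqr exprMn real_normK ?num_real//.
  have n0 : (0 : R) <= n%:R by [].
  move: x2 nx n0; move: (x 0 i ^+ 2) (nrm2 x) (n%:R : R) => A B N; nra.
have hb y : rbox p y -> approx_id k (x - y) <= C1 * (2 * (1 + n%:R)) ^+ n * J (- n%:R) x.
  move=> /pr/(_ i) yi; set z := x - y.
  have zi : `|x 0 i| / 2 <= `|z 0 i|.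
    rewrite /z !mxE; have := ler_normB (x 0 i - y 0 i) (- y 0 i).
    rewrite opprK subrK normrN; lra.
  have zi0 : 0 < `|z 0 i| by apply: lt_le_trans zi; rewrite divr_gt0.
  have s0 : 0 < k.+1%:R :> R by rewrite ltr0n.
  have jz : k.+1%:R * `|z 0 i| <= japanese (k.+1%:R *: z).
    have := le_coord_japanese (k.+1%:R *: z) i.
    by rewrite mxE normrM (gtr0_norm s0).
  have e1 : bump_density (k.+1%:R *: z) <= C1 * (k.+1%:R * `|z 0 i|) ^- n.
    apply: (le_trans (ler_norm _)); apply: (le_trans (hC1 _)); rewrite ler_wpM2l//.
    apply: (@le_trans _ _ (J (- n%:R) (k.+1%:R *: z))); first by apply: le_powj; rewrite lerBlDr lerDl.
    rewrite japanese_scaleV lef_pV2 ?posrE ?exprn_gt0 ?mulr_gt0 ?japanese_gt0//.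
    by rewrite lerXn2r ?nnegrE ?mulr_ge0 ?(ltW s0) ?(ltW (japanese_gt0 _)).
  have e2 : approx_id k z <= C1 * `|z 0 i| ^- n.
    have := ler_wpM2l (ltW (exprn_gt0 n s0)) e1; rewrite -/(approx_id k z).
    by rewrite exprMn invfM mulrCA (mulrA (k.+1%:R ^+ n)) divff ?mul1r// expf_neq0// gt_eqF.
  apply: (le_trans e2); rewrite -mulrA ler_wpM2l// japanese_scaleV.
  rewrite -[leRHS]invrK invfM invrK lef_pV2 ?posrE ?exprn_gt0//; last first.
    by rewrite mulr_gt0 ?invr_gt0 ?exprn_gt0 ?mulr_gt0// ltr_pwDl.
  rewrite -exprVn -exprMn lerXn2r ?nnegrE//.
    by rewrite mulr_ge0 ?invr_ge0 ?mulr_ge0 ?addr_ge0// ltW.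
  rewrite ler_pdivrMl ?mulr_gt0 ?ltr_pwDl//; apply: (le_trans jb).
  by rewrite -mulrA [leRHS]mulrCA ler_wpM2l ?addr_ge0//; lra.
apply: (@le_trans _ _ (\int[mu]_y (C1 * (2 * (1 + n%:R)) ^+ n * J (- n%:R) x * \1_(ccube rho) y)%:E)%E).
  apply: ge0_le_integral => //.
  - by move=> y _; rewrite lee_fin mulr_ge0// approx_id_ge0.
  - apply/measurable_EFinP; apply: measurable_funM; last exact: measurable_approx_id.
    by apply: measurable_indic; exact: measurable_rbox.
  - apply/measurable_EFinP; apply: measurable_funM => //.
    by apply: measurable_indic; exact: measurable_ccube.
  move=> y _; rewrite lee_fin !indicE; have [yp|yp] := pselect (rbox p y); last first.
    by rewrite memNset// mul0r !mulr_ge0 ?exprn_ge0 ?mulr_ge0 ?addr_ge0 ?powR_ge0.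
  rewrite !mem_set//; last by apply/ccubeP; exact: pr.
  by rewrite mul1r mulr1; exact: hb.
under eq_integral do rewrite EFinM.
rewrite ge0_integralZl_EFin//; last 2 first.
- by apply/measurable_EFinP/measurable_indic; exact: measurable_ccube.
- by rewrite !mulr_ge0 ?exprn_ge0 ?mulr_ge0 ?addr_ge0 ?powR_ge0.
rewrite integral_indic// ?setIT; last exact: measurable_ccube.
apply: (@le_trans _ _ ((C1 * (2 * (1 + n%:R)) ^+ n * J (- n%:R) x)%:E * b%:E)%E).
  by rewrite /b -(@leb_ccube R n rho (ltW rho0)).
rewrite -EFinM lee_fin [leRHS]mulrDl ler_wpDl//.
  by rewrite !mulr_ge0 ?powR_ge0 ?exprn_ge0// ltW// bump_mass_gt0.
by rewrite /C2 mulrAC.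
Qed.

End mollified_boxes.

(** * Newtonian potentials and energies of nonnegative densities *)

Section energy.
Context {R : realType} {n : nat}.
Local Notation rV := 'rV[R]_n.
Local Notation mu := (@leb R n).
Local Notation J m x := (japanese x `^ m).
Hypothesis n3 : (3 <= n)%N.
Implicit Types (f g v : rV -> R).

(** The kernel |z|^(2 - n), infinite at 0. As an increasing limit of bubbles it is directly
    accessible to monotone convergence. *)
Definition newton (z : rV) : \bar R := limn (fun k => (bubble k z)%:E).

Definition energy f g : \bar R :=
  (\int[mu]_y \int[mu]_x ((f y * g x)%:E * newton (x - y)%R))%E.

Definition energy_approx k f g : \bar R :=
  (\int[mu]_y \int[mu]_x (f y * g x * bubble k (x - y)%R)%:E)%E.

Definition newton_potential g (y : rV) : \bar R :=
  (\int[mu]_x ((g x)%:E * newton (x - y)%R))%E.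

Definition L12 f := [/\ measurable_fun setT f, mu.-integrable setT (EFin \o f) &
  mu.-integrable setT (EFin \o (fun x => f x ^+ 2))].

Lemma bubble_e_nd (z : rV) : nondecreasing_seq (fun k => (bubble k z)%:E).
Proof. by move=> i j ij; rewrite lee_fin; exact: bubble_nd. Qed.

Lemma cvg_newton (z : rV) : (fun k => (bubble k z)%:E) @ \oo --> newton z.
Proof. exact: ereal_nondecreasing_is_cvgn (bubble_e_nd z). Qed.

Lemma newton_ge0 (z : rV) : (0 <= newton z)%E.
Proof.
apply: lime_ge; first exact: ereal_nondecreasing_is_cvgn (bubble_e_nd z).
by apply: nearW => k; rewrite lee_fin bubble_ge0.
Qed.

Lemma newton_le (z : rV) : (newton z <= newton_dyadic z + 1)%E.
Proof.
apply: lime_le; first exact: ereal_nondecreasing_is_cvgn (bubble_e_nd z).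
by apply: nearW => k; exact: bubble_newton.
Qed.

Lemma newtonN (z : rV) : newton (- z) = newton z.
Proof. by rewrite /newton; congr (lim _); under eq_fun do rewrite bubbleN. Qed.

Lemma measurable_bubble k : measurable_fun setT (@bubble R n k).
Proof.
apply: continuous_measurable_rV; have := sym_cont (@sym_bubble R n n3 k 0).
by rewrite (_ : (fun x => _) = bubble k)//; apply/funext => x; rewrite subr0.
Qed.

Lemma measurable_newton : measurable_fun setT newton.
Proof.
apply: (emeasurable_fun_cvg (fun k z => (bubble k z)%:E)) => [k|z _].
  by apply/measurable_EFinP; exact: measurable_bubble.
exact: cvg_newton.
Qed.

Lemma measurable_diff : measurable_fun setT (fun p : rV * rV => p.2 - p.1).
Proof.
apply: measurable_fun_coordP => i; under eq_fun do rewrite !mxE.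
apply: measurable_funB.
  apply: (@measurableT_comp _ _ _ _ _ _ (fun x : rV => x 0 i : R)); first exact: measurable_coord.
  exact: measurable_snd.
apply: (@measurableT_comp _ _ _ _ _ _ (fun x : rV => x 0 i : R)); first exact: measurable_coord.
exact: measurable_fst.
Qed.

Lemma measurable_tensor f g : measurable_fun setT f -> measurable_fun setT g ->
  measurable_fun setT (fun p : rV * rV => f p.1 * g p.2).
Proof.
move=> mf mg; apply: measurable_funM.
  by apply: (@measurableT_comp _ _ _ _ _ _ f) => //; exact: measurable_fst.
by apply: (@measurableT_comp _ _ _ _ _ _ g) => //; exact: measurable_snd.
Qed.

Lemma measurable_tensor_ker f g (h : rV -> \bar R) :
  measurable_fun setT f -> measurable_fun setT g -> measurable_fun setT h ->
  measurable_fun setT (fun p : rV * rV => (f p.1 * g p.2)%:E * h (p.2 - p.1)%R)%E.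
Proof.
move=> mf mg mh; apply: emeasurable_funM.
  by apply/measurable_EFinP; exact: measurable_tensor.
by apply: (@measurableT_comp _ _ _ _ _ _ h) => //; exact: measurable_diff.
Qed.

Lemma measurable_sub_l (h : rV -> \bar R) (y : rV) : measurable_fun setT h ->
  measurable_fun setT (fun x : rV => h (x - y)%R).
Proof.
move=> mh; apply: (@measurableT_comp _ _ _ _ _ _ h) => //.
have := measurable_affine (1 : R) (- y).
by under eq_fun do rewrite scale1r.
Qed.

Lemma energyC f g : measurable_fun setT f -> measurable_fun setT g ->
  (forall x, 0 <= f x) -> (forall x, 0 <= g x) -> energy f g = energy g f.
Proof.
move=> mf mg f0 g0; rewrite /energy.
rewrite (fubini_tonelli (fun p : rV * rV => ((f p.1 * g p.2)%:E * newton (p.2 - p.1)%R)%E)).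
- apply: eq_integral => y _; apply: eq_integral => x _ /=.
  by rewrite mulrC -(newtonN (y - x)) opprB.
- exact: measurable_tensor_ker mf mg measurable_newton.
- by move=> p; rewrite mule_ge0 ?newton_ge0// lee_fin mulr_ge0.
Qed.

Lemma energyE f g : measurable_fun setT f -> measurable_fun setT g ->
  (forall x, 0 <= f x) -> (forall x, 0 <= g x) ->
  energy f g = (\int[mu]_y ((f y)%:E * newton_potential g y))%E.
Proof.
move=> mf mg f0 g0; apply: eq_integral => y _.
rewrite /newton_potential -ge0_integralZl_EFin//.
- by apply: eq_integral => x _; rewrite EFinM muleA.
- by move=> x _; rewrite mule_ge0 ?lee_fin ?newton_ge0.
- apply: emeasurable_funM; first exact/measurable_EFinP.
  exact: measurable_sub_l measurable_newton.
Qed.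

Lemma newton_potential_ge0 g : (forall x, 0 <= g x) -> forall y, (0 <= newton_potential g y)%E.
Proof. by move=> g0 y; apply: integral_ge0 => x _; rewrite mule_ge0 ?lee_fin ?newton_ge0. Qed.

Lemma measurable_newton_potential g : measurable_fun setT g ->
  (forall x, 0 <= g x) -> measurable_fun setT (newton_potential g).
Proof.
move=> mg g0.
have := @measurable_fun_fubini_tonelli_F _ _ _ _ R mu
  (fun p : rV * rV => ((1 * g p.2)%:E * newton (p.2 - p.1)%R)%E)
  (@measurable_tensor_ker (fun=> 1) g _ (measurable_cst _) mg measurable_newton).
have h (p : rV * rV) : (0 <= (1 * g p.2)%:E * newton (p.2 - p.1)%R)%E.
  by rewrite mule_ge0 ?newton_ge0// mul1r lee_fin.
move=> /(_ h); rewrite /fubini_F; apply: eq_measurable_fun => y _ /=.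
by apply: eq_integral => x _; rewrite mul1r.
Qed.

(** Monotone convergence twice, in the inner variable and then in the outer one. *)
Lemma cvg_energy f g : measurable_fun setT f -> measurable_fun setT g ->
  (forall x, 0 <= f x) -> (forall x, 0 <= g x) ->
  energy_approx k f g @[k --> \oo] --> energy f g.
Proof.
move=> mf mg f0 g0.
have m2 k : measurable_fun setT (fun p : rV * rV => (f p.1 * g p.2 * bubble k (p.2 - p.1))%:E).
  have := measurable_tensor_ker mf mg ((measurable_EFinP _ _).2 (measurable_bubble k)).
  by apply: eq_measurable_fun => p _ /=; rewrite -EFinM.
have m1 k y : measurable_fun setT (fun x : rV => (f y * g x * bubble k (x - y))%:E).
  apply/measurable_EFinP; apply: measurable_funM; first exact: measurable_funM.
  by apply/measurable_EFinP; exact: (measurable_sub_l y ((measurable_EFinP _ _).2 (measurable_bubble k))).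
have p0 k y x : (0 <= (f y * g x * bubble k (x - y))%:E)%E.
  by rewrite lee_fin; apply: mulr_ge0; [exact: mulr_ge0|exact: bubble_ge0].
have nd y x : nondecreasing_seq (fun k => (f y * g x * bubble k (x - y))%:E).
  by move=> i j ij; rewrite lee_fin ler_wpM2l ?mulr_ge0//; exact: bubble_nd.
pose Q k y : \bar R := (\int[mu]_x (f y * g x * bubble k (x - y)%R)%:E)%E.
have mQ k : measurable_fun setT (Q k).
  by have := @measurable_fun_fubini_tonelli_F _ _ _ _ R mu _ (m2 k); apply => p; exact: p0.
have Q0 k y : (0 <= Q k y)%E by exact: integral_ge0.
have ndQ y : nondecreasing_seq (Q ^~ y).
  by move=> i j ij; apply: ge0_le_integral => // x _; exact: nd.
have := @cvg_monotone_convergence _ _ _ mu setT measurableT Q mQ (fun k y _ => Q0 k y) (fun y _ => ndQ y).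
congr (_ --> _); apply: eq_integral => y _.
have := @monotone_convergence _ _ _ mu setT measurableT
  (fun k x => (f y * g x * bubble k (x - y)%R)%:E) (m1 ^~ y) (fun k x _ => p0 k y x) (fun x _ => nd y x).
move=> <-; apply: eq_integral => x _; apply/cvg_lim => //.
under eq_cvg do rewrite EFinM.
by apply: cvgeZl => //; exact: cvg_newton.
Qed.

Lemma L12_norm f : L12 f -> L12 (fun x => `|f x|).
Proof.
move=> [mf if1 if2]; split; first exact: measurableT_comp.
  exact: integrable_abse if1.
by apply: eq_integrable if2 => // x _ /=; rewrite real_normK ?num_real.
Qed.

Lemma L12_lty f : L12 f -> (\int[mu]_x (`|f x|)%:E < +oo)%E /\ (\int[mu]_x (f x ^+ 2)%:E < +oo)%E.
Proof.
move=> [mf if1 if2]; split; first by have /integrableP[] := if1.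
have /integrableP[_] := if2; apply: le_lt_trans; apply: ge0_le_integral => //.
- by move=> x _; rewrite lee_fin sqr_ge0.
- by apply/measurable_EFinP; exact: measurable_funX.
- apply: measurableT_comp => //; apply/measurable_EFinP; exact: measurable_funX.
- by move=> x _; exact: lee_abs.
Qed.

Lemma integral_newton_dyadic (y : rV) :
  (\int[mu]_x newton_dyadic (x - y)%R = \int[mu]_x newton_dyadic x)%E.
Proof. by rewrite (integral_shift (- y) (@measurable_newton_dyadic R n)). Qed.

(** The kernel is at most [nd + 1] with [nd] integrable. From f(y) g(x) <= f(y)^2 + g(x)^2, the part
    with [nd] is controlled by the L^2 norms and translation invariance; the part with 1 is the
    product of the L^1 norms. *)
Lemma energy_lty f g : L12 f -> L12 g -> (forall x, 0 <= f x) -> (forall x, 0 <= g x) ->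
  (energy f g < +oo)%E.
Proof.
move=> Lf Lg f0 g0; have [f1 f2] := L12_lty Lf; have [g1 g2] := L12_lty Lg.
have [mf _ _] := Lf; have [mg _ _] := Lg.
pose nd := @newton_dyadic R n.
have mnd : measurable_fun setT nd by exact: measurable_newton_dyadic.
have nd0 z : (0 <= nd z)%E by exact: newton_dyadic_ge0.
have ndl : (\int[mu]_x nd x < +oo)%E by exact: newton_dyadic_lty (ltnW n3).
have ndN z : nd (- z) = nd z by exact: newton_dyadic_opp.
have ndS y : (\int[mu]_x nd (x - y)%R = \int[mu]_x nd x)%E by exact: integral_newton_dyadic.
have newton_nd z : (newton z <= nd z + 1)%E by exact: newton_le.
clearbody nd.
pose I1 := (\int[mu]_y \int[mu]_x ((f y ^+ 2 * 1)%:E * nd (x - y)%R))%E.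
pose I2 := (\int[mu]_y \int[mu]_x ((1 * g x ^+ 2)%:E * nd (x - y)%R))%E.
pose I3 := (\int[mu]_y \int[mu]_x (f y * g x)%:E)%E.
have mfs : measurable_fun setT (fun x => f x ^+ 2) by exact: measurable_funX.
have mgs : measurable_fun setT (fun x => g x ^+ 2) by exact: measurable_funX.
have m1 := @measurable_tensor_ker _ (fun=> 1) _ mfs (measurable_cst _) mnd.
have m2 := @measurable_tensor_ker (fun=> 1) _ _ (measurable_cst _) mgs mnd.
have m3 : measurable_fun setT (fun p : rV * rV => (f p.1 * g p.2)%:E).
  by apply/measurable_EFinP; exact: measurable_tensor.
have half h (y : rV) : (\int[mu]_x ((h y ^+ 2 * 1)%:E * nd (x - y)%R) =
    (h y ^+ 2)%:E * \int[mu]_x nd x)%E.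
  rewrite -(ndS y) -ge0_integralZl_EFin ?sqr_ge0//.
  - by apply: eq_integral => x _; rewrite mulr1.
  - exact: measurable_sub_l.
have halfint (h : rV -> R) : measurable_fun setT h -> (\int[mu]_x (h x ^+ 2)%:E < +oo)%E ->
    (\int[mu]_y ((h y ^+ 2)%:E * \int[mu]_x nd x) < +oo)%E.
  move=> mh hl; have nF : (\int[mu]_x nd x)%E \is a fin_num.
    by rewrite ge0_fin_numE// integral_ge0.
  rewrite -(fineK nF) ge0_integralZr//.
  - by rewrite -(fineK nF) lte_mul_pinfty// ?integral_ge0// ?lee_fin ?sqr_ge0//;
      [move=> ? _; rewrite lee_fin sqr_ge0|rewrite ge0_fin_numE// integral_ge0// => ? _; rewrite lee_fin sqr_ge0|rewrite ltry].
  - by apply/measurable_EFinP; exact: measurable_funX.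
  - by move=> x _; rewrite lee_fin sqr_ge0.
  - by rewrite lee_fin fine_ge0// integral_ge0.
have p1 p : (0 <= (f p.1 ^+ 2 * 1)%:E * nd (p.2 - p.1)%R)%E.
  by rewrite mule_ge0// lee_fin mulr1 sqr_ge0.
have p2 p : (0 <= (1 * g p.2 ^+ 2)%:E * nd (p.2 - p.1)%R)%E.
  by rewrite mule_ge0// lee_fin mul1r sqr_ge0.
have i1 : (I1 < +oo)%E.
  by rewrite /I1; under eq_integral do rewrite half; exact: halfint.
have i2 : (I2 < +oo)%E.
  rewrite /I2 (fubini_tonelli _ m2 p2) /=.
  rewrite (eq_integral (fun x => (g x ^+ 2)%:E * \int[mu]_x nd x)%E); first exact: halfint.
  move=> x _; rewrite -half; apply: eq_integral => y _.
  by rewrite mulrC -opprB ndN.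
have i3 : (I3 < +oo)%E.
  rewrite /I3; under eq_integral => y _.
    rewrite (eq_integral (fun x => (f y)%:E * (g x)%:E)%E); last by move=> x _; rewrite EFinM.
    rewrite ge0_integralZl_EFin//; [|by move=> x _; rewrite lee_fin|exact/measurable_EFinP].
    over.
  have e h : (forall x, 0 <= h x) -> (\int[mu]_x (`|h x|)%:E = \int[mu]_x (h x)%:E)%E.
    by move=> h0; apply: eq_integral => x _; rewrite ger0_norm.
  rewrite e// in f1; rewrite e// in g1.
  have gF : (\int[mu]_x (g x)%:E)%E \is a fin_num.
    by rewrite ge0_fin_numE// integral_ge0// => x _; rewrite lee_fin.
  rewrite -(fineK gF) ge0_integralZr//; [|exact/measurable_EFinP|by move=> x _; rewrite lee_fin|by rewrite lee_fin fine_ge0// integral_ge0// => x _; rewrite lee_fin].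
  rewrite lte_mul_pinfty ?ltry//; first by apply: integral_ge0 => x _; rewrite lee_fin.
  by rewrite ge0_fin_numE// integral_ge0// => x _; rewrite lee_fin.
pose F (p : rV * rV) : \bar R := ((f p.1 ^+ 2 * 1)%:E * nd (p.2 - p.1)%R
  + (1 * g p.2 ^+ 2)%:E * nd (p.2 - p.1)%R + (f p.1 * g p.2)%:E)%E.
have p3 (p : rV * rV) : (0 <= (f p.1 * g p.2)%:E)%E by rewrite lee_fin mulr_ge0.
have mF : measurable_fun setT F by apply: emeasurable_funD => //; exact: emeasurable_funD.
have mE := measurable_tensor_ker mf mg measurable_newton.
have E0 (p : rV * rV) : (0 <= (f p.1 * g p.2)%:E * newton (p.2 - p.1)%R)%E.
  by rewrite mule_ge0 ?newton_ge0// lee_fin mulr_ge0.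
apply: (@le_lt_trans _ _ (\int[(mu \x mu)%E]_p F p)%E).
  have -> : energy f g = (\int[(mu \x mu)%E]_p ((f p.1 * g p.2)%:E * newton (p.2 - p.1)%R))%E.
    by rewrite fubini_tonelli1.
  apply: ge0_le_integral => //.
  move=> [y x] _; rewrite /F /=.
  apply: (@le_trans _ _ ((f y * g x)%:E * (nd (x - y)%R + 1))%E).
    by rewrite lee_wpmul2l ?newton_nd// lee_fin mulr_ge0.
  rewrite ge0_muleDr// mule1 leeD2r// mulr1 mul1r -ge0_muleDl ?lee_fin ?sqr_ge0//.
  rewrite lee_wpmul2r// -EFinD lee_fin.
  have := sqr_ge0 (f y - g x); have := f0 y; have := g0 x.
  by move: (f y) (g x) => a b; nra.
rewrite /F ge0_integralD//; [|by move=> p _; rewrite adde_ge0|exact: emeasurable_funD].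
rewrite ge0_integralD// !fubini_tonelli1//.
by apply: lte_add_pinfty; [apply: lte_add_pinfty; [exact: i1|exact: i2]|exact: i3].
Qed.

End energy.

(** * Representation of solutions by potentials, and reciprocity *)

Section reciprocity.
Context {R : realType} {n : nat}.
Local Notation rV := 'rV[R]_n.
Local Notation mu := (@leb R n).
Local Notation J m x := (japanese x `^ m).
Local Notation bmass := (@bump_mass R n).
Hypothesis n3 : (3 <= n)%N.
Implicit Types (f g v w : rV -> R).

(** Energies are handled for nonnegative densities, where Tonelli and monotone convergence apply;
    signed densities are split into these parts. *)
Definition pospart g (x : rV) : R := Num.max (g x) 0.
Definition negpart g (x : rV) : R := Num.max (- g x) 0.

Lemma pospart_ge0 g x : 0 <= pospart g x.
Proof. by rewrite le_max lexx orbT. Qed.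

Lemma negpart_ge0 g x : 0 <= negpart g x.
Proof. by rewrite le_max lexx orbT. Qed.

Lemma pospart_le g x : pospart g x <= `|g x|.
Proof. by rewrite ge_max ler_norm normr_ge0. Qed.

Lemma negpart_le g x : negpart g x <= `|g x|.
Proof. by rewrite ge_max -normrN ler_norm normr_ge0. Qed.

Lemma pospartB g x : pospart g x - negpart g x = g x.
Proof. by rewrite /pospart /negpart; case: leP => h1; case: leP => h2; lra. Qed.

Lemma measurable_pospart g : measurable_fun setT g -> measurable_fun setT (pospart g).
Proof. by move=> mg; exact: measurable_maxr. Qed.

Lemma measurable_negpart g : measurable_fun setT g -> measurable_fun setT (negpart g).
Proof. by move=> mg; apply: measurable_maxr => //; exact: measurableT_comp. Qed.

Lemma L12_le f g : measurable_fun setT f -> (forall x, 0 <= f x <= `|g x|) ->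
  L12 g -> L12 f.
Proof.
move=> mf fg Lg; have [mg ig _] := L12_norm Lg; have [_ _ ig2] := Lg.
split=> //.
  by apply: (real_le_integrable mf _ ig) => x; have /andP[f0 h] := fg x; rewrite ger0_norm.
apply: (@real_le_integrable _ _ _ mu _ (fun x => g x ^+ 2)) => [||//]; first exact: measurable_funX.
move=> x; have /andP[f0 h] := fg x; rewrite ger0_norm ?sqr_ge0//.
by rewrite -(real_normK (num_real (g x))) lerXn2r ?nnegrE.
Qed.

Lemma L12_pospart g : L12 g -> L12 (pospart g).
Proof.
move=> Lg; have [mg _ _] := Lg; apply: L12_le Lg; first exact: measurable_pospart.
by move=> x; rewrite pospart_ge0 pospart_le.
Qed.

Lemma L12_negpart g : L12 g -> L12 (negpart g).
Proof.
move=> Lg; have [mg _ _] := Lg; apply: L12_le Lg; first exact: measurable_negpart.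
by move=> x; rewrite negpart_ge0 negpart_le.
Qed.

Lemma rbox_ccube (p : {ffun 'I_n -> rat} * {ffun 'I_n -> rat}) :
  exists2 e : R, 0 <= e & (rbox p : set rV) `<=` ccube e.
Proof.
exists (\sum_(i < n) (`|ratr (p.1 i)| + `|ratr (p.2 i)|)).
  by apply: sumr_ge0 => i _; rewrite addr_ge0.
move=> y yp; apply/ccubeP => i; have /andP[h1 h2] := yp i.
have h : `|ratr (p.1 i)| + `|ratr (p.2 i)| <=
    \sum_(i < n) (`|ratr (p.1 i)| + `|ratr (p.2 i)|) :> R.
  by rewrite (bigD1 i)//= lerDl; apply: sumr_ge0 => j _; rewrite addr_ge0.
have h3 := ler_norm (ratr (p.2 i) : R); have h4 := ler_norm (- ratr (p.1 i) : R).
rewrite normrN in h4; have h5 := normr_ge0 (ratr (p.1 i) : R).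
have h6 := normr_ge0 (ratr (p.2 i) : R).
by rewrite ler_norml; apply/andP; split; lra.
Qed.

Lemma ccube_powj (e : R) : 0 <= e -> exists2 C, 0 <= C &
  forall x : rV, ccube e x -> 1 <= C * J (- n%:R) x.
Proof.
move=> e0; pose M : R := Num.sqrt (1 + n%:R * e ^+ 2).
have M0 : 0 <= M by rewrite sqrtr_ge0.
exists (M ^+ n); first exact: exprn_ge0.
move=> x /ccubeP xe; have jx0 := japanese_gt0 x.
rewrite japanese_scaleV ler_pdivlMr ?exprn_gt0// mul1r lerXn2r ?nnegrE ?(ltW jx0)//.
rewrite -(@ler_pXn2r _ 2)// ?nnegrE ?(ltW jx0)// japanese_sqr sqr_sqrtr.
  rewrite lerD2l /nrm2 mulr_natl -[X in _ *+ X](card_ord n) -sumr_const.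
  apply: ler_sum => i _; rewrite -(real_normK (num_real (x 0 i))).
  by rewrite lerXn2r ?nnegrE.
by rewrite addr_ge0// mulr_ge0// sqr_ge0.
Qed.

Lemma zclass_indic_rbox p v : zclass v ->
  mu.-integrable setT (fun x => (\1_(rbox p) x * v x)%:E).
Proof.
move=> zv; have [e e0 pe] := rbox_ccube p; have [C C0 hC] := ccube_powj e0.
have mi : measurable_fun setT (\1_(rbox p) : rV -> R).
  by apply: measurable_indic; exact: measurable_rbox.
have : mu.-integrable setT (EFin \o (fun x => v x * \1_(rbox p) x)).
  apply: (zclass_integrable zv mi); exists C => x.
  rewrite indicE; have [xp|xp] := pselect (rbox p x).
    by rewrite mem_set// normr1; exact: hC (pe _ xp).
  by rewrite memNset// normr0 mulr_ge0// powR_ge0.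
by apply: eq_integrable => // x _ /=; rewrite mulrC.
Qed.

Lemma integrable_indic_rbox p : mu.-integrable setT (EFin \o (\1_(rbox p) : rV -> R)).
Proof.
have [e e0 pe] := rbox_ccube p.
apply: (@integrable_ccube _ _ _ 1 e) => //.
- by apply: measurable_indic; exact: measurable_rbox.
- by move=> x; rewrite indicE; case: (_ \in _); rewrite ?normr1 ?normr0.
- by move=> x nx; rewrite indicE memNset// => /pe.
Qed.

Lemma L12_indic_rbox p : L12 (\1_(rbox p) : rV -> R).
Proof.
have H := integrable_indic_rbox p.
split=> //; first by apply: measurable_indic; exact: measurable_rbox.
apply: eq_integrable H => // x _ /=; rewrite indicE.
by case: (_ \in _); rewrite ?expr1n ?expr0n.
Qed.

Lemma measurable_ker (h : rV -> R) (y : rV) : measurable_fun setT h ->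
  measurable_fun setT (fun x : rV => h (x - y)).
Proof.
by move=> /measurable_EFinP mh; apply/measurable_EFinP; exact: (measurable_sub_l y mh).
Qed.

(** Fubini: after integration over the box the kernel is bounded by C <x>^(-n), against which a
    function of [zclass] is integrable. *)
Lemma mollified_pairing p k v : zclass v ->
  (mu \x mu)%E.-integrable setT
    (fun q : rV * rV => (\1_(rbox p) q.1 * v q.2 * approx_id k (q.2 - q.1))%:E) /\
  (\int[mu]_y \int[mu]_x (\1_(rbox p) y * v x * approx_id k (x - y)%R)%:E =
   \int[mu]_x ((v x)%:E * mollified_box p k x))%E.
Proof.
move=> zv; have [mv iv _] := zv; have [C C0 hC] := @mollified_box_bound R n n3 p.
have ma : measurable_fun setT (@approx_id R n k).
  have := @measurable_approx_id R n n3 k 0.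
  by apply: eq_measurable_fun => x _; rewrite sub0r approx_idN.
have mi : measurable_fun setT (\1_(rbox p) : rV -> R).
  by apply: measurable_indic; exact: measurable_rbox.
have m2 : measurable_fun setT (fun q : rV * rV =>
    (\1_(rbox p) q.1 * v q.2 * approx_id k (q.2 - q.1))%:E).
  have := measurable_tensor_ker mi mv ((measurable_EFinP _ _).2 ma).
  by apply: eq_measurable_fun => q _ /=; rewrite -EFinM.
have mk x : measurable_fun setT (fun y : rV => (\1_(rbox p) y * approx_id k (x - y))%:E).
  by apply/measurable_EFinP; apply: measurable_funM; [exact: mi|exact: (@measurable_approx_id R n n3 k x)].
have k0 x y : 0 <= \1_(rbox p) y * approx_id k (x - y) :> R.
  by apply: mulr_ge0 => //; exact: approx_id_ge0.
have ik x : mu.-integrable setT (fun y : rV => (\1_(rbox p) y * approx_id k (x - y))%:E).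
  apply/integrableP; split; first exact: mk.
  apply: le_lt_trans (ltry (C * J (- n%:R) x)); apply: le_trans (hC k x).
  by apply: ge0_le_integral => //; [exact: measurableT_comp|move=> y _; rewrite gee0_abs// lee_fin].
have i2 : (mu \x mu)%E.-integrable setT (fun q : rV * rV =>
    (\1_(rbox p) q.1 * v q.2 * approx_id k (q.2 - q.1))%:E).
  apply/(integrable21ltyP _ _ m2).
  have iC : mu.-integrable setT (fun x => (C * `|v x * J (- n%:R) x|)%:E).
    have := integrableZl measurableT C (integrable_abse iv).
    by apply: eq_integrable => // x _ /=; rewrite EFinM.
  have mC := measurable_int _ iC.
  apply: (@le_lt_trans _ _ (\int[mu]_x (C * `|v x * J (- n%:R) x|)%:E)%E); last first.
    have /integrableP[_] := iC; apply: le_lt_trans; apply: ge0_le_integral => //.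
    - by move=> x _; rewrite lee_fin mulr_ge0.
    - exact: measurableT_comp.
    - by move=> x _; exact: lee_abs.
  apply: ge0_le_integral => //.
  - by move=> x _; exact: integral_ge0.
  - have := @measurable_fun_fubini_tonelli_G _ _ _ _ R mu
      (fun q : rV * rV => `|(\1_(rbox p) q.1 * v q.2 * approx_id k (q.2 - q.1))%:E|)%E.
    by apply => //; exact: measurableT_comp.
  - move=> x _; rewrite normrM mulrCA EFinM.
    rewrite (eq_integral (fun y => `|v x|%:E * (\1_(rbox p) y * approx_id k (x - y))%:E)%E); last first.
      move=> y _ /=; rewrite -EFinM; congr EFin.
      by rewrite [_ * v x]mulrC -mulrA normrM (ger0_norm (k0 x y)).
    rewrite ge0_integralZl_EFin//; last by move=> y _; rewrite lee_fin.
    rewrite lee_wpmul2l ?lee_fin// (ger0_norm (powR_ge0 _ _)); exact: hC.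
split=> //; rewrite (Fubini i2); apply: eq_integral => x _.
rewrite /mollified_box -integralZl//.
by apply: eq_integral => y _; rewrite -EFinM [in RHS]mulrCA mulrA.
Qed.

Lemma measurable_mollified_box p k : measurable_fun setT (@mollified_box R n p k).
Proof.
have ma : measurable_fun setT (@approx_id R n k).
  have := @measurable_approx_id R n n3 k 0.
  by apply: eq_measurable_fun => x _; rewrite sub0r approx_idN.
have mi : measurable_fun setT (\1_(rbox p) : rV -> R).
  by apply: measurable_indic; exact: measurable_rbox.
have m2 := @measurable_tensor_ker R n _ (fun=> 1) _ mi (measurable_cst _) ((measurable_EFinP _ _).2 ma).
have h (q : rV * rV) : (0 <= (\1_(rbox p) q.1 * 1)%:E * (EFin \o approx_id k) (q.2 - q.1)%R)%E.
  by rewrite mule_ge0 ?lee_fin ?approx_id_ge0// mulr_ge0.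
have := @measurable_fun_fubini_tonelli_G _ _ _ _ R mu _ m2 h; rewrite /fubini_G.
apply: eq_measurable_fun => x _; apply: eq_integral => y _ /=.
by rewrite -EFinM mulr1.
Qed.

Lemma cvg_mollified_pairing p v : zclass v ->
  (\int[mu]_x ((v x)%:E * mollified_box p k x))%E @[k --> \oo] -->
  (bmass%:E * \int[mu]_x (\1_(rbox p) x * v x)%:E)%E.
Proof.
move=> zv; have [mv iv _] := zv; have [C C0 hC] := @mollified_box_bound R n n3 p.
have mi : measurable_fun setT (\1_(rbox p) : rV -> R).
  by apply: measurable_indic; exact: measurable_rbox.
have iC : mu.-integrable setT (fun x => (C * `|v x * J (- n%:R) x|)%:E).
  have := integrableZl measurableT C (integrable_abse iv).
  by apply: eq_integrable => // x _ /=; rewrite EFinM.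
have [| | | | |i _ H] := @dominated_convergence _ _ _ mu setT measurableT
  (fun k x => (v x)%:E * mollified_box p k x)%E
  (fun x => (v x * (bmass * \1_(rbox p) x))%:E)
  (fun x => (C * `|v x * J (- n%:R) x|)%:E).
- by move=> k; apply: emeasurable_funM; [exact/measurable_EFinP|exact: measurable_mollified_box].
- apply/measurable_EFinP; apply: measurable_funM => //; exact: measurable_funM.
- apply: filterS (rbox_boundary_ae p) => x nx _.
  by rewrite EFinM; apply: cvgeZl => //; exact: cvg_mollified_box.
- exact: iC.
- apply: aeW => x k _; rewrite abseM abse_EFin (gee0_abs (mollified_box_ge0 _ _ _)).
  apply: (@le_trans _ _ (`|v x|%:E * (C * J (- n%:R) x)%:E)%E).
    by rewrite lee_wpmul2l ?lee_fin.
  by rewrite -EFinM lee_fin normrM (ger0_norm (powR_ge0 _ _)) mulrCA.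
move: H; congr (_ --> _).
rewrite -integralZl//; last first.
  by move: (integrableZl measurableT bmass^-1 i); apply: eq_integrable => // x _ /=;
    rewrite -EFinM; congr EFin; rewrite mulrCA [_ * v x]mulrC; congr (_ * _);
    rewrite mulrA mulVf ?mul1r// gt_eqF// bump_mass_gt0.
by apply: eq_integral => x _; rewrite -EFinM; congr EFin; rewrite mulrCA [_ * v x]mulrC.
Qed.

Lemma bubble_le_newton k (z : rV) : ((bubble k z)%:E <= newton z)%E.
Proof.
apply: lime_ge; first exact: ereal_nondecreasing_is_cvgn (bubble_e_nd z).
by exists k => // m /= km; exact: bubble_e_nd.
Qed.

Lemma energy_approx_integrable k f g : L12 f -> L12 g -> (forall x, 0 <= f x) ->
  (forall x, 0 <= g x) ->
  (mu \x mu)%E.-integrable setT (fun q : rV * rV => (f q.1 * g q.2 * bubble k (q.2 - q.1))%:E).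
Proof.
move=> Lf Lg f0 g0; have [mf _ _] := Lf; have [mg _ _] := Lg.
have m1 := measurable_tensor_ker mf mg (measurable_newton n3).
have m2 : measurable_fun setT (fun q : rV * rV => (f q.1 * g q.2 * bubble k (q.2 - q.1))%:E).
  have := measurable_tensor_ker mf mg ((measurable_EFinP _ _).2 (measurable_bubble n3 k)).
  by apply: eq_measurable_fun => q _ /=; rewrite -EFinM.
have fg0 (q : rV * rV) : (0 <= (f q.1 * g q.2)%:E)%E by rewrite lee_fin mulr_ge0.
have b0 (q : rV * rV) : (0 <= (f q.1 * g q.2 * bubble k (q.2 - q.1))%:E)%E.
  by rewrite lee_fin; apply: mulr_ge0; [exact: mulr_ge0|exact: bubble_ge0].
have N0 (q : rV * rV) : (0 <= (f q.1 * g q.2)%:E * newton (q.2 - q.1)%R)%E.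
  by rewrite mule_ge0// newton_ge0.
apply/integrableP; split => //.
apply: le_lt_trans (energy_lty n3 Lf Lg f0 g0).
have -> : energy f g = (\int[(mu \x mu)%E]_p ((f p.1 * g p.2)%:E * newton (p.2 - p.1)%R))%E.
  by rewrite fubini_tonelli1.
apply: ge0_le_integral => //; first exact: measurableT_comp.
by move=> q _; rewrite gee0_abs// EFinM lee_wpmul2l// bubble_le_newton.
Qed.

(** The hypothesis is - laplacian v = g tested against the bubble centred at y. Integrated over y in
    the box, its left side tends to [bmass] times the integral of [v], its right side to a
    difference of energies. The negative energy is moved across so that no infinite values are
    subtracted. *)
Lemma box_energy p v g : zclass v -> L12 g ->
  (forall k y, \int[mu]_x (v x * approx_id k (x - y)%R)%:E =
               \int[mu]_x (g x * bubble k (x - y)%R)%:E)%E ->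
  energy (\1_(rbox p)) (pospart g) =
  (energy (\1_(rbox p)) (negpart g) + bmass%:E * \int[mu]_x (\1_(rbox p) x * v x)%:E)%E.
Proof.
move=> zv Lg eqn; have [mg ig _] := Lg; have [mv iv _] := zv.
have LB := L12_indic_rbox p; have [mi iB _] := LB.
have i0 (y : rV) : 0 <= (\1_(rbox p) y : R) by [].
have Ep := cvg_energy n3 mi (measurable_pospart mg) i0 (pospart_ge0 g).
have En := cvg_energy n3 mi (measurable_negpart mg) i0 (negpart_ge0 g).
have fn := energy_lty n3 LB (L12_negpart Lg) i0 (negpart_ge0 g).
have mb k := measurable_bubble n3 k.
have ib k y h : L12 h -> mu.-integrable setT (fun x : rV => (h x * bubble k (x - y))%:E).
  move=> [mh ih _]; apply: (@real_le_integrable _ _ _ mu _ (fun x => k.+1%:R ^+ (n - 2) * `|h x|)).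
  - by apply: measurable_funM => //; exact: measurable_ker.
  - move=> x; rewrite normrM mulrC (ger0_norm (bubble_ge0 _ _)) ler_wpM2r//; exact: bubble_le.
  have := integrableZl measurableT (k.+1%:R ^+ (n - 2)) (integrable_abse ih).
  by apply: eq_integrable => // x _ /=; rewrite EFinM.
have step k : energy_approx k (\1_(rbox p)) (pospart g) =
    (energy_approx k (\1_(rbox p)) (negpart g) +
     \int[mu]_x ((v x)%:E * mollified_box p k x))%E.
  have [i2 <-] := mollified_pairing p k zv.
  have i3 := energy_approx_integrable k LB (L12_negpart Lg) i0 (negpart_ge0 g).
  have H := integralD measurableT (integrable_fubini_F i3) (integrable_fubini_F i2).
  apply: etrans H; apply: eq_integral => y _; rewrite /fubini_F /=.
  rewrite indicE; case: (y \in rbox p); last first.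
    have z h h' : (\int[mu]_x (0 * h x * h' (x - y))%:E = 0)%E.
      by apply: integral0_eq => x _; rewrite !mul0r.
    by rewrite !z adde0.
  have o h h' : (\int[mu]_x (1 * h x * h' (x - y))%:E = \int[mu]_x (h x * h' (x - y))%:E)%E.
    by apply: eq_integral => x _; rewrite mul1r.
  rewrite !o eqn -integralD//; [|exact: ib (L12_negpart Lg)|exact: ib Lg].
  apply: eq_integral => x _; rewrite -EFinD -mulrDl; congr (_ * _)%:E.
  by have := pospartB g x; lra.
have vF : (bmass%:E * \int[mu]_x (\1_(rbox p) x * v x)%:E)%E \is a fin_num.
  by rewrite fin_numM//; apply: integrable_fin_num => //; exact: zclass_indic_rbox.
have H : (fun k => energy_approx k (\1_(rbox p)) (negpart g) +
    \int[mu]_x ((v x)%:E * mollified_box p k x))%E @ \oo -->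
    (energy (\1_(rbox p)) (negpart g) + bmass%:E * \int[mu]_x (\1_(rbox p) x * v x)%:E)%E.
  apply: cvgeD; [exact: fin_num_adde_defl|exact: En|exact: cvg_mollified_pairing].
rewrite -(funext step : (fun k => _) = _) in H.
by rewrite -(cvg_lim (@ereal_hausdorff R) Ep) -(cvg_lim (@ereal_hausdorff R) H).
Qed.

(** [v] is almost everywhere 1 / [bmass] times the Newtonian potential of [g]: the two sides have
    equal integrals over all boxes, by [box_energy]. *)
Lemma solution_potential v g : zclass v -> L12 g ->
  (forall k y, \int[mu]_x (v x * approx_id k (x - y)%R)%:E =
               \int[mu]_x (g x * bubble k (x - y)%R)%:E)%E ->
  {ae mu, forall y, newton_potential (pospart g) y =
     newton_potential (negpart g) y + (bmass * v y)%:E}%E.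
Proof.
move=> zv Lg eqn; have [mg ig _] := Lg; have [mv iv _] := zv.
have mp := measurable_newton_potential n3 (measurable_pospart mg) (pospart_ge0 g).
have mn := measurable_newton_potential n3 (measurable_negpart mg) (negpart_ge0 g).
have mi p : measurable_fun setT (\1_(rbox p) : rV -> R).
  by apply: measurable_indic; exact: measurable_rbox.
have i0 p (y : rV) : 0 <= (\1_(rbox p) y : R) by [].
have pot0 := newton_potential_ge0.
have ivB p := zclass_indic_rbox p zv.
have iE h p : L12 h -> (forall x, 0 <= h x) -> mu.-integrable setT (fun y => (\1_(rbox p) y)%:E * newton_potential h y)%E.
  move=> Lh h0; have [mh _ _] := Lh; have mN := measurable_newton_potential n3 mh h0.
  have H0 y : (0 <= (\1_(rbox p) y : R)%:E * newton_potential h y)%E by rewrite mule_ge0 ?lee_fin ?pot0.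
  have mH : measurable_fun setT (fun y : rV => (\1_(rbox p) y : R)%:E * newton_potential h y)%E.
    by apply: emeasurable_funM => //; exact/measurable_EFinP.
  apply/integrableP; split => //.
  under eq_integral do rewrite gee0_abs//.
  rewrite -(energyE n3)//; exact: energy_lty (L12_indic_rbox p) Lh _ h0.
(* Multiplication by the indicator of a cube makes both sides integrable, as [rbox_ae_eq] requires;
   intersecting with the cube sends boxes to boxes. *)
have cube m : ae_eq mu setT
    (fun y => (\1_(rcube m) y : R)%:E * newton_potential (pospart g) y)%E
    (fun y => (\1_(rcube m) y : R)%:E * newton_potential (negpart g) y
       + bmass%:E * (\1_(rcube m) y * v y)%:E)%E.
  have iv2 : mu.-integrable setT (fun y => bmass%:E * (\1_(rcube m) y * v y)%:E)%E.
    exact: integrableZl (ivB _).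
  apply: rbox_ae_eq.
  - exact: iE (L12_pospart Lg) (pospart_ge0 g).
  - by apply: integrableD => //; exact: iE (L12_negpart Lg) (negpart_ge0 g).
  move=> p; have [q _ qE] : (range rbox) ((rbox p : set rV) `&` rcube m).
    by apply: rboxI; [exists p|exists ([ffun=> - m%:R], [ffun=> m%:R])].
  have rw (h : rV -> \bar R) : (\int[mu]_(y in rbox p) ((\1_(rcube m) y : R)%:E * h y) =
      \int[mu]_y ((\1_(rbox q) y : R)%:E * h y))%E.
    rewrite integral_mkcond; apply: eq_integral => y _.
    rewrite patchE (qE : rbox q = _) indicI /=.
    by rewrite [\1_(rbox p) _]indicE; case: ifP => _; rewrite ?mul1r ?mul0r ?mul0e.
  rewrite rw -(energyE n3 (mi q) (measurable_pospart mg) (i0 q) (pospart_ge0 g)).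
  rewrite (box_energy q zv Lg eqn) (energyE n3 (mi q) (measurable_negpart mg) (i0 q) (negpart_ge0 g)).
  rewrite -integralZl// -integralD//; [|exact: iE (L12_negpart Lg) (negpart_ge0 g)|exact: integrableZl (ivB q)].
  rewrite [RHS](eq_integral (fun y => (\1_(rcube m) y : R)%:E * (newton_potential (negpart g) y
     + bmass%:E * (v y)%:E))%E).
    by rewrite rw; apply: eq_integral => y _; rewrite indicE; case: (y \in _);
      rewrite ?mul1e ?mul0e ?mul1r ?mul0r ?mule0 ?adde0.
  by move=> y _; rewrite indicE; case: (y \in _); rewrite ?mul1e ?mul0e ?mul1r ?mul0r ?mule0 ?adde0.
have := ae_foralln cube; apply: filterS => y cy.
have [m _ ym] : (\bigcup_k rcube k) y by rewrite rcube_cover.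
have := cy m I; rewrite indicE mem_set// !mul1e mul1r => ->.
by rewrite EFinM.
Qed.

Lemma solution_energy v g f : zclass v -> L12 g ->
  (forall k y, \int[mu]_x (v x * approx_id k (x - y)%R)%:E =
               \int[mu]_x (g x * bubble k (x - y)%R)%:E)%E ->
  L12 f -> (forall x, 0 <= f x) -> mu.-integrable setT (fun x => (f x * v x)%:E) ->
  fine (energy f (pospart g)) =
  fine (energy f (negpart g)) + bmass * fine (\int[mu]_x (f x * v x)%:E)%E.
Proof.
move=> zv Lg eqn Lf f0 ifv; have [mg ig _] := Lg; have [mf _ _] := Lf.
have mp := measurable_newton_potential n3 (measurable_pospart mg) (pospart_ge0 g).
have mn := measurable_newton_potential n3 (measurable_negpart mg) (negpart_ge0 g).
have [mv _ _] := zv.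
have fn := energy_lty n3 Lf (L12_negpart Lg) f0 (negpart_ge0 g).
have n0 y := newton_potential_ge0 (negpart_ge0 g) y.
have e0 : (0 <= energy f (negpart g))%E.
  by rewrite energyE//; [|exact: measurable_negpart|exact: negpart_ge0];
    apply: integral_ge0 => y _; rewrite mule_ge0 ?lee_fin.
have eF : energy f (negpart g) \is a fin_num by rewrite ge0_fin_numE.
have iF : (\int[mu]_x (f x * v x)%:E)%E \is a fin_num by exact: integrable_fin_num.
suff -> : energy f (pospart g) = (energy f (negpart g) + bmass%:E * \int[mu]_x (f x * v x)%:E)%E.
  by rewrite fineD// ?fin_numM// fineM.
have e1 := energyE n3 mf (measurable_negpart mg) f0 (negpart_ge0 g).
rewrite (energyE n3 mf (measurable_pospart mg) f0 (pospart_ge0 g)).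
have mfn : measurable_fun setT (fun y => (f y)%:E * newton_potential (negpart g) y)%E.
  by apply: emeasurable_funM => //; exact/measurable_EFinP.
have in1 : mu.-integrable setT (fun y => (f y)%:E * newton_potential (negpart g) y)%E.
  apply/integrableP; split => //.
  by under eq_integral do rewrite gee0_abs ?mule_ge0 ?lee_fin//; rewrite -e1.
have e2 := integralZl measurableT ifv bmass.
have e3 := integralD measurableT in1 (integrableZl measurableT bmass ifv).
rewrite e1 -e2; apply: etrans e3.
apply: ae_eq_integral => //.
- by apply: emeasurable_funM => //; exact/measurable_EFinP.
- apply: emeasurable_funD => //; apply/measurable_EFinP.
  by do 2 apply: measurable_funM => //.
apply: filterS (solution_potential zv Lg eqn) => y -> _ /=.
rewrite muleDr//; last exact: fin_num_adde_defl.
by rewrite -!EFinM mulrCA.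
Qed.

Lemma fine_integral_parts f h : measurable_fun setT f -> measurable_fun setT h ->
  mu.-integrable setT (fun x => (f x * h x)%:E) ->
  [/\ mu.-integrable setT (fun x => (pospart f x * h x)%:E),
      mu.-integrable setT (fun x => (negpart f x * h x)%:E) &
      fine (\int[mu]_x (f x * h x)%:E)%E = fine (\int[mu]_x (pospart f x * h x)%:E)%E
        - fine (\int[mu]_x (negpart f x * h x)%:E)%E].
Proof.
move=> mf mh ifh.
have i1 : mu.-integrable setT (fun x => (pospart f x * h x)%:E).
  apply: (@real_le_integrable _ _ _ mu _ (fun x => `|f x * h x|)) (integrable_abse ifh).
  - by apply: measurable_funM => //; exact: measurable_pospart.
  - by move=> x; rewrite !normrM ler_wpM2r// ger0_norm ?pospart_ge0 ?pospart_le.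
have i2 : mu.-integrable setT (fun x => (negpart f x * h x)%:E).
  apply: (@real_le_integrable _ _ _ mu _ (fun x => `|f x * h x|)) (integrable_abse ifh).
  - by apply: measurable_funM => //; exact: measurable_negpart.
  - by move=> x; rewrite !normrM ler_wpM2r// ger0_norm ?negpart_ge0 ?negpart_le.
split => //; rewrite -fineB ?integrable_fin_num// -integralB//.
by congr fine; apply: eq_integral => x _; rewrite -EFinB -mulrBl pospartB.
Qed.

(** Here a, b, c, d are the energies of the pairs (f+, g+), (f+, g-), (f-, g+), (f-, g-). Both sides
    of the conclusion, multiplied by [m], equal a - b - c + d, the energy of the signed
    densities. *)
Let four_terms (m a b c d e1 e2 e3 e4 : R) : 0 < m -> b = d + m * e4 -> a = c + m * e3 ->
  c = d + m * e2 -> a = b + m * e1 -> e1 - e2 = e3 - e4.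
Proof.
by move=> m0 h1 h2 h3 h4; apply: (mulfI (lt0r_neq0 m0)); rewrite !mulrBr; lra.
Qed.

(* Formally f = - laplacian w and g = - laplacian v, and both sides are the
   (symmetric) Newtonian energy of f and g; this replaces Green's formula, for
   which v and w are not regular enough. *)
Lemma reciprocity v w f g : zclass v -> zclass w -> L12 f -> L12 g ->
  (forall k y, \int[mu]_x (v x * approx_id k (x - y)%R)%:E =
               \int[mu]_x (g x * bubble k (x - y)%R)%:E)%E ->
  (forall k y, \int[mu]_x (w x * approx_id k (x - y)%R)%:E =
               \int[mu]_x (f x * bubble k (x - y)%R)%:E)%E ->
  mu.-integrable setT (fun x => (f x * v x)%:E) ->
  mu.-integrable setT (fun x => (g x * w x)%:E) ->
  (\int[mu]_x (f x * v x)%:E = \int[mu]_x (g x * w x)%:E)%E.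
Proof.
move=> zv zw Lf Lg ev ew ifv igw.
have [mf _ _] := Lf; have [mg _ _] := Lg; have [mv _ _] := zv; have [mw _ _] := zw.
rewrite -[LHS]fineK ?integrable_fin_num// -[RHS]fineK ?integrable_fin_num//.
have [ip im ->] := fine_integral_parts mf mv ifv.
have [jp jm ->] := fine_integral_parts mg mw igw.
have := solution_energy zv Lg ev (L12_pospart Lf) (pospart_ge0 f) ip.
have := solution_energy zv Lg ev (L12_negpart Lf) (negpart_ge0 f) im.
have := solution_energy zw Lf ew (L12_pospart Lg) (pospart_ge0 g) jp.
have := solution_energy zw Lf ew (L12_negpart Lg) (negpart_ge0 g) jm.
have C (a b : rV -> R) : L12 a -> L12 b -> (forall x, 0 <= a x) -> (forall x, 0 <= b x) ->
    energy a b = energy b a by move=> La Lb a0 b0; have [ma _ _] := La; have [mb _ _] := Lb; exact: (@energyC R n n3 a b ma mb a0 b0).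
have [Lfp Lfn] := (L12_pospart Lf, L12_negpart Lf).
have [Lgp Lgn] := (L12_pospart Lg, L12_negpart Lg).
have [fp fn] := (pospart_ge0 f, negpart_ge0 f); have [gp gn] := (pospart_ge0 g, negpart_ge0 g).
rewrite (C (pospart g) (pospart f))// (C (pospart g) (negpart f))//.
rewrite (C (negpart g) (pospart f))// (C (negpart g) (negpart f))//.
have := bump_mass_gt0 n3 : 0 < bmass.
by move=> m0 h1 h2 h3 h4; congr EFin; exact: (four_terms m0 h1 h2 h3 h4).
Qed.


End reciprocity.

(** * Zero modes for generic couplings *)

Section generic_coupling.
Context {R : realType} {n : nat}.
Local Notation rV := 'rV[R]_n.
Local Notation mu := (@leb R n).
Local Notation J m x := (japanese x `^ m).
Hypothesis n3 : (3 <= n)%N.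
Implicit Types (f g v w V : rV -> R).

Lemma le_powjn (x : rV) (m : R) : m <= n%:R -> J (- n%:R) x <= J (- m) x.
Proof. by move=> h; apply: le_powj; rewrite lerN2. Qed.

Let n2R : (2 : R) <= n%:R. Proof. by rewrite ler_nat ltnW. Qed.
Let n3R : (3 : R) <= n%:R. Proof. by rewrite ler_nat. Qed.

(** The rate matches the weight in [zclass]: it makes [V v] integrable, and square integrable as 2 n
    >= 3. *)
Definition decays V := exists2 C, 0 <= C & forall x : rV, `|V x| <= C * J (- n%:R) x.

Lemma zclass_mul_L12 v V : zclass v -> measurable_fun setT V -> decays V ->
  L12 (fun x => - (V x * v x)).
Proof.
move=> zv mV [C C0 hC]; have [mv iv iv2] := zv.
have mVv : measurable_fun setT (fun x => V x * v x) by exact: measurable_funM.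
have m : measurable_fun setT (fun x => - (V x * v x)) by exact: measurableT_comp.
split => //.
  have : mu.-integrable setT (EFin \o (fun x => v x * V x)).
    by apply: zclass_integrable => //; exists C.
  move=> /(integrableN); apply: eq_integrable => // x _ /=; by rewrite mulrC.
apply: (@real_le_integrable _ _ _ mu _ (fun x => C ^+ 2 * (v x ^+ 2 * J (- 3) x))).
- exact: measurable_funX.
- move=> x; rewrite sqrrN exprMn; have q0 : 0 <= V x ^+ 2 * v x ^+ 2.
    by apply: mulr_ge0; exact: sqr_ge0.
  rewrite (ger0_norm q0) [leRHS]mulrCA [leLHS]mulrC ler_wpM2l ?sqr_ge0//.
  rewrite -(real_normK (num_real (V x))).
  apply: (@le_trans _ _ ((C * J (- n%:R) x) ^+ 2)).
    by rewrite lerXn2r ?nnegrE// mulr_ge0// powR_ge0.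
  rewrite exprMn ler_wpM2l ?sqr_ge0// -powR_mulrn ?powR_ge0// -powRrM.
  by apply: le_powj; have := n3R; lra.
have := integrableZl measurableT (C ^+ 2) iv2.
by apply: eq_integrable => // x _ /=; rewrite EFinM.
Qed.

Lemma zclass_mul_integrable v w V : zclass v -> zclass w -> measurable_fun setT V ->
  decays V -> mu.-integrable setT (fun x => (V x * v x * w x)%:E).
Proof.
move=> [mv _ iv] [mw _ iw] mV [C C0 hC].
apply: (@real_le_integrable _ _ _ mu _ (fun x => C * (v x ^+ 2 * J (- 3) x) + C * (w x ^+ 2 * J (- 3) x))).
- by apply: measurable_funM => //; exact: measurable_funM.
- move=> x; rewrite -mulrDr -mulrDl -mulrA normrM.
  have h : `|V x| <= C * J (- 3) x.
    by apply: le_trans (hC x) _; rewrite ler_wpM2l// le_powjn.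
  rewrite [_ * J _ _]mulrC mulrA; apply: ler_pM => //; rewrite normrM.
  rewrite -(real_normK (num_real (v x))) -(real_normK (num_real (w x))).
  by have := sqr_ge0 (`|v x| - `|w x|); have := normr_ge0 (v x); have := normr_ge0 (w x);
    move: `|v x| `|w x| => a b; nra.
have := integrableD measurableT (integrableZl measurableT C iv) (integrableZl measurableT C iw).
by apply: eq_integrable => // x _ /=; rewrite EFinD !EFinM.
Qed.

Lemma zsol_integrable v V phi : zclass v -> measurable_fun setT V -> decays V ->
  test_function phi ->
  mu.-integrable setT (EFin \o (fun x => v x * (- laplacian phi x + V x * phi x))).
Proof.
move=> zv mV [C C0 hC] tphi; have [e e0 phi0] := test_function_support tphi.
have [B B0 hB] := test_bounded [::] tphi; have [A A0 hA] := laplacian_bounded tphi.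
have [D D0 hD] := @ccube_powj R n e (ltW e0).
apply: (zclass_integrable zv).
  apply: measurable_funD.
    by apply: measurableT_comp => //; exact: laplacian_measurable tphi.1.
  by apply: measurable_funM => //; exact: (@smooth_measurable _ _ phi [::] tphi.1).
exists ((A + C * B) * D) => x; have [xe|xe] := pselect (ccube e x); last first.
  have l0 : laplacian phi x = 0 by apply: big1 => i _; exact: phi0.
  have p0 : phi x = 0 by exact: (phi0 [::]).
  rewrite l0 p0 oppr0 mulr0 addr0 normr0.
  by apply: mulr_ge0; [apply: mulr_ge0 => //; rewrite addr_ge0// mulr_ge0|exact: powR_ge0].
have V1 : `|V x| <= C.
  apply: le_trans (hC x) _; rewrite ler_piMr// -[leRHS](powRr0 (japanese x)).
  by apply: le_powj; have := n3R; lra.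
apply: (@le_trans _ _ (A + C * B)).
  apply: le_trans (ler_normD _ _) _; rewrite normrN; apply: lerD => //.
  by rewrite normrM; apply: ler_pM => //; exact: hB.
by rewrite -[leLHS]mulr1 -mulrA ler_wpM2l ?hD// addr_ge0// mulr_ge0.
Qed.

(** The bubble centred at y has order 2 - n, so [weak_eq_sym] allows it as a test function. The
    result is the hypothesis of [reciprocity] with density - V v. *)
Lemma solution_newton v V k y : zclass v -> measurable_fun setT V -> decays V -> zsol V v ->
  (\int[mu]_x (v x * approx_id k (x - y)%R)%:E =
   \int[mu]_x (- (V x * v x) * bubble k (x - y)%R)%:E)%E.
Proof.
move=> zv mV [C C0 hC] sol; have [mv _ _] := zv.
have sP := @sym_bubble R n n3 k y.
have V2 x : `|V x| <= C * J (- 2) x.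
  by apply: le_trans (hC x) _; rewrite ler_wpM2l// le_powjn.
have H := weak_eq_sym zv mV V2 sol sP.
have [A A0 hA] := sym_bnd sP.
have [B B0 hB] := sym_bnd (sym_laplacian sP).
have ma : measurable_fun setT (fun x : rV => approx_id k (x - y)).
  have := laplacian_measurable (sym_smooth sP) => h.
  have : measurable_fun setT (fun x : rV => - laplacian (fun x => bubble k (x - y)) x).
    exact: measurableT_comp.
  by apply: eq_measurable_fun => x _; rewrite laplacian_bubble// opprK.
have mb : measurable_fun setT (fun x : rV => bubble k (x - y)).
  exact: measurable_ker (measurable_bubble n3 k).
have i1 : mu.-integrable setT (EFin \o (fun x => v x * approx_id k (x - y))).
  apply: (zclass_integrable zv ma); exists B => x; have := hB x.
  by rewrite laplacian_bubble// normrN; move/le_trans; apply; rewrite ler_wpM2l// le_powj//; lra.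
have i2 : mu.-integrable setT (EFin \o (fun x => v x * (V x * bubble k (x - y)))).
  apply: (zclass_integrable zv); first exact: measurable_funM.
  exists (C * A) => x; rewrite normrM.
  rewrite (_ : J (- n%:R) x = J (- 2) x * J (2 - n%:R) x); last first.
    by rewrite -powjD; congr powR; lra.
  by rewrite mulrACA; exact: ler_pM.
have E : (\int[mu]_x (v x * approx_id k (x - y)%R)%:E +
          \int[mu]_x (v x * (V x * bubble k (x - y)%R))%:E = 0)%E.
  rewrite -H -integralD//; apply: eq_integral => x _.
  by rewrite -EFinD -mulrDr laplacian_bubble// opprK.
have F : (\int[mu]_x (v x * (V x * bubble k (x - y)%R))%:E)%E \is a fin_num.
  exact: integrable_fin_num.
transitivity (- \int[mu]_x (v x * (V x * bubble k (x - y)%R))%:E)%E.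
  by rewrite -[LHS]adde0 -(subee F) addeA E add0e.
rewrite -integralN; last exact: integrable_add_def.
by apply: eq_integral => x _ /=; rewrite mulNr mulrA [v x * _]mulrC.
Qed.

(** * Orthogonality of zero modes for distinct couplings *)

Section orthogonality.
Variables (U W : rV -> R).
Hypotheses (mU : measurable_fun setT U) (mW : measurable_fun setT W).
Hypotheses (dU : decays U) (dW : decays W).

Let coupled (t : R) (x : rV) : R := U x + t * W x.

Lemma decays_coupled t : decays (coupled t).
Proof.
have [A A0 hA] := dU; have [B B0 hB] := dW; exists (A + `|t| * B).
  by rewrite addr_ge0// mulr_ge0.
move=> x; apply: le_trans (ler_normD _ _) _; rewrite mulrDl lerD// normrM -mulrA.
by rewrite ler_wpM2l.
Qed.

(** Reciprocity equates the integrals of (U + t W) v w and (U + s W) v w; the terms with [U] cancel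
    and (s - t) times the integral of W v w remains. *)
Lemma solutions_orthogonal s t v w : s != t -> zclass v -> zclass w ->
  zsol (coupled s) v -> zsol (coupled t) w -> \int[mu]_x (W x * v x * w x) = 0.
Proof.
move=> st zv zw sv sw.
have mC c : measurable_fun setT (coupled c).
  by apply: measurable_funD => //; exact: measurable_funM.
have Lv := zclass_mul_L12 zv (mC s) (decays_coupled s).
have Lw := zclass_mul_L12 zw (mC t) (decays_coupled t).
have iU := zclass_mul_integrable zv zw mU dU.
have iW := zclass_mul_integrable zv zw mW dW.
have ev k y := solution_newton k y zv (mC s) (decays_coupled s) sv.
have ew k y := solution_newton k y zw (mC t) (decays_coupled t) sw.
have iC c : mu.-integrable setT (EFin \o (fun x => U x * v x * w x + c * (W x * v x * w x))).
  have := integrableD measurableT iU (integrableZl measurableT c iW).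
  by apply: eq_integrable => // x _ /=; rewrite EFinD EFinM.
have i1 : mu.-integrable setT (fun x => (- (coupled t x * w x) * v x)%:E).
  have := integrableN (iC t); apply: eq_integrable => // x _ /=.
  by rewrite /coupled; congr EFin; ring.
have i2 : mu.-integrable setT (fun x => (- (coupled s x * v x) * w x)%:E).
  have := integrableN (iC s); apply: eq_integrable => // x _ /=.
  by rewrite /coupled; congr EFin; ring.
have := reciprocity n3 zv zw Lw Lv ev ew i1 i2.
move/(congr1 fine) => H; have {}H : \int[mu]_x (- (coupled t x * w x) * v x) =
    \int[mu]_x (- (coupled s x * v x) * w x) by exact: H.
have := RintegralB measurableT i1 i2; rewrite H subrr.
have -> : \int[mu]_x (- (coupled t x * w x) * v x - - (coupled s x * v x) * w x) =
    \int[mu]_x ((s - t) * (W x * v x * w x)).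
  by apply: eq_Rintegral => x _; rewrite /coupled; ring.
rewrite RintegralZl// => /eqP; rewrite mulf_eq0 subr_eq0 (negbTE st) => /eqP.
exact.
Qed.

Hypothesis W0 : forall x, 0 < W x.

Let X f := measurable_fun setT f /\ mu.-integrable setT (fun x => (W x * f x * f x)%:E).
Let ip f g : R := \int[mu]_x (W x * f x * g x).

Lemma weighted_integrable f g : X f -> X g ->
  mu.-integrable setT (fun x => (W x * f x * g x)%:E).
Proof.
move=> [mf If] [mg Ig].
apply: (@real_le_integrable _ _ _ mu _ (fun x => W x * f x * f x + W x * g x * g x)).
- by apply: measurable_funM => //; exact: measurable_funM.
- move=> x; rewrite -!mulrA -mulrDr normrM (gtr0_norm (W0 x)) ler_pM2l// normrM.
  rewrite -[f x * f x]/(f x ^+ 2) -[g x * g x]/(g x ^+ 2).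
  rewrite -(real_normK (num_real (f x))) -(real_normK (num_real (g x))).
  by have := sqr_ge0 (`|f x| - `|g x|); have := normr_ge0 (f x); have := normr_ge0 (g x);
    move: `|f x| `|g x| => a b; nra.
by have := integrableD measurableT If Ig; apply: eq_integrable.
Qed.

Let ipC f g : ip f g = ip g f.
Proof. by apply: eq_Rintegral => x _; ring. Qed.

Let ip_ge0 f : 0 <= ip f f.
Proof. by apply: Rintegral_ge0 => x _; rewrite -mulrA; apply: mulr_ge0; [exact: ltW|exact: sqr_ge0]. Qed.

Let X_sub f e c : X f -> X e -> X (fun x => f x - c * e x).
Proof.
move=> Xf Xe; have [mf If] := Xf; have [me Ie] := Xe; split.
  by apply: measurable_funB => //; exact: measurable_funM.
have Ife := weighted_integrable Xf Xe.
have := integrableD measurableT If (integrableD measurableT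
  (integrableZl measurableT (- (2 * c)) Ife) (integrableZl measurableT (c ^+ 2) Ie)).
by apply: eq_integrable => // x _; rewrite -!EFinM -!EFinD; congr EFin; ring.
Qed.

Let ip_sub f e c g : X f -> X e -> X g -> ip (fun x => f x - c * e x) g = ip f g - c * ip e g.
Proof.
move=> Xf Xe Xg; have i1 := weighted_integrable Xf Xg; have i2 := weighted_integrable Xe Xg.
rewrite /ip -RintegralZl// -RintegralB//.
  by apply: eq_Rintegral => x _; ring.
by have := integrableZl measurableT c i2; apply: eq_integrable => // x _; rewrite EFinM.
Qed.

(** Induction on the family: subtracting the component along its first vector lowers the squared
    norm by the square of that coefficient and leaves the other coefficients unchanged. *)
Lemma bessel (I : eqType) (s : seq I) (e : I -> rV -> R) f : uniq s -> X f ->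
  (forall i, i \in s -> X (e i) /\ ip (e i) (e i) = 1) ->
  (forall i j, i \in s -> j \in s -> i != j -> ip (e i) (e j) = 0) ->
  \sum_(i <- s) ip f (e i) ^+ 2 <= ip f f.
Proof.
elim: s f => [|i s IH] f us Xf hX orth; first by rewrite big_nil; exact: ip_ge0.
have [Xi n1] := hX i (mem_head _ _); move: us => /= /andP[nis us].
pose f' (x : rV) := f x - ip f (e i) * e i x.
have Xf' : X f' by exact: X_sub.
have sub j : j \in s -> j \in i :: s by rewrite in_cons orbC => ->.
have := IH f' us Xf' (fun j js => hX j (sub j js)) (fun j k js ks => orth j k (sub j js) (sub k ks)).
have -> : ip f' f' = ip f f - ip f (e i) ^+ 2.
  rewrite ip_sub// ipC ip_sub// (ipC (e i) f') ip_sub// n1 (ipC (e i) f); ring.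
have E : \sum_(j <- s) ip f' (e j) ^+ 2 = \sum_(j <- s) ip f (e j) ^+ 2.
  apply: eq_big_seq => j js; have [Xj _] := hX j (sub j js).
  rewrite ip_sub// orth ?mulr0 ?subr0//; [exact: mem_head|exact: sub|].
  by apply: contraNneq nis => ->.
by rewrite E big_cons; lra.
Qed.

Let bad p (N : nat) : set R := [set t | exists v, [/\ zclass v, zsol (coupled t) v,
  ip v v = 1 & N.+1%:R^-1 <= ip (\1_(rbox p)) v ^+ 2]].

Let X_zclass v : zclass v -> X v.
Proof. by move=> zv; have [mv _ _] := zv; split => //; exact: (zclass_mul_integrable zv zv mW dW). Qed.

Let X_rbox p : X (\1_(rbox p)).
Proof.
have [mi ii _] := @L12_indic_rbox R n p; split => //.
have [C C0 hC] := dW.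
have mWi : measurable_fun setT (fun x => W x * \1_(rbox p) x * \1_(rbox p) x).
  by apply: measurable_funM => //; exact: measurable_funM.
apply: (@real_le_integrable _ _ _ mu _ (fun x => C * \1_(rbox p) x)) => //.
  move=> x; rewrite indicE; case: (x \in _); rewrite ?mulr1 ?mulr0 ?normr0//.
  apply: le_trans (hC x) _; rewrite ler_piMr//.
  by rewrite -[leRHS](powRr0 (japanese x)); apply: le_powj; have := n3R; lra.
by have := integrableZl measurableT C ii; apply: eq_integrable => // x _ /=; rewrite EFinM.
Qed.

Lemma finite_bad p N : finite_set (bad p N).
Proof.
apply: contrapT => inf.
(* One more than Bessel's inequality permits: M / (N + 1) exceeds the squared norm of the indicator
   of the box. *)
pose M := (Num.truncn (N.+1%:R * ip (\1_(rbox p)) (\1_(rbox p)))).+1.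
have [B sB hB] := infinite_set_fset M inf.
have /choice[e he] : forall t, exists v, t \in B -> [/\ zclass v, zsol (coupled t) v,
    ip v v = 1 & N.+1%:R^-1 <= ip (\1_(rbox p)) v ^+ 2].
  move=> t; have [tB|tB] := boolP (t \in B); last by exists 0.
  by have [v hv] := sB t tB; exists v.
have := @bessel R (enum_fset B) e (\1_(rbox p)) (fset_uniq _) (X_rbox p).
have h1 i : i \in enum_fset B -> X (e i) /\ ip (e i) (e i) = 1.
  by move=> /he[zi _ ni _]; split => //; exact: X_zclass.
have h2 i j : i \in enum_fset B -> j \in enum_fset B -> i != j -> ip (e i) (e j) = 0.
  by move=> /he[zi si _ _] /he[zj sj _ _] ij; exact: solutions_orthogonal ij zi zj si sj.
move=> /(_ h1 h2); rewrite leNgt => /negP; apply.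
have : M%:R * N.+1%:R^-1 <= \sum_(i <- enum_fset B) ip (\1_(rbox p)) (e i) ^+ 2.
  apply: (@le_trans _ _ (\sum_(i <- enum_fset B) N.+1%:R^-1)).
    rewrite big_const_seq iter_addr_0 -[leRHS]mulr_natl ler_wpM2r ?invr_ge0// ler_nat.
    by rewrite count_predT.
  rewrite big_seq [leRHS]big_seq; apply: ler_sum => i /he[_ _ _]; exact.
apply: lt_le_trans; rewrite ltr_pdivlMr// mulrC; exact: truncnS_gt.
Qed.

(* Solutions for distinct couplings are orthogonal in L^2(W dx); by Bessel, a box
   and a threshold leave room for finitely many of them only. *)
Lemma countable_resonant_couplings : countable [set t | exists v, [/\ zclass v,
  zsol (coupled t) v & ~ {ae mu, forall x, v x = 0}]].
Proof.
apply: (@sub_countable _ _ _ (\bigcup_(q in [set: ({ffun 'I_n -> rat} * {ffun 'I_n -> rat}) * nat])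
    bad q.1 q.2)); last first.
  by apply: bigcup_countable => // q _; apply: finite_set_countable; exact: finite_bad.
apply: subset_card_le => t [v [zv sv nv]].
have Xv := X_zclass zv; have [mv Iv] := Xv.
have v1 : 0 < ip v v.
  rewrite lt_neqAle ip_ge0 andbT eq_sym; apply/eqP => v0; apply: nv.
  have : (\int[mu]_x `|(fun x => (W x * v x * v x)%:E) x| = 0)%E.
    rewrite -[LHS]fineK; last first.
      by apply: integrable_fin_num => //; exact: integrable_abse.
    suff -> : fine (\int[mu]_x `|(W x * v x * v x)%:E|)%E = ip v v by rewrite v0.
    apply: eq_Rintegral => x _ /=.
    by rewrite ger0_norm// -mulrA; apply: mulr_ge0; [exact: ltW|exact: sqr_ge0].
  move/(ae_eq_integral_abs mu measurableT (measurable_int _ Iv)).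
  apply: filterS => x /(_ I) [] /eqP; rewrite -mulrA mulf_eq0 gt_eqF//=.
  by rewrite mulf_eq0 orbb => /eqP.
(* If [v] were orthogonal to the indicators of all boxes, the integrals of [W v] over boxes would
   vanish, so [W v], and with it [v], would be null. *)
have [p np] : exists p, ip (\1_(rbox p)) v != 0.
  apply: contrapT => np; apply: nv.
  have ivW : mu.-integrable setT (fun x => (v x * W x)%:E).
    by apply: (zclass_integrable zv mW); have [C _ hC] := dW; exists C.
  have : ae_eq mu setT (fun x => (v x * W x)%:E) (cst 0%E).
    apply: rbox_ae_eq => //; first exact: integrable0.
    move=> p; rewrite integral0 integral_mkcond.
    have : ip (\1_(rbox p)) v = 0 by apply/eqP/negPn/negP => h; apply: np; exists p.
    have F : mu.-integrable setT (fun x => (W x * \1_(rbox p) x * v x)%:E).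
      exact: weighted_integrable (X_rbox p) Xv.
    move=> h; rewrite -[RHS]/(0%:E) -h /ip /Rintegral fineK ?integrable_fin_num//.
    apply: eq_integral => x _; rewrite patchE indicE; case: ifP => _; last by rewrite mulr0 mul0r.
    by rewrite mulr1 mulrC.
  apply: filterS => x /(_ I) [] /eqP; rewrite mulf_eq0 => /orP[/eqP//|].
  by rewrite gt_eqF.
pose c := (Num.sqrt (ip v v))^-1.
have c0 : 0 < c by rewrite invr_gt0 sqrtr_gt0.
pose w (x : rV) := c * v x.
have wE f : X f -> ip f w = c * ip f v.
  move=> Xf; rewrite /ip -RintegralZl//; last exact: weighted_integrable.
  by apply: eq_Rintegral => x _; rewrite mulrCA.
have zw : zclass w.
  have [_ i1 i2] := zv; split; first exact: measurable_funM.
    have := integrableZl measurableT c i1; apply: eq_integrable => // x _ /=.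
    by rewrite -EFinM mulrA.
  have := integrableZl measurableT (c ^+ 2) i2; apply: eq_integrable => // x _ /=.
  by rewrite -EFinM mulrA -exprMn.
have d0 : 0 < ip (\1_(rbox p)) w ^+ 2.
  by rewrite exprn_even_gt0//= wE ?mulf_neq0 ?(gt_eqF c0)//; exact: X_rbox.
exists (p, Num.truncn (ip (\1_(rbox p)) w ^+ 2)^-1) => //; exists w; split => //.
- move=> phi tphi; have := sv phi tphi; rewrite /w.
  have -> : \int[mu]_x (c * v x * (- laplacian phi x + coupled t x * phi x)) =
      \int[mu]_x (c * (v x * (- laplacian phi x + coupled t x * phi x))).
    by apply: eq_Rintegral => x _; rewrite mulrA.
  move=> h; rewrite RintegralZl ?h ?mulr0//.
  apply: (zsol_integrable zv _ (decays_coupled t) tphi).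
  by apply: measurable_funD => //; exact: measurable_funM.
- rewrite wE; last exact: X_zclass.
  rewrite ipC wE// mulrA -expr2 exprVn sqr_sqrtr ?ltW// mulVf// gt_eqF//.
- rewrite -[leRHS]invrK lef_pV2 ?posrE ?invr_gt0//; apply: ltW; exact: truncnS_gt.
Qed.

(** The exceptional couplings are countable, hence Lebesgue null, while the interval from 0 to [e]
    has measure [e]. *)
Lemma generic_coupling (e : R) : 0 < e -> exists t, [/\ 0 < t, t < e &
  forall v, zclass v -> zsol (coupled t) v -> {ae mu, forall x, v x = 0}].
Proof.
move=> e0; apply: contrapT => nt.
have := countable_lebesgue_measure0 countable_resonant_couplings.
have sub : `]0, e[%classic `<=` [set t | exists v, [/\ zclass v,
    zsol (coupled t) v & ~ {ae mu, forall x, v x = 0}]].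
  move=> t /=; rewrite in_itv /= => /andP[t0 te]; apply: contrapT => nv.
  by apply: nt; exists t; split => // v zv sv; apply: contrapT => h; apply: nv; exists v.
have : (lebesgue_measure (`]0%R, e[%classic : set R) = e%:E)%E.
  by rewrite lebesgue_measure_itv /= lte_fin e0 -EFinB subr0.
move=> h1 h2.
have := countable_lebesgue_measure0 (sub_countable (subset_card_le sub) countable_resonant_couplings).
by rewrite h1 => -[] e00; rewrite e00 ltxx in e0.
Qed.

End orthogonality.

End generic_coupling.

(** * Quasimodes and the resolvent *)

Section weighted_norms.
Context {R : realType} {n : nat}.
Local Notation rV := 'rV[R]_n.
Local Notation mu := (@leb R n).
Local Notation J m x := (japanese x `^ m).
Implicit Types (u f : rV -> R[i]).

Definition sqabs (z : R[i]) : R := complex.Re z ^+ 2 + complex.Im z ^+ 2.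

Definition sqnorm (m : R) u : \bar R := (\int[mu]_x (J (2 * m) x * sqabs (u x))%R%:E)%E.

Lemma sqabs_ge0 z : 0 <= sqabs z. Proof. by rewrite addr_ge0// sqr_ge0. Qed.

Lemma cabs_sqr z : cabs z ^+ 2 = sqabs z.
Proof. by case: z => a b; rewrite /cabs /= sqr_sqrtr// addr_ge0// sqr_ge0. Qed.

Lemma cabs_ge0 (z : R[i]) : 0 <= cabs z.
Proof. by case: z => a b; rewrite /cabs /= sqrtr_ge0. Qed.

Lemma measurable_sqabs u : cmeasurable u -> measurable_fun setT (fun x => sqabs (u x)).
Proof. by move=> [m1 m2]; apply: measurable_funD; exact: measurable_funX. Qed.

Lemma measurable_cabs u : cmeasurable u -> measurable_fun setT (fun x => cabs (u x)).
Proof.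
move=> mu0; rewrite (_ : (fun x => _) = (fun x => Num.sqrt (sqabs (u x)))).
  apply: (@measurableT_comp _ _ _ _ _ _ (@Num.sqrt R)); last exact: measurable_sqabs.
  exact: continuous_measurable_fun (@sqrt_continuous R).
by apply/funext => x; rewrite -cabs_sqr sqrtr_sqr ger0_norm// cabs_ge0.
Qed.

Lemma wnormE m u : wnorm m u = (sqnorm m u `^ 2^-1)%E.
Proof.
rewrite /wnorm unlock /Lnorm /sqnorm; congr (_ `^ _)%E; apply: eq_integral => x _.
rewrite abse_EFin poweR_EFin; congr EFin.
have c0 := cabs_ge0 (u x); have j0 := powR_ge0 (japanese x) m.
rewrite ger0_norm ?mulr_ge0// -[X in _ `^ X = _]/(2%:R) powR_mulrn ?mulr_ge0// exprMn cabs_sqr.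
by congr (_ * _); rewrite -powR_mulrn// -powRrM mulrC.
Qed.

Lemma sqnorm_ge0 m u : (0 <= sqnorm m u)%E.
Proof. by apply: integral_ge0 => x _; rewrite lee_fin mulr_ge0 ?powR_ge0 ?sqabs_ge0. Qed.

Lemma wnorm_lty m u : (wnorm m u < +oo)%E <-> (sqnorm m u < +oo)%E.
Proof.
rewrite wnormE; have := sqnorm_ge0 m u; case: (sqnorm m u) => [r| |]//= _; first by rewrite !ltry.
by rewrite ifF// invr_eq0 pnatr_eq0.
Qed.

Lemma H0_weighted_sqr m u : H0 m u ->
  mu.-integrable setT (EFin \o (fun x => complex.Re (u x) ^+ 2 * J (2 * m) x)) /\
  mu.-integrable setT (EFin \o (fun x => complex.Im (u x) ^+ 2 * J (2 * m) x)).
Proof.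
move=> [mu0 /wnorm_lty fin]; have [m1 m2] := mu0.
have mJ := @measurable_powj R n (2 * m).
have I : mu.-integrable setT (EFin \o (fun x => J (2 * m) x * sqabs (u x))).
  apply/integrableP; split.
    by apply/measurable_EFinP; apply: measurable_funM => //; exact: measurable_sqabs.
  apply: le_lt_trans fin; apply: ge0_le_integral => //=.
  - by apply/measurable_EFinP/measurableT_comp => //; apply: measurable_funM => //; exact: measurable_sqabs.
  - by apply/measurable_EFinP; apply: measurable_funM => //; exact: measurable_sqabs.
  - by move=> x _; rewrite lee_fin ger0_norm// mulr_ge0 ?powR_ge0 ?sqabs_ge0.
have pw (a b j : R) : 0 <= j -> `|a ^+ 2 * j| <= j * (a ^+ 2 + b ^+ 2) /\
    `|b ^+ 2 * j| <= j * (a ^+ 2 + b ^+ 2).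
  move=> j0; have a0 := sqr_ge0 a; have b0 := sqr_ge0 b.
  have e1 : 0 <= a ^+ 2 * j by exact: mulr_ge0.
  have e2 : 0 <= b ^+ 2 * j by exact: mulr_ge0.
  by rewrite (ger0_norm e1) (ger0_norm e2) mulrDr; split; lra.
split; apply: real_le_integrable I.
- by apply: measurable_funM => //; exact: measurable_funX.
- by move=> x; have [] := pw (complex.Re (u x)) (complex.Im (u x)) _ (powR_ge0 (japanese x) (2 * m)).
- by apply: measurable_funM => //; exact: measurable_funX.
- by move=> x; have [] := pw (complex.Re (u x)) (complex.Im (u x)) _ (powR_ge0 (japanese x) (2 * m)).
Qed.

(** One has |v| <x>^(-n) <= v^2 <x>^(2m) + <x>^(-2n - 2m). The last term is integrable because n + 2
    m > 0, which follows from m > -3/2 and n >= 3. *)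
Lemma weighted_sqr_zclass m (v : rV -> R) : - (3 / 2) < m -> (3 <= n)%N -> measurable_fun setT v ->
  mu.-integrable setT (EFin \o (fun x => v x ^+ 2 * J (2 * m) x)) -> zclass v.
Proof.
move=> m3 n3 mv iv; have n3R : (3 : R) <= n%:R by rewrite ler_nat.
split => //.
- have eta : 0 < n%:R + 2 * m by lra.
  have iJ := @powj_integrable R n _ eta.
  apply: (@real_le_integrable _ _ _ mu _ (fun x => v x ^+ 2 * J (2 * m) x + J (- (n%:R + (n%:R + 2 * m))) x)).
  + by apply: measurable_funM => //; exact: measurable_powj.
  + move=> x; rewrite (_ : J (- n%:R) x = J m x * J (- n%:R - m) x); last first.
      by rewrite -powjD; congr powR; lra.
    have -> : J (2 * m) x = J m x ^+ 2 by rewrite expr2 -powjD; congr powR; lra.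
    have -> : J (- (n%:R + (n%:R + 2 * m))) x = J (- n%:R - m) x ^+ 2.
      by rewrite expr2 -powjD; congr powR; lra.
    have := powR_ge0 (japanese x) m; have := powR_ge0 (japanese x) (- n%:R - m).
    rewrite -(real_normK (num_real (v x))); move=> p q; rewrite !normrM (ger0_norm p) (ger0_norm q).
    move: p q (normr_ge0 (v x)); move: `|v x| (J m x) (J (- n%:R - m) x) => b j k k0 j0 b0.
    by rewrite mulrA -exprMn; have : 0 <= b * j by [exact: mulr_ge0]; move: (b * j) => c c0;
      have := sqr_ge0 (c - k); nra.
  by have := integrableD measurableT iv iJ; apply: eq_integrable.
- apply: real_le_integrable iv.
    by apply: measurable_funM; [exact: measurable_funX|exact: measurable_powj].
  move=> x; rewrite normrM !ger0_norm ?powR_ge0 ?sqr_ge0// ler_wpM2l ?sqr_ge0//.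
  by apply: le_powj; lra.
Qed.

Lemma sqnorm_ae0 m u : cmeasurable u -> {ae mu, forall x, complex.Re (u x) = 0} ->
  {ae mu, forall x, complex.Im (u x) = 0} -> sqnorm m u = 0%E.
Proof.
move=> mu0 r0 i0; rewrite /sqnorm (ae_eq_integral (cst 0%E))//; first exact: integral0.
  apply/measurable_EFinP; apply: measurable_funM; first exact: measurable_powj.
  exact: measurable_sqabs.
by apply: filterS2 r0 i0 => x r i _; rewrite /sqabs r i expr0n addr0 mulr0.
Qed.

Lemma schrodinger_zsol V u : schrodinger_eq V u (fun=> 0) ->
  zsol V (fun x => complex.Re (u x)) /\ zsol V (fun x => complex.Im (u x)).
Proof.
move=> H; split => phi tphi; have := H phi tphi; rewrite /pairing => -[h1 h2].
  by apply: (etrans h1); rewrite /Rintegral integral0_eq// => x _; rewrite mul0r.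
by apply: (etrans h2); rewrite /Rintegral integral0_eq// => x _; rewrite mul0r.
Qed.

Lemma no_zero_modes (V : rV -> R) : (3 <= n)%N ->
  (forall v, zclass v -> zsol V v -> {ae mu, forall x, v x = 0}) ->
  ~ zero_resonance V /\ ~ exists u, zero_eigenfunction V u.
Proof.
move=> n3 H.
have key m u : - (3 / 2) < m -> H0 m u -> schrodinger_eq V u (fun=> 0) ->
    {ae mu, forall x, complex.Re (u x) = 0} /\ {ae mu, forall x, complex.Im (u x) = 0}.
  move=> m3 hu /schrodinger_zsol[s1 s2]; have [[m1 m2] _] := hu.
  have [i1 i2] := H0_weighted_sqr hu.
  by split; apply: H => //; exact: weighted_sqr_zclass m3 n3 _ _.
split=> [[u [[s s0 hu] eqn nu _]]|[u [[hu _ eqn] nu]]].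
- have s3 : - (3 / 2) < - (3 / 2) + s by lra.
  have [r0 i0] := key _ _ s3 hu eqn; have [mu0 _] := hu.
  (* A null function belongs to every weighted space, in particular to the one that the definition
     of a resonance excludes for s = 1. *)
  apply: (nu 1) => //; split => //; apply/wnorm_lty.
  by rewrite sqnorm_ae0// ltry.
- have s3 : - (3 / 2) < 0 :> R by lra.
  have [r0 i0] := key _ _ s3 hu eqn; apply: nu.
  apply: filterS2 r0 i0 => x r i _; move: r i; case: (u x) => a b /= -> ->; reflexivity.
Qed.

Lemma wnorm_cauchy_schwarz m u f : cmeasurable u -> cmeasurable f ->
  (\int[mu]_x (cabs (u x) * cabs (f x))%R%:E <= wnorm (- m) u * wnorm m f)%E.
Proof.
move=> mu0 mf.
have m1 : measurable_fun setT (fun x => J (- m) x * cabs (u x)).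
  by apply: measurable_funM; [exact: measurable_powj|exact: measurable_cabs].
have m2 : measurable_fun setT (fun x => J m x * cabs (f x)).
  by apply: measurable_funM; [exact: measurable_powj|exact: measurable_cabs].
have e2 : 2^-1 + 2^-1 = 1 :> R by lra.
have H := @hoelder _ _ _ (lebesgue_rV n) _ _ 2 2 m1 m2 (ltr0Sn _ _) (ltr0Sn _ _) e2.
apply: (@le_trans _ _ ('N[lebesgue_rV n]_1[EFin \o ((fun x => J (- m) x * cabs (u x)) \*
  (fun x => J m x * cabs (f x)))%R])%E); last exact: H.
rewrite Lnorm1 le_eqVlt; apply/orP; left; apply/eqP.
apply: eq_integral => x _ /=; congr EFin.
have c1 := cabs_ge0 (u x); have c2 := cabs_ge0 (f x).
rewrite mulrACA powRN mulVf ?mul1r ?ger0_norm ?mulr_ge0//.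
by rewrite gt_eqF// powR_gt0// japanese_gt0.
Qed.

End weighted_norms.

(** * The potential, the quasimode and their uniform bounds *)

Section quasimode.
Context {R : realType} {n : nat}.
Local Notation rV := 'rV[R]_n.
Local Notation mu := (@leb R n).
Local Notation J m x := (japanese x `^ m).
Variables (i0 i1 : 'I_n) (l : nat).
Hypotheses (n3 : (3 <= n)%N) (i01 : i0 != i1) (l0 : (0 < l)%N).

(** On a harmonic polynomial of degree [l] times a radial function, the Laplacian acts as the radial
    Laplacian of dimension n + 2 l; [a] is the Newtonian exponent of that dimension. *)
Let a := (n + l.*2 - 2)%N.

Definition zero_state (x : rV) : R := harmP i0 i1 l x * profile a x.

Definition well (x : rV) : R := - 3 * a%:R ^+ 2 * nrm2 x ^+ a.-1 * profile a x ^+ 4.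

(** The W of the overview: radial, rapidly decaying, strictly positive so that its pairing detects
    null functions, and at most 1 so that t W perturbs the source by at most t |psi|. *)
Definition weight (x : rV) : R := profile a x ^+ 2.

Definition dilate (r : R) (x : rV) : R := cutoff (r^-1 *: x).

(** The plateau of [dilate (2 * r)] covers the support of [dilate r], so the shift by [lam] acts
    exactly on the quasimode. *)
Definition potential (r lam t : R) (x : rV) : R :=
  (well x + lam * dilate (2 * r) x) + t * weight x.

Definition quasimode (r : R) (x : rV) : R := zero_state x * dilate r x.

(** The commutator of minus the Laplacian with the cutoff, applied to [zero_state]; for t = 0 it is
    the whole error of the quasimode. *)
Definition commutator (r : R) (x : rV) : R := - (zero_state x * laplacian (dilate r) x
  + 2 * \sum_(i < n) 'D_(basis_vec i) zero_state x * 'D_(basis_vec i) (dilate r) x).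

Let n3R : (3 : R) <= n%:R. Proof. by rewrite ler_nat. Qed.
Let l1R : (1 : R) <= l%:R. Proof. by rewrite ler1n. Qed.
Let a2 : (a.+2 = n + l.*2)%N. Proof. by rewrite /a; lia. Qed.
Let aR : a%:R = n%:R + 2 * l%:R - 2 :> R.
Proof. by have := congr1 (fun k => k%:R : R) a2; rewrite -!natr1 natrD -mul2n natrM; lra. Qed.
Let a1R : a.-1%:R = a%:R - 1 :> R.
Proof.
have : (0 < a)%N by rewrite /a; lia.
by move=> h; rewrite -[in RHS](prednK h) -natr1; ring.
Qed.

Lemma sym_zero_state : sym (2 - n%:R - l%:R) zero_state.
Proof.
have := symM (sym_harm i0 i1 l).1 (@sym_profile R n a); apply: sym_le.
by rewrite aR; lra.
Qed.

(** The computed order is -2a - 2; it is relaxed to a value that suits the weight and the compactly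
    supported plateau as well. *)
Lemma sym_well : sym (- (n%:R + l%:R)) well.
Proof.
have := symM (symZ (- 3 * a%:R ^+ 2) (symX a.-1 (@sym_nrm2 R n))) (symX 4 (@sym_profile R n a)).
by apply: sym_le; rewrite a1R aR; have := n3R; have := l1R; lra.
Qed.

Lemma sym_weight : sym (- (n%:R + l%:R)) weight.
Proof.
have := symX 2 (@sym_profile R n a).
by apply: sym_le; rewrite aR; have := n3R; have := l1R; lra.
Qed.

Lemma sym_dilate (m r : R) : 0 < r -> sym m (dilate r).
Proof.
move=> r0; rewrite (_ : dilate r = fun x => cutoff (r^-1 *: x + 0)); last first.
  by apply/funext => x; rewrite addr0.
by apply: sym_affine; [rewrite invr_eq0 gt_eqF|exact: sym_cutoff].
Qed.

Lemma sym_potential (r lam t : R) : 0 < r -> sym (- (n%:R + l%:R)) (potential r lam t).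
Proof.
move=> r0; apply: symD; last exact: symZ sym_weight.
by apply: symD; [exact: sym_well|apply: symZ; apply: sym_dilate; rewrite mulr_gt0].
Qed.

Lemma sym_quasimode (m r : R) : 0 < r -> sym m (quasimode r).
Proof.
move=> r0; have := symM sym_zero_state (sym_dilate (m - (2 - n%:R - l%:R)) r0).
by apply: sym_le; lra.
Qed.

Lemma dilate_in (r : R) x : 0 < r -> nrm2 x <= r ^+ 2 -> dilate r x = 1.
Proof.
move=> r0 h; apply: cutoff_in; rewrite nrm2_scale exprVn.
by rewrite ler_pdivrMl ?exprn_gt0// mulr1.
Qed.

Lemma dilate_out (r : R) x : 0 < r -> 4 * r ^+ 2 <= nrm2 x -> dilate r x = 0.
Proof.
move=> r0 h; apply: cutoff_out; rewrite nrm2_scale exprVn.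
by rewrite ler_pdivlMl ?exprn_gt0// mulrC.
Qed.

Lemma dilate_mul (r : R) x : 0 < r -> dilate (2 * r) x * dilate r x = dilate r x.
Proof.
move=> r0; have [h|h] := leP (nrm2 x) (4 * r ^+ 2).
  rewrite dilate_in ?mul1r ?mulr_gt0//; move: h; move: (nrm2 x) => q; lra.
by rewrite (dilate_out r0 (ltW h)) mulr0.
Qed.

Lemma quasimode_test (r : R) : 0 < r -> test_function (quasimode r).
Proof.
move=> r0; apply: (@test_function_intro _ _ 0 (2 * r) _ (sym_quasimode 0 r0)) => x nx.
rewrite /quasimode dilate_out ?mulr0//.
move/ccubeP : nx => /existsNP[i /negP]; rewrite -ltNge => xi.
have xi2 : (2 * r) ^+ 2 <= x 0 i ^+ 2.
  rewrite -(real_normK (num_real (x 0 i))) ler_pXn2r// ?nnegrE ?mulr_ge0 ?(ltW r0)//.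
  exact: ltW.
rewrite (_ : 4 * _ = (2 * r) ^+ 2); last by rewrite exprMn; ring.
apply: (le_trans xi2); rewrite /nrm2 (bigD1 i)//= lerDl.
by apply: sumr_ge0 => j _; exact: sqr_ge0.
Qed.

Let ring_eq (v s d d2 D2 S w lam t : R) : d2 * d = d ->
  - (s * D2 + 2 * S + d * (v * s)) + (v + lam * d2 + t * w) * (s * d) - lam * (s * d) =
  - (s * D2 + 2 * S) + t * (w * (s * d)).
Proof.
move=> h; have e : lam * d2 * (s * d) = lam * s * (d2 * d) by ring.
by rewrite !mulrDl e h; ring.
Qed.

(** The well cancels the Laplacian of [zero_state], and by [dilate_mul] the plateau cancels [lam];
    derivatives of the cutoff and the term with [t] remain. *)
Lemma quasimode_eq (r lam t : R) x : 0 < r ->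
  - laplacian (quasimode r) x + potential r lam t x * quasimode r x - lam * quasimode r x =
  commutator r x + t * (weight x * quasimode r x).
Proof.
move=> r0; have H := laplacianM x sym_zero_state (sym_dilate 0 r0).
have H0 := laplacian_harm_profile i01 x a2.
have -> : laplacian (quasimode r) x = zero_state x * laplacian (dilate r) x
  + 2 * (\sum_(i < n) 'D_(basis_vec i) zero_state x * 'D_(basis_vec i) (dilate r) x)
  + dilate r x * (well x * zero_state x).
  by apply: (etrans H); congr (_ + _ * _); exact: H0.
exact: ring_eq (dilate_mul x r0).
Qed.

Let comb_bound (A B C1 C2 j : R) (S : R) (z : R) : `|z| <= A * j -> `|S| <= B * j ->
  0 <= j -> `|- (z + 2 * S)| <= (A + 2 * B) * j.
Proof.
move=> h1 h2 j0; rewrite normrN; apply: le_trans (ler_normD _ _) _.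
by rewrite [leRHS]mulrDl lerD// normrM ger0_norm// -mulrA ler_pM2l.
Qed.

Lemma commutator_bound : exists2 C, 0 <= C & forall (r : R) x, 1 <= r ->
  `|commutator r x| <= C * J (- (n%:R + l%:R)) x.
Proof.
have [B B0 hB] := @cutoff_scale_unif R n.
have [A0 A00 hA0] := sym_bnd sym_zero_state.
have /choice[A1 hA1] : forall i : 'I_n, exists A, 0 <= A /\
    forall x, `|'D_(basis_vec i) zero_state x| <= A * J (2 - n%:R - l%:R - 1) x.
  by move=> i; have [A ? h] := sym_bnd (sym_d i sym_zero_state); exists A.
exists (A0 * B + 2 * (\sum_i A1 i * B)).
  rewrite addr_ge0 ?mulr_ge0//; apply: sumr_ge0 => i _; apply: mulr_ge0 => //.
  by case: (hA1 i).
move=> r x r1; have [b0 b1 b2] := hB r x r1.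
have e1 : J (2 - n%:R - l%:R) x * J (- 2) x = J (- (n%:R + l%:R)) x.
  by rewrite -powjD; congr powR; ring.
have e2 : J (2 - n%:R - l%:R - 1) x * J (- 1) x = J (- (n%:R + l%:R)) x.
  by rewrite -powjD; congr powR; ring.
apply: comb_bound (powR_ge0 _ _) => //.
  by rewrite normrM -e1 mulrACA; exact: ler_pM.
rewrite mulr_suml; apply: (le_trans (ler_norm_sum _ _ _)); apply: ler_sum => i _.
by rewrite normrM -e2 mulrACA; apply: ler_pM => //; case: (hA1 i).
Qed.

Lemma commutator_in (r : R) x : 0 < r -> nrm2 x < r ^+ 2 -> commutator r x = 0.
Proof.
move=> r0 xr; have xk : nrm2 (r^-1 *: x) < 1.
  by rewrite nrm2_scale exprVn ltr_pdivrMl ?exprn_gt0// mulr1.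
have sm : smooth (@cutoff R n) by exact: sym_smooth (sym_cutoff 0).
have dchi s : (0 < size s)%N -> partials s (dilate r) x = 0.
  move=> hs; apply: (etrans (partials_scale r^-1 s x sm)).
  apply: (etrans (congr1 (fun t => r^-1 ^+ size s * t) (cutoff_partials_in xk hs))).
  exact: mulr0.
have lchi : laplacian (dilate r) x = 0 by apply: big1 => i _; exact: (dchi [:: i; i]).
rewrite /commutator lchi mulr0 add0r big1 ?mulr0 ?oppr0// => i _.
by rewrite (dchi [:: i] isT : 'D_(basis_vec i) (dilate r) x = 0) mulr0.
Qed.

Lemma radial_potential (r lam t : R) : radial (potential r lam t).
Proof.
move=> x y xy; have q : nrm2 x = nrm2 y by rewrite -!enorm2 xy.
have c z w : nrm2 z = nrm2 w -> dilate (2 * r) z = dilate (2 * r) w.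
  by move=> h; rewrite /dilate /cutoff /flat_ball !nrm2_scale h.
by rewrite /potential (c _ _ q) /well /weight /profile q.
Qed.

Lemma partialsD m m' (f g : rV -> R) (s : seq 'I_n) : sym m f -> sym m' g ->
  partials s (fun x => f x + g x) = (fun x => partials s f x + partials s g x).
Proof.
move=> sf sg; elim: s => [//|i s IH].
have -> : partials (i :: s) (fun x => f x + g x) =
  'D_(basis_vec i) (partials s (fun x => f x + g x)) by [].
rewrite IH; exact: sym_dD (sym_partials s sf) (sym_partials s sg).
Qed.

Lemma partialsZ m (f : rV -> R) (c : R) (s : seq 'I_n) : sym m f ->
  partials s (fun x => c * f x) = (fun x => c * partials s f x).
Proof.
move=> sf; elim: s => [//|i s IH].
have -> : partials (i :: s) (fun x => c * f x) =
  'D_(basis_vec i) (partials s (fun x => c * f x)) by [].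
rewrite IH; apply/funext => x.
by have [_ ->] := is_dZ c (sym_is_d i x (sym_partials s sf)).
Qed.

Lemma japanese_dilate (r : R) (x : rV) : 1 <= r -> japanese x <= r * japanese (r^-1 *: x).
Proof.
move=> r1; have r0 : 0 < r by apply: lt_le_trans r1.
rewrite -(@ler_pXn2r _ 2)// ?nnegrE ?mulr_ge0 ?(ltW r0) ?(ltW (japanese_gt0 _))//.
rewrite exprMn !japanese_sqr nrm2_scale mulrDr mulr1 mulrA -exprMn divff ?gt_eqF//.
by rewrite expr1n mul1r lerD2r exprn_ege1.
Qed.

Let dilate_arith (D lam X q c Y rp tp : R) : 0 <= X -> 0 <= lam -> 0 <= D -> 0 <= q ->
  0 <= c -> 0 <= Y -> 0 <= rp -> 0 <= tp -> c <= 1 -> Y * q <= D -> X <= tp * rp * Y ->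
  lam * rp <= 1 -> lam * (X * (c * q)) <= D * tp.
Proof.
move=> X0 l0' D0 q0 c0 Y0 rp0 tp0 c1 YqD XY lrp.
apply: (@le_trans _ _ (lam * (X * q))).
  rewrite ler_wpM2l// ler_wpM2l//; exact: ler_piMl.
apply: (@le_trans _ _ (lam * (tp * rp * Y * q))).
  by rewrite ler_wpM2l// ler_wpM2r.
have -> : lam * (tp * rp * Y * q) = (lam * rp) * (tp * (Y * q)) by ring.
apply: (@le_trans _ _ (1 * (tp * (Y * q)))).
  by rewrite ler_wpM2r// mulr_ge0// mulr_ge0.
by rewrite mul1r mulrC ler_wpM2r.
Qed.

Let bound_arith (A B D X lam t u v w : R) : 0 <= X -> 0 <= lam -> 0 <= t -> t <= 1 ->
  X * `|u| <= A -> lam * (X * `|v|) <= D -> X * `|w| <= B ->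
  `|X * (u + lam * v + t * w)| <= A + D + B.
Proof.
move=> X0 l0' t0 t1 h1 h2 h3; rewrite normrM (ger0_norm X0).
apply: (@le_trans _ _ (X * (`|u| + lam * `|v| + t * `|w|))).
  rewrite ler_wpM2l//; apply: le_trans (ler_normD _ _) _; apply: lerD.
    by apply: le_trans (ler_normD _ _) _; rewrite lerD// normrM ger0_norm.
  by rewrite normrM ger0_norm.
rewrite !mulrDr; apply: lerD; first by apply: lerD => //; rewrite mulrCA.
rewrite mulrCA; apply: le_trans h3; rewrite ler_piMl// mulr_ge0//.
Qed.

Let weight_kill (p c E q : R) (y : rV) : 0 <= E -> c <= - p -> `|q| <= E * J c y ->
  J p y * `|q| <= E.
Proof.
move=> E0 cp h; apply: (@le_trans _ _ (J p y * (E * J (- p) y))).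
  apply: ler_wpM2l; first exact: powR_ge0.
  by apply: le_trans h _; apply: ler_wpM2l => //; exact: le_powj.
by rewrite mulrCA -powjD subrr powRr0 mulr1.
Qed.

(** Well and weight decay faster than <x>^(-p), as p <= l. For the plateau, <x>^p <= (2r)^p
    <x/(2r)>^p: the cutoff, being of order -p as well, absorbs the bracket, and lam r^p <= 1 absorbs
    the power of r. *)
Lemma potential_bounds (s : seq 'I_n) (p : R) : 0 <= p -> p <= l%:R -> exists2 C, 0 <= C &
  forall (r lam t : R) (x : rV), 1 <= r -> 0 <= lam -> lam * r `^ p <= 1 -> 0 <= t <= 1 ->
  `|J p x * partials s (potential r lam t) x| <= C.
Proof.
move=> p0 pl.
have [A A0 hA] := sym_bnd (sym_partials s sym_well).
have [B B0 hB] := sym_bnd (sym_partials s sym_weight).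
have [D D0 hD] := sym_bnd (sym_partials s (@sym_cutoff R n (- p))).
exists (A + D * 2 `^ p + B); first by rewrite !addr_ge0// mulr_ge0// powR_ge0.
move=> r lam t x r1 lam0 lamr /andP[t0 t1].
have r0 : 0 < r by apply: lt_le_trans r1.
have s2 : sym 0 (dilate (2 * r)) by apply: sym_dilate; rewrite mulr_gt0.
have sz : 0 <= (size s)%:R :> R by [].
have -> : partials s (potential r lam t) x =
    partials s well x + lam * partials s (dilate (2 * r)) x + t * partials s weight x.
  rewrite /potential (partialsD s (symD (sym_le _ sym_well) (symZ lam s2)) (symZ t sym_weight)).
    rewrite (partialsD s sym_well (symZ lam s2)).
    by rewrite (partialsZ lam s s2) (partialsZ t s sym_weight).
  by have := n3R; have := l1R; lra.
have J0 : 0 <= J p x by exact: powR_ge0.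
have kill := weight_kill (p := p).
have h1 : J p x * `|partials s well x| <= A.
  by apply: kill A0 _ (hA x); have := n3R; lra.
have h3 : J p x * `|partials s weight x| <= B.
  by apply: kill B0 _ (hB x); have := n3R; lra.
have h2 : lam * (J p x * `|partials s (dilate (2 * r)) x|) <= D * 2 `^ p.
  have r2 : 1 <= 2 * r by lra.
  have r20 : 0 < 2 * r by lra.
  rewrite /dilate (partials_scale _ _ _ (sym_smooth (sym_cutoff 0))).
  set y := (2 * r)^-1 *: x; have k := kill _ D (partials s cutoff y) y D0 _ (hD y).
  have {}k : J p y * `|partials s cutoff y| <= D by apply: k; lra.
  have jx : J p x <= (2 * r) `^ p * J p y.
    rewrite -powRM ?(ltW r20) ?(ltW (japanese_gt0 _))//.
    by apply: powR_le2 => //; [exact: ltW (japanese_gt0 _)|exact: japanese_dilate].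
  have c1 : `|(2 * r)^-1 ^+ size s| <= 1.
    rewrite ger0_norm ?exprn_ge0 ?invr_ge0 ?(ltW r20)//.
    by rewrite exprn_ile1 ?invr_ge0 ?(ltW r20)// invf_le1.
  rewrite normrM; move: c1 k jx lamr; rewrite powRM ?(ltW r0)//.
  have := powR_ge0 2 p; have := powR_ge0 r p; have := powR_ge0 (japanese y) p.
  move: (normr_ge0 (partials s cutoff y)) (normr_ge0 ((2 * r)^-1 ^+ size s)).
  move: `|partials s cutoff y| `|(2 * r)^-1 ^+ size s| (J p y) (r `^ p) (2 `^ p) J0 lam0 D0.
  move: (J p x); exact: dilate_arith.
apply: (bound_arith J0 lam0 t0 t1 h1 h2 h3).
Qed.

End quasimode.

Local Open Scope complex_scope.

(** * The source term and the lower bound for the resolvent *)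

Section resolvent_bound.
Context {R : realType} {n : nat}.
Local Notation rV := 'rV[R]_n.
Local Notation mu := (@leb R n).
Local Notation J m x := (japanese x `^ m).
Variables (i0 i1 : 'I_n) (l : nat).
Hypotheses (n3 : (3 <= n)%N) (i01 : i0 != i1) (l0 : (0 < l)%N).

Local Notation state := (@zero_state R n i0 i1 l).
Local Notation quasi := (@quasimode R n i0 i1 l).
Local Notation comm := (@commutator R n i0 i1 l).
Local Notation wgt := (@weight R n l).
Local Notation pot := (@potential R n l).

(* The image of the quasimode under H - (lam + i theta). *)
Definition source (r t theta : R) (x : rV) : R[i] :=
  Complex (comm r x + t * (wgt x * quasi r x)) (- (theta * quasi r x)).

Let n3R : (3 : R) <= n%:R. Proof. by rewrite ler_nat. Qed.

Lemma sym_measurable m (f : rV -> R) : sym m f -> measurable_fun setT f.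
Proof. by move=> /sym_cont; exact: continuous_measurable_rV. Qed.

Lemma sym_integrable (f g : rV -> R) (C : R) : sym (- (n%:R + 1)) f -> measurable_fun setT g ->
  (forall x, `|g x| <= C) -> mu.-integrable setT (EFin \o (fun x => f x * g x)).
Proof.
move=> sf mg gC; have [A A0 hA] := sym_bnd sf.
have C0 : 0 <= C by apply: le_trans (gC 0).
apply: (@real_le_integrable _ _ _ mu _ (fun x => A * C * J (- (n%:R + 1)) x)).
- by apply: measurable_funM => //; exact: sym_measurable sf.
- by move=> x; rewrite normrM mulrAC; apply: ler_pM.
have := integrableZl measurableT (A * C) (@powj_integrable R n 1 ltr01).
by apply: eq_integrable => // x _; rewrite /= EFinM.
Qed.

Lemma sym_decays m (f : rV -> R) : m <= - n%:R -> sym m f -> decays f.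
Proof.
move=> mn sf; have [A A0 hA] := sym_bnd sf; exists A => // x.
by apply: le_trans (hA x) _; rewrite ler_wpM2l//; exact: le_powj.
Qed.

Lemma zclass_sym_integrable (v f : rV -> R) : zclass v -> sym (- n%:R) f ->
  mu.-integrable setT (EFin \o (fun x => v x * f x)).
Proof.
move=> zv sf; apply: (zclass_integrable zv (sym_measurable sf)).
by have [C _ hC] := sym_bnd sf; exists C.
Qed.

Lemma sym_source_re (r lam t : R) (m : R) : 0 < r ->
  sym m (fun x => comm r x + t * (wgt x * quasi r x)).
Proof.
move=> r0.
(* [quasimode_eq] with lam = 0 exhibits this function as the image of a compactly supported one,
   hence of every order. *)
rewrite (_ : (fun x => _) = (fun x => - laplacian (quasi r) x + pot r 0 t x * quasi r x
   - 0 * quasi r x)); last first.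
  by apply/funext => x; rewrite (quasimode_eq n3 i01 l0).
apply: symB; last by apply: symZ; exact: sym_quasimode.
apply: symD.
  apply: symN; have := sym_laplacian (@sym_quasimode R n i0 i1 l n3 i01 l0 (m + 2) r r0).
  by apply: sym_le; lra.
have := symM (sym_potential n3 i01 l0 0 t r0) (@sym_quasimode R n i0 i1 l n3 i01 l0 (m + n%:R + l%:R) r r0).
by apply: sym_le; lra.
Qed.

Lemma cmeasurable_source (r t theta : R) : 0 < r -> cmeasurable (source r t theta).
Proof.
move=> r0; split; first exact: (sym_measurable (sym_source_re 0 t 0 r0)).
exact: (sym_measurable (symN (symZ theta (@sym_quasimode R n i0 i1 l n3 i01 l0 0 r r0)))).
Qed.

Lemma quasimode_bound : exists2 C, 0 <= C & forall (r : R) x, 1 <= r ->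
  `|quasi r x| <= C * J (2 - n%:R - l%:R) x.
Proof.
have [B B0 hB] := @cutoff_scale_unif R n.
have [A A0 hA] := sym_bnd (@sym_zero_state R n i0 i1 l n3 i01 l0).
exists (A * B); first exact: mulr_ge0.
move=> r x r1; have [b0 _ _] := hB r x r1.
by rewrite normrM mulrAC; apply: ler_pM.
Qed.

Let sq_arith (c q t w theta e : R) : 0 <= t <= e -> 0 <= w <= 1 -> `|theta| <= e ->
  (c + t * (w * q)) ^+ 2 + (- (theta * q)) ^+ 2 <= 2 * c ^+ 2 + 3 * e ^+ 2 * q ^+ 2.
Proof.
move=> /andP[t0 te] /andP[w0 w1] th.
have e0 : 0 <= e by apply: le_trans te.
have h1 : (t * w) ^+ 2 <= e ^+ 2.
  by rewrite lerXn2r ?nnegrE ?mulr_ge0//; apply: le_trans te; exact: ler_piMr.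
have h2 : theta ^+ 2 <= e ^+ 2.
  by rewrite -(real_normK (num_real theta)) lerXn2r ?nnegrE.
have q0 := sqr_ge0 q.
have h3 := ler_wpM2r q0 h1; have h4 := ler_wpM2r q0 h2.
rewrite sqrrN exprMn; have := sqr_ge0 (c - t * w * q).
have -> : (c + t * (w * q)) ^+ 2 = 2 * c ^+ 2 + 2 * ((t * w) ^+ 2 * q ^+ 2) - (c - t * w * q) ^+ 2.
  by ring.
move: h3 h4; move: ((t * w) ^+ 2 * q ^+ 2) (theta ^+ 2 * q ^+ 2) ((c - t * w * q) ^+ 2) => u v y.
lra.
Qed.

Lemma source_bound (k b : R) : 1 <= b -> k + b <= l%:R -> exists2 K, 0 < K &
  forall r t theta e : R, 1 <= r -> 0 <= t <= e -> `|theta| <= e ->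
  (sqnorm k (source r t theta) <= (K * (r `^ (- (2 * b)) + e ^+ 2))%:E)%E.
Proof.
move=> b1 kbl; have [C C0 hC] := @commutator_bound R n i0 i1 l n3 i01 l0.
have [Q Q0 hQ] := quasimode_bound.
pose K0 := 2 * C ^+ 2 + 3 * Q ^+ 2 + 1.
have K00 : 0 < K0.
  by have := sqr_ge0 C; have := sqr_ge0 Q; rewrite /K0; move: (C ^+ 2) (Q ^+ 2) => u v; lra.
have iJ := @powj_integrable R n 1 ltr01.
pose I := \int[mu]_x J (- (n%:R + 1)) x.
have I0 : 0 <= I by apply: Rintegral_ge0 => x _; exact: powR_ge0.
exists (K0 * (I + 1)); first by rewrite mulr_gt0// ltr_wpDl.
move=> r t theta e r1 te th; have r0 : 0 < r by apply: lt_le_trans r1.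
have e0 : 0 <= e by apply: le_trans th.
set S := r `^ (- (2 * b)) + e ^+ 2.
have S0 : 0 <= S by rewrite addr_ge0 ?powR_ge0 ?sqr_ge0.
have ms := measurable_sqabs (cmeasurable_source t theta r0).
have mJ := @measurable_powj R n.
apply: (@le_trans _ _ (\int[mu]_x ((K0 * S)%:E * (J (- (n%:R + 1)) x)%:E))%E); last first.
  rewrite integralZl//.
  have -> : (\int[mu]_x (J (- (n%:R + 1)) x)%:E = I%:E)%E.
    by rewrite /I /Rintegral fineK//; exact: integrable_fin_num.
  rewrite -EFinM lee_fin [leRHS]mulrAC ler_wpM2l ?mulr_ge0 ?(ltW K00)//.
  by rewrite lerDl.
apply: ge0_le_integral => //.
- by move=> x _; rewrite lee_fin mulr_ge0 ?powR_ge0 ?sqabs_ge0.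
- by apply/measurable_EFinP; apply: measurable_funM.
- by apply: emeasurable_funM => //; apply/measurable_EFinP.
move=> x _; rewrite -EFinM lee_fin.
have w01 : 0 <= wgt x <= 1.
  rewrite /weight sqr_ge0 exprn_ile1 ?profile_le1//; exact: ltW (profile_gt0 _ _).
have J0 m : 0 <= J m x by exact: powR_ge0.
have h := sq_arith (comm r x) (quasi r x) te w01 th.
apply: (@le_trans _ _ (J (2 * k) x * (2 * comm r x ^+ 2 + 3 * e ^+ 2 * quasi r x ^+ 2))).
  exact: ler_wpM2l.
have hq : J (2 * k) x * quasi r x ^+ 2 <= Q ^+ 2 * J (- (n%:R + 1)) x.
  apply: (@le_trans _ _ (J (2 * k) x * (Q * J (2 - n%:R - l%:R) x) ^+ 2)).
    apply: ler_wpM2l => //; rewrite -(real_normK (num_real (quasi r x))).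
    by apply: lerXn2r; rewrite ?nnegrE ?normr_ge0 ?mulr_ge0//; exact: hQ.
  rewrite exprMn mulrCA ler_wpM2l ?sqr_ge0// expr2 -!powjD.
  by apply: le_powj; have := n3R; lra.
have hc : J (2 * k) x * comm r x ^+ 2 <= C ^+ 2 * (r `^ (- (2 * b)) * J (- (n%:R + 1)) x).
  have [xr|xr] := ltP (nrm2 x) (r ^+ 2).
    by rewrite commutator_in// expr0n mulr0; do 2 apply: mulr_ge0 => //; rewrite ?sqr_ge0 ?powR_ge0.
  apply: (@le_trans _ _ (J (2 * k) x * (C * J (- (n%:R + l%:R)) x) ^+ 2)).
    apply: ler_wpM2l => //; rewrite -(real_normK (num_real (comm r x))).
    by apply: lerXn2r; rewrite ?nnegrE ?normr_ge0 ?mulr_ge0//; exact: hC.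
  rewrite exprMn mulrCA ler_wpM2l ?sqr_ge0// expr2 -!powjD.
  apply: (@le_trans _ _ (J (- (2 * b) - (n%:R + 1)) x)).
    by apply: le_powj; have := n3R; lra.
  rewrite powjD ler_wpM2r// !powRN lef_pV2 ?posrE ?powR_gt0 ?japanese_gt0//.
  apply: powR_le2; [lra|exact: ltW|].
  rewrite -(@ler_pXn2r _ 2)// ?nnegrE ?(ltW r0) ?(ltW (japanese_gt0 _))//.
  by rewrite japanese_sqr; apply: le_trans xr _; rewrite lerDr.
rewrite mulrDr [J _ x * (2 * _)]mulrCA [J _ x * (3 * _ * _)]mulrCA.
apply: (@le_trans _ _ (2 * (C ^+ 2 * (r `^ (- (2 * b)) * J (- (n%:R + 1)) x)) +
   3 * e ^+ 2 * (Q ^+ 2 * J (- (n%:R + 1)) x))).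
  apply: lerD; first by rewrite ler_pM2l.
  by apply: ler_wpM2l => //; rewrite mulr_ge0// sqr_ge0.
rewrite /S /K0; move: (J0 (- (n%:R + 1))) (powR_ge0 r (- (2 * b))) (sqr_ge0 e) (sqr_ge0 C) (sqr_ge0 Q).
move: (J (- (n%:R + 1)) x) (r `^ (- (2 * b))) (e ^+ 2) (C ^+ 2) (Q ^+ 2) => j p E2 C2 Q2.
move=> j0 p0 E0 C20 Q20.
have -> : 2 * (C2 * (p * j)) + 3 * E2 * (Q2 * j) = (2 * C2 * p + 3 * Q2 * E2) * j by ring.
rewrite ler_wpM2r//.
have h1 : 0 <= C2 * E2 by exact: mulr_ge0.
have h2 : 0 <= Q2 * p by exact: mulr_ge0.
have -> : (2 * C2 + 3 * Q2 + 1) * (p + E2) = 2 * C2 * p + 3 * Q2 * E2 + 2 * (C2 * E2) + 3 * (Q2 * p) + p + E2 by ring.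
lra.
Qed.

Lemma harm_axis (s : R) (k : nat) : harm i0 i1 k (s *: basis_vec i0 : rV) = (s ^+ k, 0).
Proof.
elim: k => [//|k IH] /=; rewrite IH /= !mxE !eqxx /= [i1 == i0]eq_sym (negbTE i01).
by rewrite !mulr0 !mulr1 !mul0r subr0 addr0 exprS.
Qed.

(** The constant must not depend on [r]. The fixed function [g] is supported in the unit ball, where
    the quasimode equals [state] for all r >= 1, so the mass of [state * g] gives the bound up to
    the supremum of [g]. *)
Lemma quasimode_mass : exists2 A, 0 < A & forall r : R, 1 <= r ->
  (A%:E <= \int[mu]_x (quasi r x ^+ 2)%:E)%E.
Proof.
have [B B0 hB] := sym_bnd (@sym_cutoff R n 0).
pose g (x : rV) : R := cutoff (2 *: x + 0).
have sg : sym 0 g by apply: sym_affine; [rewrite pnatr_eq0|exact: sym_cutoff].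
pose f (x : rV) : R := (state x * g x) ^+ 2.
have sf := symX 2 (symM (@sym_zero_state R n i0 i1 l n3 i01 l0) sg).
have fI : (0 < \int[mu]_x (f x)%:E)%E.
  (* On the axis [i0] the harmonic polynomial is s^l; at s = 1/2 it is nonzero and [g] is 1. *)
  apply: (@integral_continuous_gt0 _ _ f (2^-1 *: basis_vec i0)).
  - exact: sym_cont sf.
  - by move=> y; exact: sqr_ge0.
  rewrite /f exprn_even_gt0//= mulf_neq0//.
    rewrite /zero_state /harmP harm_axis/= mulf_neq0 ?expf_neq0 ?invr_neq0//.
    by rewrite gt_eqF// profile_gt0.
  rewrite /g addr0 scalerA divff// scale1r cutoff_in ?oner_neq0//.
  rewrite /nrm2 (bigD1 i0)//= big1 ?addr0 => [|j ji]; rewrite !mxE !eqxx /= ?expr1n//.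
  by rewrite (negbTE ji) expr0n.
(* The integral is only known to be a positive extended real; if it were infinite, 1 would serve as
   a real lower bound. *)
have [A0 A00 hA0] : exists2 A0 : R, 0 < A0 & (A0%:E <= \int[mu]_x (f x)%:E)%E.
  move: fI; case: (\int[mu]_x (f x)%:E)%E => [y|_|//]; last by exists 1; rewrite ?leey.
  by rewrite lte_fin => y0; exists y.
have B2 : 0 < B ^+ 2 + 1 by rewrite ltr_wpDl// sqr_ge0.
exists (A0 / (B ^+ 2 + 1)); first by rewrite divr_gt0.
move=> r r1; have r0 : 0 < r by apply: lt_le_trans r1.
have mq : measurable_fun setT (fun x => quasi r x ^+ 2).
  by apply: measurable_funX; exact: sym_measurable (@sym_quasimode R n i0 i1 l n3 i01 l0 0 r r0).
have : (A0%:E <= (B ^+ 2 + 1)%:E * \int[mu]_x (quasi r x ^+ 2)%:E)%E.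
  apply: le_trans hA0 _; rewrite -ge0_integralZl_EFin ?(ltW B2)//; first last.
  - exact/measurable_EFinP.
  - by move=> x _; rewrite lee_fin sqr_ge0.
  apply: ge0_le_integral => //.
  - by move=> x _; rewrite lee_fin sqr_ge0.
  - by apply/measurable_EFinP; exact: sym_measurable sf.
  - by apply/measurable_EFinP; exact: measurable_funM.
  move=> x _; have fE : f x = state x ^+ 2 * g x ^+ 2 by exact: exprMn.
  have qE : quasi r x ^+ 2 = state x ^+ 2 * dilate r x ^+ 2 by exact: exprMn.
  rewrite -EFinM lee_fin fE qE.
  have [x1|x1] := leP (nrm2 x) (r ^+ 2).
    rewrite dilate_in// expr1n mulr1 mulrC; apply: ler_wpM2r; first exact: sqr_ge0.
    apply: (@le_trans _ _ (B ^+ 2)); last by rewrite lerDl.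
    have : `|g x| <= B by have := hB (2 *: x + 0); rewrite powRr0 mulr1.
    move: (g x) => y yB; rewrite -(real_normK (num_real y)).
    by apply: lerXn2r; rewrite ?nnegrE.
  have g0 : g x = 0.
    rewrite /g addr0; apply: cutoff_out; rewrite nrm2_scale.
    have : 1 <= r ^+ 2 by rewrite exprn_ege1.
    by move: x1; move: (nrm2 x) (r ^+ 2) => v w; rewrite expr2; lra.
  rewrite g0 expr0n mulr0; apply: mulr_ge0; first exact: ltW.
  by apply: mulr_ge0; exact: sqr_ge0.
have : (0 <= \int[mu]_x (quasi r x ^+ 2)%:E)%E.
  by apply: integral_ge0 => x _; rewrite lee_fin sqr_ge0.
case: (\int[mu]_x (quasi r x ^+ 2)%:E)%E => [y _|_ _|//]; last by rewrite leey.
by rewrite -EFinM !lee_fin ler_pdivrMr// mulrC.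
Qed.

Lemma integral_test_eq (r lam t : R) phi : 0 < r -> test_function phi ->
  \int[mu]_x (quasi r x * (- laplacian phi x + pot r lam t x * phi x)) =
  \int[mu]_x ((- laplacian (quasi r) x + pot r lam t x * quasi r x) * phi x).
Proof.
move=> r0 tphi; have tq := @quasimode_test R n i0 i1 l n3 i01 l0 r r0.
have sq m := @sym_quasimode R n i0 i1 l n3 i01 l0 m r r0.
have sV := sym_potential n3 i01 l0 lam t r0.
have [B B0 hB] := test_bounded [::] tphi; have [A A0 hA] := laplacian_bounded tphi.
have mphi : measurable_fun setT phi by exact: (@smooth_measurable _ _ phi [::] tphi.1).
have i1' : mu.-integrable setT (EFin \o (fun x => quasi r x * laplacian phi x)).
  exact: sym_integrable (sq _) (laplacian_measurable tphi.1) hA.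
have i2 : mu.-integrable setT (EFin \o (fun x => laplacian (quasi r) x * phi x)).
  apply: sym_integrable mphi hB; have := sym_laplacian (sq (- (n%:R + 1) + 2)).
  by apply: sym_le; lra.
have i3 : mu.-integrable setT (EFin \o (fun x => (pot r lam t x * quasi r x) * phi x)).
  apply: sym_integrable mphi hB; have := symM sV (sq (l%:R - 1)).
  by apply: sym_le; lra.
have G : \int[mu]_x (quasi r x * laplacian phi x) = \int[mu]_x (laplacian (quasi r) x * phi x).
  rewrite (green tphi tq); apply: eq_Rintegral => x _; exact: mulrC.
have -> : \int[mu]_x (quasi r x * (- laplacian phi x + pot r lam t x * phi x)) =
    \int[mu]_x ((pot r lam t x * quasi r x) * phi x - quasi r x * laplacian phi x).
  apply: eq_Rintegral => x _; move: (quasi r x) (laplacian phi x) (pot r lam t x) (phi x) => a b c d.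
  by ring.
have -> : \int[mu]_x ((- laplacian (quasi r) x + pot r lam t x * quasi r x) * phi x) =
    \int[mu]_x ((pot r lam t x * quasi r x) * phi x - laplacian (quasi r) x * phi x).
  apply: eq_Rintegral => x _; move: (quasi r x) (laplacian (quasi r) x) (pot r lam t x) (phi x) => a b c d.
  by ring.
by rewrite !RintegralB// G.
Qed.

Lemma sqnorm_decay_lty (m : R) (u : rV -> R[i]) : cmeasurable u ->
  (exists2 C, 0 <= C & forall x, sqabs (u x) <= C * J (- (2 * m + n%:R + 1)) x) ->
  (sqnorm m u < +oo)%E.
Proof.
move=> mu0 [C C0 hC]; have := integrableZl measurableT C (@powj_integrable R n 1 ltr01).
move=> /integrableP[mC]; apply: le_lt_trans; apply: ge0_le_integral => //.
- by move=> x _; rewrite lee_fin mulr_ge0 ?powR_ge0 ?sqabs_ge0.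
- by apply/measurable_EFinP; apply: measurable_funM; [exact: measurable_powj|exact: measurable_sqabs].
- exact: measurableT_comp.
move=> x _; rewrite -EFinM abse_EFin lee_fin; apply: le_trans (ler_norm _).
apply: le_trans (ler_wpM2l (powR_ge0 _ _) (hC x)) _; rewrite mulrCA -powjD.
by rewrite ler_wpM2l//; apply: le_powj; lra.
Qed.

Let sym_real_L2 (f : rV -> R) : sym (- n%:R) f -> L2 (fun x => Complex (f x) 0).
Proof.
move=> sf; have m1 := sym_measurable sf; have cm : cmeasurable (fun x => Complex (f x) 0) by split.
split => //; apply/wnorm_lty; apply: (sqnorm_decay_lty cm).
have [A A0 hA] := sym_bnd sf; exists (A ^+ 2); first exact: sqr_ge0.
move=> x; rewrite /sqabs /= expr0n addr0 mulr0 add0r.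
apply: (@le_trans _ _ ((A * J (- n%:R) x) ^+ 2)).
  rewrite -(real_normK (num_real (f x))); apply: lerXn2r; rewrite ?nnegrE ?mulr_ge0 ?powR_ge0//.
rewrite exprMn ler_wpM2l ?sqr_ge0// expr2 -powjD; apply: le_powj; have := n3R; lra.
Qed.

(** The source lies in the range of H - z, so that [resolvent] does not fall back on its dummy
    value. *)
Lemma quasimode_graph (r lam t theta : R) : 0 < r ->
  operator_graph (pot r lam t) (fun x => Complex (quasi r x) 0)
    (fun x => source r t theta x + (Complex lam theta) * Complex (quasi r x) 0).
Proof.
move=> r0; have sq m := @sym_quasimode R n i0 i1 l n3 i01 l0 m r r0.
pose h (x : rV) : R := - laplacian (quasi r) x + pot r lam t x * quasi r x.
have -> : (fun x => source r t theta x + (Complex lam theta) * Complex (quasi r x) 0) =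
    (fun x => Complex (h x) 0).
  have key (c q h' : R) : h' - lam * q = c ->
      Complex c (- (theta * q)) + Complex lam theta * Complex q 0 = Complex h' 0.
    move=> <-; apply/eqP; rewrite eq_complex /= !mulr0 subr0 add0r mulrC addNr eqxx andbT.
    by rewrite mulrC subrK.
  by apply/funext => x; apply: key; exact: (quasimode_eq n3 i01 l0 lam t x r0).
have sh : sym (- n%:R) h.
  apply: symD.
    by apply: symN; have := sym_laplacian (sq (- n%:R + 2)); apply: sym_le; lra.
  by have := symM (sym_potential n3 i01 l0 lam t r0) (sq l%:R); apply: sym_le; lra.
split; [exact: sym_real_L2 (sq _)|exact: sym_real_L2 sh|].
move=> phi tphi; rewrite /pairing /=; congr Complex.
  exact: integral_test_eq.
by apply: eq_Rintegral => x _; rewrite !mul0r.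
Qed.

Let cs_arith (a b c d : R) : `|a * d + b * c| <= cabs (Complex a b) * cabs (Complex c d).
Proof.
rewrite -(@ler_pXn2r _ 2)// ?nnegrE ?mulr_ge0 ?cabs_ge0// exprMn !cabs_sqr real_normK ?num_real//.
rewrite /sqabs /= -subr_ge0.
have -> : (a ^+ 2 + b ^+ 2) * (c ^+ 2 + d ^+ 2) - (a * d + b * c) ^+ 2 = (a * c - b * d) ^+ 2 by ring.
exact: sqr_ge0.
Qed.

(** The quasimode is real, so testing with it and taking imaginary parts makes the terms with [lam]
    cancel and leaves: theta times the integral of psi^2 is minus the imaginary part of the integral
    of u f. The weighted Cauchy-Schwarz inequality finishes. [u] is any member of the graph, so the
    bound applies to the representative picked by [resolvent]. *)
Lemma resolvent_lower_bound (r lam t theta k : R) u : 0 < r ->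
  operator_graph (pot r lam t) u (fun x => source r t theta x + (Complex lam theta) * u x) ->
  (`|theta|%:E * \int[mu]_x (quasi r x ^+ 2)%:E <=
   wnorm (- k) u * wnorm k (source r t theta))%E.
Proof.
move=> r0 [hu _ eqn]; have sq m := @sym_quasimode R n i0 i1 l n3 i01 l0 m r r0.
have tq := @quasimode_test R n i0 i1 l n3 i01 l0 r r0.
have [[m1 m2] _] := hu; have cs := cmeasurable_source t theta r0.
pose e (x : rV) : R := comm r x + t * (wgt x * quasi r x).
have se : sym (- n%:R) e by exact: (sym_source_re 0 t _ r0).
have m3 : - (3 / 2) < 0 :> R by lra.
have [w1 w2] := H0_weighted_sqr hu.
have z1 := weighted_sqr_zclass m3 n3 m1 w1; have z2 := weighted_sqr_zclass m3 n3 m2 w2.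
pose h (x : rV) : R := - laplacian (quasi r) x + pot r lam t x * quasi r x.
have hE x : h x = e x + lam * quasi r x.
  by have := quasimode_eq n3 i01 l0 lam t x r0; rewrite -/(h x) -/(e x); lra.
have sh : sym (- n%:R) h.
  rewrite (_ : h = fun x => e x + lam * quasi r x); last by apply/funext.
  by apply: symD => //; apply: symZ; exact: sq.
have iq2 : mu.-integrable setT (EFin \o (fun x => quasi r x * quasi r x)).
  have [C _ hC] := sym_bnd (sq 0); apply: (sym_integrable (sq _) (sym_measurable (sq 0)) (C := C)).
  by move=> x; have := hC x; rewrite powRr0 mulr1.
have I1 := zclass_sym_integrable z2 sh.
have I2 := zclass_sym_integrable z2 (sq (- n%:R)).
have I3 := zclass_sym_integrable z1 (sq (- n%:R)).
have I4 := zclass_sym_integrable z2 se.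
pose a x := complex.Re (u x); pose b x := complex.Im (u x).
have E1 : \int[mu]_x (b x * h x) = \int[mu]_x
    (- theta * (quasi r x * quasi r x) + (lam * (b x * quasi r x) + theta * (a x * quasi r x))).
  have := congr1 (@complex.Im R) (eqn _ tq); rewrite /pairing /= => H.
  apply: (etrans H); apply: eq_Rintegral => x _; rewrite /a /b /source.
  case: (u x) => a' b' /=; move: (quasi r x) => q; ring.
have J1 := integrableZl measurableT (- theta) iq2.
have J2 := integrableZl measurableT lam I2.
have J3 := integrableZl measurableT theta I3.
have E2 : theta * \int[mu]_x (quasi r x * quasi r x) =
    - \int[mu]_x (a x * - (theta * quasi r x) + b x * e x).
  have -> : \int[mu]_x (a x * - (theta * quasi r x) + b x * e x) = \int[mu]_x (b x * h x -
      (lam * (b x * quasi r x) + theta * (a x * quasi r x))).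
    apply: eq_Rintegral => x _; rewrite hE; move: (a x) (b x) (e x) (quasi r x) => a' b' e' q.
    by ring.
  have J4 : mu.-integrable setT (EFin \o (fun x => lam * (b x * quasi r x) + theta * (a x * quasi r x))).
    have := integrableD measurableT J2 J3; exact: eq_integrable.
  have J1' : mu.-integrable setT (EFin \o (fun x => - theta * (quasi r x * quasi r x))).
    by apply: eq_integrable J1 => // x _; rewrite /= !EFinM.
  rewrite RintegralB// E1 RintegralD// RintegralZl// addrK mulNr.
  by rewrite opprK.
have gE x : `|a x * - (theta * quasi r x) + b x * e x| <= cabs (u x) * cabs (source r t theta x).
  by rewrite /source /a /b -/(e x); case: (u x) => a' b' /=; exact: cs_arith.
have ig : mu.-integrable setT (EFin \o (fun x => a x * - (theta * quasi r x) + b x * e x)).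
  have := integrableD measurableT (integrableZl measurableT (- theta) I3) I4.
  apply: eq_integrable => // x _ /=; rewrite -EFinM -EFinD; congr EFin.
  by rewrite /a /b; ring.
have cabsm : measurable_fun setT (fun x => cabs (u x) * cabs (source r t theta x)).
  by apply: measurable_funM; exact: measurable_cabs.
apply: le_trans (wnorm_cauchy_schwarz k hu.1 cs).
have -> : (\int[mu]_x (quasi r x ^+ 2)%:E = (\int[mu]_x (quasi r x * quasi r x))%R%:E)%E.
  by rewrite /Rintegral fineK//; exact: integrable_fin_num.
have q0 : 0 <= \int[mu]_x (quasi r x * quasi r x).
  by apply: Rintegral_ge0 => x _; exact: sqr_ge0.
rewrite -EFinM -{1}(ger0_norm q0) -normrM E2 normrN.
apply: (@le_trans _ _ (\int[mu]_x `|a x * - (theta * quasi r x) + b x * e x|%:E)%E).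
  have -> : (\int[mu]_x `|a x * - (theta * quasi r x) + b x * e x|%:E =
     (\int[mu]_x `|a x * - (theta * quasi r x) + b x * e x|)%R%:E)%E.
    by rewrite /Rintegral fineK//; apply: integrable_fin_num => //; exact: (integrable_abse ig).
  by rewrite lee_fin; exact: le_normr_Rintegral.
apply: ge0_le_integral => //.
- by have := measurable_int _ (integrable_abse ig).
- exact/measurable_EFinP.
- by move=> x _; rewrite lee_fin.
Qed.

End resolvent_bound.

(** * Comparison of the powers of the radius *)

Section parameters.
Context {R : realType}.

(** Used with [P] the norm of the source and [Q] that of the resolvent. Were Q <= L P, then e <= Q P
    <= L P^2 < e. Arguing by products covers P = 0 and infinite [Q]. *)
Lemma lt_of_product_bound (L P e : R) (Q : \bar R) : 0 < e -> 0 <= P -> L * P ^+ 2 < e ->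
  (e%:E <= Q * P%:E)%E -> ((L * P)%:E < Q)%E.
Proof.
move=> e0 P0 h; case: Q => [q| |] H; last 2 first.
- by rewrite ltry.
- move: P0 H; rewrite le_eqVlt => /orP[/eqP<-|P0].
    by rewrite mule0 lee_fin leNgt e0.
  by rewrite gt0_mulNye ?lte_fin// leeNy_eq.
move: H; rewrite -EFinM lee_fin => H; rewrite lte_fin ltNge; apply/negP => qL.
have := ler_wpM2r P0 qL; rewrite -mulrA -expr2 => /(le_trans H).
by rewrite leNgt h.
Qed.

Variables (r K A C0 : R) (alpha gam : nat).
Hypotheses (r1 : 1 < r) (K0 : 0 < K) (A0 : 0 < A) (rKA : 2 * K / A < r).
Hypotheses (alpha0 : (0 < alpha)%N) (gamC : alpha%:R * C0 <= gam%:R).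

(** The summand [alpha + 1] keeps eps strictly below lambda even for gam = 0; [gam] compensates the
    factor lambda^(-C0). *)
Let beta := (gam + alpha + 1)%N.

Let r0 : 0 < r. Proof. exact: lt_trans r1. Qed.

Lemma powR_inv_le (k : nat) : (0 < k)%N -> r `^ (- k%:R) <= r^-1.
Proof.
move=> k0; rewrite -[leRHS]powR_inv1 ?(ltW r0)//; apply: ler_powR; first exact: ltW.
by rewrite lerN2 ler1n.
Qed.

Lemma eps_lt_lambda : r `^ (- beta%:R) < r `^ (- alpha%:R).
Proof.
have -> : - beta%:R = - alpha%:R - gam.+1%:R :> R by rewrite /beta !natrD -natr1; ring.
rewrite powRD; last by rewrite (gt_eqF r0) implybT.
rewrite gtr_pMr ?powR_gt0//; apply: le_lt_trans (powR_inv_le _) _ => //.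
by rewrite invf_lt1.
Qed.

(** [F] stands for the squared norm of the source. Both terms of its bound equal eps^2, and r^gam
    eps <= 1/r leaves the factor 2 K / r, which is below [A] by the choice of [r]. *)
Lemma source_smaller (F : R) :
  F <= K * (r `^ (- (2 * beta%:R)) + (r `^ (- beta%:R)) ^+ 2) ->
  (r `^ (- alpha%:R)) `^ (- C0) * F < r `^ (- beta%:R) * A.
Proof.
set e := r `^ (- beta%:R) => hF.
have e0 : 0 < e by exact: powR_gt0.
have e2 : r `^ (- (2 * beta%:R)) = e ^+ 2.
  by rewrite /e -powR_mulrn ?powR_ge0// -powRrM; congr powR; ring.
rewrite e2 in hF.
have L1 : (r `^ (- alpha%:R)) `^ (- C0) <= r `^ gam%:R.
  by rewrite -powRrM mulrNN; apply: ler_powR => //; exact: ltW.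
have ge : r `^ gam%:R * e <= r^-1.
  rewrite /e -powRD; last by rewrite (gt_eqF r0) implybT.
  rewrite -[leRHS]powR_inv1 ?(ltW r0)//; apply: ler_powR; first exact: ltW.
  have : (1 : R) <= alpha%:R by rewrite ler1n.
  by rewrite /beta !natrD; lra.
apply: (@le_lt_trans _ _ (r `^ gam%:R * (K * (e ^+ 2 + e ^+ 2)))).
  apply: (@le_trans _ _ ((r `^ (- alpha%:R)) `^ (- C0) * (K * (e ^+ 2 + e ^+ 2)))).
    by rewrite ler_wpM2l ?powR_ge0.
  by rewrite ler_wpM2r// mulr_ge0 ?(ltW K0)// addr_ge0 ?sqr_ge0.
have -> : r `^ gam%:R * (K * (e ^+ 2 + e ^+ 2)) = e * (2 * K * (r `^ gam%:R * e)) by ring.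
rewrite ltr_pM2l//; apply: (@le_lt_trans _ _ (2 * K * r^-1)).
  by rewrite ler_wpM2l// mulr_ge0// ltW.
by rewrite ltr_pdivrMr// [A * r]mulrC -ltr_pdivrMr.
Qed.

End parameters.

(* The sign +- is (-1) ^+ sgn. *)
Theorem proposition1p21 (R : realType) (n : nat) (hn : (3 <= n)%N)
    (sgn : bool) (C0 sigma sigma0 : R)
    (hC0 : 0 < C0) (hsigma : 0 < sigma) (hsigma0 : 0 < sigma0) :
  exists (V : nat -> 'rV[R]_n -> R) (lambda eps : nat -> R)
         (f : nat -> 'rV[R]_n -> R[i]),
    (forall m, smooth (V m) /\ radial (V m)) /\
    (forall s : seq 'I_n,
      ereal_sup (range (fun m : nat =>
        'N[lebesgue_rV n]_(+oo%E)
          [(fun x => (japanese x `^ (1 + sigma0) * partials s (V m) x)%R%:E)]))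
        < +oo)%E /\
    (lambda @ \oo --> (0 : R)) /\ (eps @ \oo --> (0 : R)) /\
    (forall m, 0 < eps m < lambda m) /\
    (forall m, H0 (1 / 2 + sigma) (f m)) /\
    (forall m, ~ zero_resonance (V m) /\
               ~ exists u, zero_eigenfunction (V m) u) /\
    (forall m,
      ((lambda m `^ (- C0))%R%:E * wnorm (1 / 2 + sigma)%R (f m) <
       wnorm (- (1 / 2) - sigma)%R
         (resolvent (V m) (lambda m +i* ((-1) ^+ sgn * eps m)%R)%C (f m)))%E).
Proof.
pose i0 : 'I_n := Ordinal (ltnW (ltnW hn)); pose i1 : 'I_n := Ordinal (ltnW hn).
have i01 : i0 != i1 by [].
(* [alpha] gives lambda r^(1 + sigma0) <= 1, as [potential_bounds] requires; [gam] dominates alpha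
   C0; [l] exceeds k + beta, for the source, and 1 + sigma0, for the decay of the potential. *)
pose alpha := (Num.truncn (1 + sigma0)).+1.
pose gam := (Num.truncn (alpha%:R * C0)).+1.
pose beta := (gam + alpha + 1)%N.
pose k : R := 1 / 2 + sigma.
pose l := (Num.truncn (k + beta%:R + alpha%:R)).+1.
have l0 : (0 < l)%N by [].
have ha : 1 + sigma0 <= alpha%:R by rewrite ltW// truncnS_gt.
have hg : alpha%:R * C0 <= gam%:R by rewrite ltW// truncnS_gt.
have hl : k + beta%:R + alpha%:R <= l%:R by rewrite ltW// truncnS_gt.
have a0 : (0 : R) <= alpha%:R by [].
have b1 : (1 : R) <= beta%:R by rewrite ler1n /beta addn1.
have k0 : 0 <= k by rewrite /k; lra.
have kb : k + beta%:R <= l%:R by lra.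
have pl : 1 + sigma0 <= l%:R by lra.
have [K K0 hK] := @source_bound R n i0 i1 l hn i01 l0 k beta%:R b1 kb.
have [A A0 hA] := @quasimode_mass R n i0 i1 l hn i01 l0.
(* Every radius must exceed both 1 and 2 K / A, the latter to absorb the constants of the source and
   of the mass. *)
pose r0 : R := 2 + 2 * K / A.
have r02 : 2 <= r0 by rewrite lerDl divr_ge0 ?mulr_ge0// ltW.
pose r (m : nat) : R := m%:R + r0.
have m0 (m : nat) : (0 : R) <= m%:R by [].
have r1 m : 1 < r m by rewrite /r; have := m0 m; lra.
have r1' m : 1 <= r m by exact: ltW.
have rpos m : 0 < r m by exact: lt_trans (r1 m).
have rKA m : 2 * K / A < r m.
  by rewrite /r /r0; have := m0 m; move: (2 * K / A) => q; lra.
have rm m : (r m)^-1 <= m.+1%:R^-1.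
  by rewrite lef_pV2 ?posrE// /r -natr1; have := m0 m; lra.
pose lam m : R := r m `^ (- alpha%:R); pose eps m : R := r m `^ (- beta%:R).
have lam0 m : 0 < lam m by exact: powR_gt0.
have eps0 m : 0 < eps m by exact: powR_gt0.
have eps1 m : eps m <= 1.
  by rewrite -(powRr0 (r m)); apply: ler_powR => //; rewrite lerNl oppr0; lra.
have to0 (g : nat -> R) : (forall m, 0 <= g m) -> (forall m, g m <= (r m)^-1) -> g @ \oo --> 0.
  move=> g0 gr; apply: (@squeeze_cvgr _ _ _ _ (fun=> 0) (@harmonic R)).
  - by apply: nearW => m; rewrite g0 (le_trans (gr m)).
  - exact: cvg_cst.
  - exact: cvg_harmonic.
have n3R : (3 : R) <= n%:R by rewrite ler_nat.
have l0R : (0 : R) <= l%:R by [].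
(* The coupling is sought below [eps m], so that t W contributes to the source no more than the
   imaginary part of the spectral parameter does. *)
have /choice[t ht] : forall m, exists t, [/\ 0 < t, t < eps m &
    forall v, zclass v -> zsol (@potential R n l (r m) (lam m) t) v ->
      {ae (@leb R n), forall x, v x = 0}].
  move=> m; have sw := @sym_well R n i0 i1 l hn i01 l0.
  have sd := @sym_dilate R n (- n%:R) (2 * r m).
  have r20 : 0 < 2 * r m by rewrite mulr_gt0.
  have sU : sym (- n%:R) (fun x : 'rV[R]_n => well l x + lam m * dilate (2 * r m) x : R).
    by apply: symD; [apply: sym_le sw; lra|apply: symZ; exact: sd].
  have sW := @sym_weight R n i0 i1 l hn i01 l0.
  apply: (generic_coupling hn (sym_measurable sU) (sym_measurable sW)) => //.
  - exact: sym_decays sU.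
  - by apply: sym_decays sW; lra.
  - by move=> x; rewrite exprn_gt0// profile_gt0.
(* The sign enters through [theta] alone, and the estimates see only its absolute value. *)
pose theta m : R := (-1) ^+ sgn * eps m.
have th m : `|theta m| = eps m by rewrite normrM normr_sign mul1r ger0_norm// ltW.
exists (fun m => potential l (r m) (lam m) (t m)), lam, eps,
  (fun m => source i0 i1 l (r m) (t m) (theta m)).
have te m : 0 <= t m <= eps m by have [t0 t1 _] := ht m; rewrite !ltW.
have fb m : (sqnorm k (source i0 i1 l (r m) (t m) (theta m)) <=
    (K * (r m `^ (- (2 * beta%:R)) + eps m ^+ 2))%:E)%E.
  by apply: hK => //; rewrite th.
have cm m := @cmeasurable_source R n i0 i1 l hn i01 l0 (r m) (t m) (theta m) (rpos m).
split.
  move=> m; split; last exact: radial_potential.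
  exact: sym_smooth (@sym_potential R n i0 i1 l hn i01 l0 (r m) (lam m) (t m) (rpos m)).
split.
  move=> s; have p0 : 0 <= 1 + sigma0 by lra.
  have [C C1 hC] := @potential_bounds R n i0 i1 l hn i01 l0 s (1 + sigma0) p0 pl.
  apply: le_lt_trans (ltry C); apply: ge_ereal_sup => _ [m _ <-].
  rewrite unlock /Lnorm; case: ifP => _; last by rewrite lee_fin.
  apply/ess_supP; apply: aeW => x /=; rewrite lee_fin; apply: hC => //.
  - exact: ltW.
  - rewrite -powRD; last by rewrite (gt_eqF (rpos m)) implybT.
    by rewrite -[leRHS](powRr0 (r m)); apply: ler_powR => //; lra.
  - by have /andP[t0 t1] := te m; rewrite t0 (le_trans t1).
split; first by apply: to0 => m; [exact: ltW|exact: powR_inv_le].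
split; first by apply: to0 => m; [exact: ltW|apply: powR_inv_le => //; rewrite /beta addn1].
split; first by move=> m; rewrite eps0 eps_lt_lambda.
split.
  move=> m; split; first exact: cm.
  by apply/wnorm_lty; exact: le_lt_trans (fb m) (ltry _).
split; first by move=> m; have [_ _ h] := ht m; exact: no_zero_modes.
move=> m; set f := source _ _ _ _ _ _; set u := resolvent _ _ _.
have gu : operator_graph (potential l (r m) (lam m) (t m)) u
    (fun x => f x + Complex (lam m) (theta m) * u x).
  (* The quasimode is a witness, so [xget] returns an element of the set and not its default
     value. *)
  apply: (@xgetPex _ (fun=> 0) [set u | operator_graph (potential l (r m) (lam m) (t m)) u
    (fun x => f x + Complex (lam m) (theta m) * u x)]).
  by eexists; exact: (@quasimode_graph R n i0 i1 l hn i01 l0 (r m) (lam m) (t m) (theta m) (rpos m)).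
have H := @resolvent_lower_bound R n i0 i1 l hn i01 l0 (r m) (lam m) (t m) (theta m) k u (rpos m) gu.
have {}H : ((eps m * A)%:E <= wnorm (- k) u * wnorm k f)%E.
  apply: le_trans H; rewrite th EFinM; apply: lee_wpmul2l; first by rewrite lee_fin ltW.
  exact: hA.
have := fb m; rewrite -/f; have := sqnorm_ge0 k f; have := wnormE k f.
case: (sqnorm k f) => [F| |]//= wF; rewrite !lee_fin => F0 FK.
rewrite wF -opprD -EFinM; rewrite wF in H.
apply: lt_of_product_bound H; first by rewrite mulr_gt0.
  exact: powR_ge0.
(* The norm of the source is the square root of [F], so its square in [lt_of_product_bound] is
   [F]. *)
rewrite -powR_mulrn ?powR_ge0// -powRrM mulVf ?powRr1//.
by apply: (source_smaller (K := K) (gam := gam)) => //.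
Qed.
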